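(* For each $n\ge 1$ let $\sigma_a,\sigma_b$ be chosen independently and uniformly at random from the symmetric group $S_n$, and let $X=X_n$ be the genus $g$ of the resulting random origami made of $n$ unit squares. Let $E_n$ and $\sigma_n$ denote the expectation and the standard deviation of $X_n$. Then, as $n\to\infty$, $$E_n=-\tfrac12\bigl(\log n+\gamma+o(1)\bigr)+1+\tfrac12 n,$$ $$\sigma_n=\tfrac12\left(\sqrt{\log n}-\Bigl(\frac{\pi^2}{12}-\frac{\gamma}{2}\Bigr)\frac{1}{\sqrt{\log n}}+o\Bigl(\frac{1}{\sqrt{\log n}}\Bigr)\right),$$ where $\gamma$ is the Euler constant, and $X_n$ is asymptotically normally distributed, i.e. $(X_n-E_n)/\sigma_n$ converges in distribution to the standard normal distribution.
   Context: An origami made of $n$ unit squares is given by a pair $(\sigma_a,\sigma_b)\in S_n\times S_n$: take $n$ copies of the Euclidean unit square labelled $1,\dots,n$; glue by translation, for each $i$, the right edge of square $i$ to the left edge of square $\sigma_a(i)$, and the top edge of square $i$ to the bottom edge of square $\sigma_b(i)$. Let $E$ be the number of vertices after gluing (equivalence classes of corners of the squares), $K=2n$ the number of edges and $F=n$ the number of faces. The genus $g$ is determined by the Euler formula $2-2g=E-K+F$, i.e. $g=1+\tfrac12 n-\tfrac12E$. A randomly chosen origami is one with random gluings. *)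

(* Defs.v *)
From HB Require Import structures.
From mathcomp Require Import all_boot all_order all_algebra all_fingroup.
From mathcomp Require Import all_classical all_reals all_analysis.

Set Implicit Arguments.
Unset Strict Implicit.
Unset Printing Implicit Defensive.

Import Order.TTheory GRing.Theory Num.Theory.
Import numFieldNormedType.Exports.

Local Open Scope classical_set_scope.
Local Open Scope ring_scope.

(* A corner (i, r, t) of square i is on the right edge iff r = true, and on
   the top edge iff t = true. *)
Definition corner (n : nat) := ('I_n * bool * bool)%type.

(* The right edge of i goes to the left edge of sa i, the top edge of i to the
   bottom edge of sb i; being translations, these gluings preserve the other
   coordinate of a corner. *)
Definition glued n (sa sb : 'S_n) : rel (corner n) := fun c c' =>
  let: (i, r, t) := c in let: (i', r', t') := c' in
  [&& r, ~~ r', t == t' & i' == sa i] || [&& t, ~~ t', r == r' & i' == sb i].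

Definition corner_equiv n (sa sb : 'S_n) : rel (corner n) :=
  connect (fun c c' => glued sa sb c c' || glued sa sb c' c).

Definition vertices n (sa sb : 'S_n) : {set {set corner n}} :=
  equivalence_partition (corner_equiv sa sb) [set: corner n]%SET.

Definition euler_char n (sa sb : 'S_n) : int :=
  #|vertices sa sb|%:Z - (2 * n)%N%:Z + n%:Z.

(* The solution g of 2 - 2 g = E - K + F. The surface may be disconnected, so
   g need not be a natural number. *)
Definition genus (R : realType) n (sa sb : 'S_n) : R :=
  (2 - (euler_char sa sb)%:~R) / 2.

(* Permutations carry the discrete sigma-algebra. *)
HB.instance Definition _ (T : finType) := isPointed.Build (perm_type T) 1%g.
HB.instance Definition _ (T : finType) :=
  @isMeasurable.Build default_measure_display (perm_type T)
    discrete_measurable discrete_measurable0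
    discrete_measurableC discrete_measurableU.

Definition uniform_perm d (T : measurableType d) (R : realType)
    (P : probability T R) n (s : {RV P >-> 'S_n}) :=
  forall p : 'S_n, P (s @^-1` [set p]) = ((n`!)%:R^-1)%:E.

Definition independent_RV d d1 d2 (T : measurableType d)
    (T1 : measurableType d1) (T2 : measurableType d2) (R : realType)
    (P : probability T R) (X : {RV P >-> T1}) (Y : {RV P >-> T2}) :=
  forall A B, measurable A -> measurable B ->
    P (X @^-1` A `&` Y @^-1` B) = (P (X @^-1` A) * P (Y @^-1` B))%E.

Definition euler_gamma (R : realType) : R :=
  limn (fun n => series harmonic n - ln n%:R : R).

Definition stddev d (T : measurableType d) (R : realType)
    (P : probability T R) (X : T -> R) : R :=
  Num.sqrt (fine 'V_P[X]).

(* Pointwise convergence of the distribution functions at the continuity points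
   of the limiting one. The X n are raw functions, as for expectation; they are
   meant to be measurable. *)
Definition cvg_in_distribution (R : realType) (d : nat -> measure_display)
    (T : forall n, measurableType (d n)) (P : forall n, probability (T n) R)
    (X : forall n, T n -> R) (mu : set R -> \bar R) :=
  forall x : R, {for x, continuous (fun r : R => mu `]-oo, r]%classic)} ->
    P n (X n @^-1` `]-oo, x]) @[n --> \oo] --> mu `]-oo, x]%classic.

(* Main.v *)
(** Going around a vertex through the four squares that meet there shows that
the vertices of the origami are the cycles of a commutator of the two
permutations, so that the genus is 1 + n/2 - C/2 with C the number of cycles of
a commutator [a, b] of independent uniform permutations.

By Frobenius, the sum of x^C over all a and b is n! times the sum, over the
irreducible characters of S_n, of the content polynomials prod (x + c), where c
runs over the contents of the Young diagram. The trivial character yields the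
law of the number of cycles of a uniform permutation, a sum of independent
Bernoulli variables of parameters 1, 1/2, ..., 1/n. The sign character yields
prod (x - j), whose effect is negligible because it vanishes at 0 and 1. All
other diagrams or their transposes have their first row at least as long as
their first column and shorter than n, and even with x = 5/4 and all signs made
positive their total contribution is O(n! / sqrt n). Since (5/4)^k dominates
the bounded functions and k^2, expectation, variance and distribution of C
agree asymptotically with those of the uniform case: the mean is
H_n = ln n + gamma + o(1), the variance H_n - sum 1/k^2 = ln n + gamma - pi^2/6
+ o(1), and the central limit theorem follows by Stein's method.

The diagram of a character is found without Young's theory: its first row is
the largest size of a set B such that Sym B has a nonzero invariant vector, and
for B of this size the invariants of Sym B form an irreducible representation
of the symmetric group on the complement of B, which determines the character
and has the remaining rows as its diagram. *)

Require Import Defs.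
From HB Require Import structures.
From mathcomp Require Import all_boot all_order all_algebra all_fingroup.
From mathcomp Require Import all_field all_character.
From mathcomp Require Import all_classical all_reals all_analysis.
From mathcomp Require Import measurable_realfun ring lra zify.

Set Implicit Arguments.
Unset Strict Implicit.
Unset Printing Implicit Defensive.

Import Order.TTheory GRing.Theory Num.Theory.
Import numFieldNormedType.Exports.
(* Lets the names of finset take precedence over those of classical_sets. *)
Import mathcomp.boot.fintype mathcomp.boot.finset.

Local Open Scope ring_scope.

(** * Sums over symmetric groups *)

(** Both uses of a maximal set B rest on one relation. Let e be the sum of Sym B in the
    representation. Since Sym (B + k) has no invariants, the transpositions (i k) with i in B add up
    to -1 next to e. In the product of factors that gives the sum of x^C g this replaces x by x - 1
    for the points outside B, which is the shift of contents from one row to the next. It also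
    rewrites e g e in terms of the e s with s in Sym (A \ B), with coefficients that do not depend
    on the representation; hence the invariants are irreducible and determine the character.

    In the error bound, partitions of k number O((5/4)^k). If the first row m is below n/4, contents
    are below n/4, and n! >= (n/3)^n leaves (5/4 . 3/4)^n = (15/16)^n. Otherwise k = n - m <= 3n/4,
    and binomial(n, k) >= (n/k)^k leaves (15/16)^k, which is small unless k < n/4; there the terms
    decrease geometrically from order 1/sqrt n. This rate serves the variance, where squaring the
    mean multiplies its error by about 2 ln n. *)

Section SymSums.
Variable T : finType.
Implicit Types (A B D : {set T}) (g h s t : {perm T}).

Lemma SymP A g : reflect (forall x, x \notin A -> g x = x) (g \in Sym A).
Proof.
rewrite inE; apply: (iffP subsetP) => [gA x|gA x].
  by apply: contraNeq => ?; exact: gA.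
by rewrite inE; apply: contraNT => /gA ->.
Qed.

Lemma Sym_closed A g x : g \in Sym A -> (g x \in A) = (x \in A).
Proof. by rewrite inE => /perm_closed. Qed.

Lemma SymS A B : A \subset B -> Sym A \subset Sym B.
Proof.
move=> AB; apply/subsetP => g /SymP gA; apply/SymP => x xB.
by apply: gA; apply: contraNN xB; exact: subsetP.
Qed.

Lemma tperm_Sym A x y : x \in A -> y \in A -> tperm x y \in Sym A.
Proof.
move=> xA yA; apply/SymP => z zA.
by rewrite tpermD //; apply: contraNneq zA => <-.
Qed.

Lemma Sym_commute A B g h : [disjoint A & B] -> g \in Sym A -> h \in Sym B ->
  (g * h = h * g)%g.
Proof.
move=> AB /[1!inE] gA /[1!inE] hB.
by apply: (perm_onC gA hB).
Qed.

Section Decomposition.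
Variables (V : nmodType) (A : {set T}) (k : T).
Hypothesis kA : k \notin A.

Lemma SymU1_mulr h i : h \in Sym A -> i \in k |: A ->
  (tperm i k * h)%g \in Sym (k |: A).
Proof.
move=> hA iA; rewrite groupM ?tperm_Sym ?setU11 //.
by apply: (subsetP (SymS _)) hA; exact: subsetUr.
Qed.

Lemma Sym_fix h : h \in Sym A -> h k = k.
Proof. by move/SymP; apply. Qed.

(** The [tperm i k] represent the cosets of [Sym A] in [Sym (k |: A)], with [i] the preimage of [k];
    the case [i = k] is [Sym A] itself. *)
Lemma sum_SymU1l (F : {perm T} -> V) : \sum_(g in Sym (k |: A)) F g =
  \sum_(i in k |: A) \sum_(h in Sym A) F (tperm i k * h)%g.
Proof.
rewrite (partition_big (fun g => g^-1%g k) (mem (k |: A))) /=; last first.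
  by move=> g gA; rewrite (Sym_closed _ (groupVr gA)) setU11.
apply: eq_bigr => i iA.
rewrite (reindex_onto (fun h => (tperm i k * h)%g) (fun g => (tperm i k * g)%g)) /=.
  apply: eq_bigl => h; rewrite mulgA tperm2 mul1g eqxx andbT.
  apply/andP/idP => [[/SymP gA /eqP gk]|hA].
    apply/SymP => x xA; have [->|xk] := eqVneq x k.
      by have := congr1 (tperm i k * h)%g gk; rewrite permKV permM tpermL.
    have := gA (tperm i k x); rewrite permM tpermK.
    have [ix|ix] := eqVneq i x; last by rewrite tpermD // 1?eq_sym // => -> //; rewrite !inE negb_or xk.
    by move: iA; rewrite ix !inE (negbTE xk) (negbTE xA).
  by rewrite SymU1_mulr // invMg tpermV permM (Sym_fix (groupVr hA)) tpermR.
by move=> g _; rewrite mulgA tperm2 mul1g.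
Qed.

Lemma sum_SymU1r (F : {perm T} -> V) : \sum_(g in Sym (k |: A)) F g =
  \sum_(i in k |: A) \sum_(h in Sym A) F (h * tperm i k)%g.
Proof.
rewrite (reindex_inj (@invg_inj _)) /= (eq_bigl _ _ (fun g => groupV _ g)).
rewrite (sum_SymU1l (fun g => F g^-1%g)); apply: eq_bigr => i _.
rewrite (reindex_inj (@invg_inj _)) /= (eq_bigl _ _ (fun g => groupV _ g)).
by apply: eq_bigr => h _; rewrite invMg invgK tpermV.
Qed.

End Decomposition.

(* The number of cycles on A of a permutation g that fixes the complement of A. *)
Definition cycles A g := (#|porbits g| - #|~: A|)%N.

Lemma porbit_fix g x : g x = x -> porbit g x = [set x].
Proof.
move=> gx; apply/setP => y; rewrite inE; apply/porbitP/eqP => [[i ->]|->]; last first.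
  by exists 0%N; rewrite expg0 perm1.
by elim: i => [|i IH]; rewrite ?expg0 ?perm1 // expgSr permM IH.
Qed.

Lemma leq_porbits A g : g \in Sym A -> (#|~: A| <= #|porbits g|)%N.
Proof.
move/SymP=> gA; rewrite -(card_in_imset (f := fun x => porbit g x)).
  by apply/subset_leq_card/subsetP => _ /imsetP [x _ ->]; exact: imset_f.
by move=> x y; rewrite !inE => /gA gx /gA gy; rewrite !porbit_fix // => /set1_inj.
Qed.

Lemma cyclesU1 A k h : k \notin A -> h \in Sym A ->
  cycles (k |: A) h = (cycles A h).+1.
Proof.
move=> kA hA; rewrite /cycles setCU.
have -> : (#|~: A| = #|~: [set k] :&: ~: A|.+1)%N.
  by rewrite (cardsD1 k (~: A)) inE kA add1n setDE setIC.
have := leq_porbits hA.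
by rewrite (cardsD1 k (~: A)) inE kA add1n setDE setIC; lia.
Qed.

(** As [h] fixes [k], the transposition inserts [k] into the cycle of [i]. *)
Lemma cycles_tperm A k i h : k \notin A -> h \in Sym A -> i \in A ->
  cycles (k |: A) (tperm i k * h)%g = cycles A h.
Proof.
move=> kA hA iA.
have ik : i != k by apply: contraNneq kA => <-.
have := porbits_mul_tperm h i k; rewrite /= ik porbit_fix ?(SymP _ _ hA) // inE ik /=.
have := cyclesU1 kA hA; rewrite /cycles.
have := leq_porbits hA; move: #|porbits (tperm i k * h)| #|porbits h| #|~: A| #|~: (k |: A)| => P1 P2 P3 P4; rewrite -addnn; clear. lia.
Qed.

Lemma cycles_invg A g : cycles A g^-1 = cycles A g.
Proof. by rewrite /cycles porbitsV. Qed.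

Lemma cycles_conjg A g h : cycles A (g ^ h) = cycles A g.
Proof.
suff le g' h' : (#|porbits g'| <= #|porbits (g' ^ h')|)%N.
  rewrite /cycles; congr (_ - _)%N; apply/eqP; rewrite eqn_leq le andbT.
  by rewrite -[X in (_ <= #|porbits X|)%N](conjgK h) le.
have im x : (h' @: porbit g' x = porbit (g' ^ h') (h' x))%g.
  apply/setP => y; apply/imsetP/porbitP => [[z /porbitP[i ->] ->]|[i ->]].
    by exists i; rewrite -conjXg /conjg !permM permK.
  by exists ((g' ^+ i)%g x); rewrite ?mem_porbit // -conjXg /conjg !permM permK.
rewrite -(card_imset _ (imset_inj (@perm_inj _ h'))).
apply/subset_leq_card/subsetP => _ /imsetP[_ /imsetP[x _ ->] ->].
by rewrite im; exact: imset_f.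
Qed.

Section CycleSum.
Variables (F : fieldType) (V : lmodType F).

Lemma cycle_sumU1 A k (x : F) (f : {perm T} -> V) : k \notin A ->
  \sum_(g in Sym (k |: A)) x ^+ cycles (k |: A) g *: f g =
  \sum_(h in Sym A) x ^+ cycles A h *: (x *: f h + \sum_(i in A) f (tperm i k * h)%g).
Proof.
move=> kA; rewrite sum_SymU1l // big_setU1 //= exchange_big /= -big_split /=.
apply: eq_bigr => h hA; rewrite tperm1 mul1g cyclesU1 // exprS scalerDr scalerA [x * _]mulrC.
by congr (_ + _); rewrite scaler_sumr; apply: eq_bigr => i iA; rewrite cycles_tperm.
Qed.
End CycleSum.

End SymSums.

Definition rising {R : pzRingType} (x : R) n := \prod_(j < n) (x + j%:R).

Lemma sum_cycles (T : finType) (F : fieldType) (A : {set T}) (x : F) :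
  \sum_(g in Sym A) x ^+ cycles A g = rising x #|A|.
Proof.
have [n] := ubnP #|A|; elim: n A => // n IH A.
have [->|[k kA]] := set_0Vmem A.
  move=> _; rewrite cards0 /rising big_ord0.
  have -> : Sym (@set0 T) = [set 1%g].
    apply/setP => g; rewrite [in RHS]inE; apply/SymP/eqP => [g1|-> y _]; last by rewrite perm1.
    by apply/permP => y; rewrite perm1 g1 ?inE.
  rewrite big_set1 /cycles setC0 cardsT.
  have -> : porbits (1 : {perm T})%g = [set [set x] | x in [set: T]].
    rewrite /porbits; apply/setP => X; apply/imsetP/imsetP => -[y _ ->]; exists y => //;
    by rewrite porbit_fix // perm1.
  by rewrite card_imset ?cardsT ?subnn // => y z /set1_inj.
rewrite -(setD1K kA) cardsU1 !inE eqxx /= add1n ltnS => Dn.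
have kD : k \notin A :\ k by rewrite !inE eqxx.
have scE (a b : F) : a *: (b : F^o) = a * b by [].
(* [cycle_sumU1] is about modules, so the constant 1 is placed in the regular module [F^o]. *)
transitivity (\sum_(g in Sym (k |: A :\ k)) x ^+ cycles (k |: A :\ k) g *: (1 : F^o)).
  by apply: eq_bigr => g _; rewrite scE mulr1.
rewrite cycle_sumU1 //; under eq_bigr do rewrite sumr_const !scE mulr1.
by rewrite -mulr_suml IH // /rising big_ord_recr.
Qed.

(** * First rows of irreducible representations *)

Definition symsum (T : finType) (V : nmodType) (F : {perm T} -> V) (B : {set T}) :=
  \sum_(h in Sym B) F h.

Definition Theta (T : finType) d (F : {perm T} -> 'M[algC]_d) (A : {set T}) (x : algC) :=
  \sum_(g in Sym A) x ^+ cycles A g *: F g.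

Lemma disjoint_setD (T : finType) (A B : {set T}) : [disjoint B & A :\: B].
Proof.
by rewrite disjoint_sym disjoints_subset; apply/subsetP => x /setDP[_ xB]; rewrite inE.
Qed.

Section Peel.
Variables (T : finType) (A B : {set T}).
Hypothesis BA : B \subset A.

Let SymB h : h \in Sym B -> h \in Sym A.
Proof. exact: (subsetP (SymS BA)). Qed.

Let SymD s : s \in Sym (A :\: B) -> s \in Sym A.
Proof. exact: (subsetP (SymS (subsetDl _ _))). Qed.

Let disjBD : [disjoint B & A :\: B].
Proof. exact: disjoint_setD. Qed.

Section Rep.
Variables (d : nat) (rG : mx_representation algC (Sym_group A) d).
Let e := symsum rG B.

Lemma symsum_mull h : h \in Sym B -> rG h *m e = e.
Proof.
move=> hB; rewrite /e /symsum mulmx_sumr [RHS](reindex_inj (mulgI h)) /=.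
apply: eq_big => [g|g gB]; first by rewrite groupMl.
by rewrite repr_mxM ?SymB.
Qed.

Lemma symsum_mulr h : h \in Sym B -> e *m rG h = e.
Proof.
move=> hB; rewrite /e /symsum mulmx_suml [RHS](reindex_inj (mulIg h)) /=.
apply: eq_big => [g|g gB]; first by rewrite groupMr.
by rewrite repr_mxM ?SymB.
Qed.

Lemma symsum_idem : e *m e = (#|B| `!)%:R *: e.
Proof.
rewrite [in X in X *m _]/e /symsum mulmx_suml (eq_bigr (fun=> e)); last first.
  by move=> h hB; rewrite symsum_mull.
by rewrite sumr_const card_Sym scaler_nat.
Qed.

Lemma symsum_comm s : s \in Sym (A :\: B) -> e *m rG s = rG s *m e.
Proof.
move=> sD; rewrite /e /symsum mulmx_suml mulmx_sumr; apply: eq_bigr => h hB.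
rewrite -!repr_mxM ?(SymB hB) ?(SymD sD) //.
by rewrite (Sym_commute disjBD hB sD).
Qed.

(** No set obtained from [B] by adding a point has nonzero invariants. This holds if [B] has the
    largest size of a set with such invariants. *)
Definition peelable := forall k, k \in A :\: B -> symsum rG (k |: B) = 0.

Hypothesis peel : peelable.

Let kNB k : k \in A :\: B -> k \notin B. Proof. by case/setDP. Qed.
Let kA k : k \in A :\: B -> k \in A. Proof. by case/setDP. Qed.

Lemma tperm_SymA i k : i \in B -> k \in A :\: B -> tperm i k \in Sym A.
Proof. by move=> iB kD; rewrite tperm_Sym ?(kA kD) ?(subsetP BA). Qed.

Lemma peel_mull k : k \in A :\: B -> \sum_(i in B) rG (tperm i k) *m e = - e.
Proof.
move=> kD; apply/eqP; rewrite -addr_eq0 addrC.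
apply/eqP; apply: etrans (peel kD).
rewrite /e /symsum sum_SymU1l ?kNB // big_setU1 ?kNB //=; congr (_ + _).
  by apply: eq_bigr => h hB; rewrite tperm1 mul1g.
apply: eq_bigr => i iB; rewrite mulmx_sumr; apply: eq_bigr => h hB.
by rewrite repr_mxM ?(SymB hB) ?tperm_SymA.
Qed.

Lemma peel_mulr k : k \in A :\: B -> \sum_(i in B) e *m rG (tperm i k) = - e.
Proof.
move=> kD; apply/eqP; rewrite -addr_eq0 addrC.
apply/eqP; apply: etrans (peel kD).
rewrite /e /symsum sum_SymU1r ?kNB // big_setU1 ?kNB //=; congr (_ + _).
  by apply: eq_bigr => h hB; rewrite tperm1 mulg1.
apply: eq_bigr => i iB; rewrite mulmx_suml; apply: eq_bigr => h hB.
by rewrite repr_mxM ?(SymB hB) ?tperm_SymA.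
Qed.

Lemma Theta_base x : e *m Theta rG B x = rising x #|B| *: e.
Proof.
rewrite -sum_cycles scaler_suml mulmx_sumr; apply: eq_bigr => h hB.
by rewrite -scalemxAr symsum_mulr.
Qed.

Lemma ThetaU1 (C : {set T}) k x : k |: C \subset A -> k \notin C ->
  Theta rG (k |: C) x = (x%:M + \sum_(i in C) rG (tperm i k)) *m Theta rG C x.
Proof.
move=> CA kC; rewrite /Theta cycle_sumU1 // mulmx_sumr; apply: eq_bigr => h hC.
have kA' : k \in A by apply: (subsetP CA); rewrite setU11.
have CA' : C \subset A by apply: subset_trans CA; exact: subsetUr.
have hA : h \in Sym A by apply: (subsetP (SymS CA')).
rewrite -scalemxAr mulmxDl mul_scalar_mx mulmx_suml; congr (_ *: (_ + _)).
by apply: eq_bigr => i iC; rewrite repr_mxM // tperm_Sym // (subsetP CA').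
Qed.

(* Theta is a product of Jucys-Murphy factors x + sum_i (i k); by peelability,
   multiplication by e turns the sum over i in B into -1. *)
Lemma peel_Theta (D : {set T}) x : D \subset A :\: B ->
  e *m Theta rG (B :|: D) x = rising x #|B| *: (e *m Theta rG D (x - 1)).
Proof.
have [n] := ubnP #|D|; elim: n D => // n IH D.
have [->|[k kD]] := set_0Vmem D.
  move=> _ _; rewrite setU0 Theta_base; congr (_ *: _).
  have -> : Theta rG set0 (x - 1) = 1%:M; last by rewrite mulmx1.
  rewrite /Theta (_ : Sym set0 = [set 1%g]) ?big_set1 ?repr_mx1.
    suff -> : cycles (@set0 T) 1%g = 0%N by rewrite expr0 scale1r.
    rewrite /cycles setC0 cardsT; apply/eqP; rewrite subn_eq0.
    exact: leq_imset_card.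
  apply/setP => g; rewrite [in RHS]inE; apply/SymP/eqP => [g1|-> y _]; last by rewrite perm1.
  by apply/permP => y; rewrite perm1 g1 ?inE.
rewrite -(setD1K kD) cardsU1 !inE eqxx /= add1n ltnS => Dn.
set D' := D :\ k in Dn *; rewrite subUset sub1set => /andP[kAB D'AB].
have kD' : k \notin D' by rewrite !inE eqxx.
have kB := kNB kAB.
have BDA : k |: (B :|: D') \subset A.
  by rewrite !subUset sub1set kA // BA (subset_trans D'AB) // subsetDl.
have kBD : k \notin B :|: D' by rewrite inE negb_or kB.
have D'A : k |: D' \subset A.
  by rewrite subUset sub1set kA // (subset_trans D'AB) // subsetDl.
rewrite setUCA !ThetaU1 // !mulmxA.
have -> : \sum_(i in B :|: D') rG (tperm i k) =
    \sum_(i in B) rG (tperm i k) + \sum_(i in D') rG (tperm i k).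
  have dis : [disjoint B & D'] := disjointWr D'AB (disjoint_setD A B).
  by rewrite -bigU //=; apply: eq_bigl => i; rewrite !inE.
have eB : e *m (\sum_(i in B) rG (tperm i k)) = - e by rewrite mulmx_sumr peel_mulr.
rewrite !mulmxDr eB !mul_mx_scalar.
have comm : e *m (\sum_(i in D') rG (tperm i k)) = (\sum_(i in D') rG (tperm i k)) *m e.
  rewrite mulmx_sumr mulmx_suml; apply: eq_bigr => i iD'.
  by rewrite symsum_comm // tperm_Sym //; exact: (subsetP D'AB).
rewrite comm addrA -[in LHS]scaleN1r -scalerDl !mulmxDl -!scalemxAl -!mulmxA.
by rewrite IH // -scalemxAr scalerDr !scalerA mulrC.
Qed.

End Rep.

Lemma Sym_stab_split g : g \in Sym A -> (forall j, j \in B -> g j \in B) ->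
  exists2 h, h \in Sym B & (h^-1 * g)%g \in Sym (A :\: B).
Proof.
move=> gA gB.
have nB : g \in ('N(B | 'P))%g.
  by rewrite !inE /=; apply/subsetP => j jB; rewrite inE /= apermE gB.
exists (restr_perm B g); first by rewrite inE restr_perm_on.
apply/SymP => x; rewrite !inE negb_and negbK => /orP[xB|xA].
  rewrite permM; set y := ((restr_perm B g)^-1)%g x.
  have yB : y \in B by rewrite -(perm_closed _ (restr_perm_on B g)) /y permKV.
  by rewrite -(restr_permE nB) // /y permKV.
have xB : x \notin B by apply: contraNN xA; exact: (subsetP BA).
rewrite permM (_ : ((restr_perm B g)^-1)%g x = x) ?(SymP _ _ gA) //.
by apply: (canLR (permK _)); rewrite (out_perm (restr_perm_on B g)).
Qed.

(* By induction on the number of points of B that g moves out of B. That the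
   coefficients [a] are the same for all representations is what makes
   [symsum_translate] work. *)
Lemma peel_span g : g \in Sym A -> exists a : {perm T} -> algC,
  forall d (rG : mx_representation algC (Sym_group A) d), peelable rG ->
  symsum rG B *m rG g *m symsum rG B =
  \sum_(s in Sym (A :\: B)) a s *: (symsum rG B *m rG s).
Proof.
have [n] := ubnP #|[set j in B | g j \notin B]|; elim: n g => // n IH g lt_n gA.
have [C0|[j]] := set_0Vmem [set j in B | g j \notin B].
  have gB j : j \in B -> g j \in B.
    by move=> jB; apply: contraT => gjB; move/setP: C0 => /(_ j); rewrite !inE jB gjB.
  have [h hB sD] := Sym_stab_split gA gB; set s := (_ * g)%g in sD.
  exists (fun t => (#|B| `!)%:R * (t == s)%:R) => d rG _.
  rewrite (bigD1 s) //= eqxx mulr1 big1 ?addr0; last first.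
    by move=> t /andP[_ /negbTE ->]; rewrite mulr0 scale0r.
  have -> : g = (h * s)%g by rewrite mulKVg.
  rewrite (repr_mxM rG (SymB hB) (SymD sD)) mulmxA symsum_mulr // symsum_comm // -mulmxA.
  by rewrite symsum_idem -scalemxAr.
rewrite inE => /andP[jB kB]; set k := g j in kB.
have kD : k \in A :\: B by rewrite inE kB Sym_closed //; exact: (subsetP BA).
(* If [i] and its preimage both lie in [B], the transposition moves to the left of [g] as an element
   of [Sym B], where [symsum rG B] absorbs it. *)
have sB i : i \in B -> g^-1%g i \in B -> (g * tperm i k = tperm (g^-1 i) j * g)%g.
  by move=> iB liB; rewrite [RHS]conjgC tpermJ permKV.
have IHi i : exists a : {perm T} -> algC, i \in B -> g^-1%g i \notin B ->
  forall d (rG : mx_representation algC (Sym_group A) d), peelable rG ->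
  symsum rG B *m rG (g * tperm i k)%g *m symsum rG B =
  \sum_(s in Sym (A :\: B)) a s *: (symsum rG B *m rG s).
  case: (boolP (i \in B)) => [iB|_]; last by exists (fun=> 0).
  case: (boolP (g^-1%g i \in B)) => [_|lB]; first by exists (fun=> 0).
  have [||a aP] := IH (g * tperm i k)%g.
  (* [g * tperm i k] brings [j] back to [i] in [B]. The only point newly sent out of [B] would be
     the preimage of [i], which is not in [B]. *)
  - rewrite -ltnS; apply: leq_trans lt_n; rewrite ltnS; apply: proper_card.
    apply/properP; split; last first.
      by exists j; rewrite ?inE ?jB //= permM -/k tpermR iB.
    apply/subsetP => l; rewrite !inE permM => /andP[lB' ]; rewrite lB' /=.
    case: tpermP => [gl|gl|//]; last by rewrite gl kB.
    by move: lB; rewrite -gl permK lB'.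
  - by rewrite groupM // tperm_SymA.
  by exists a => _ _.
have [a aP] := fin_all_exists IHi.
(* The [r] summands whose [i] has its preimage in [B] equal the unknown [X] itself, so [r.+1] times
   [X] is minus the sum of the others, and these fall under the induction hypothesis. *)
pose r := #|[set i in B | g^-1%g i \in B]|.
have r1 : r.+1%:R != 0 :> algC by rewrite pnatr_eq0.
exists (fun s => - (r.+1%:R^-1 * \sum_(i in B | g^-1%g i \notin B) a i s)) => d rG peel.
set e := symsum rG B; set X := e *m _ *m _.
have XE : X = - \sum_(i in B) e *m rG (g * tperm i k)%g *m e.
  apply/eqP; rewrite -addr_eq0 addrC; apply/eqP.
  transitivity (e *m rG g *m (\sum_(i in B) rG (tperm i k) *m e) + X).
    congr (_ + _); rewrite mulmx_sumr; apply: eq_bigr => i iB.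
    by rewrite repr_mxM ?tperm_SymA // !mulmxA.
  by rewrite peel_mull // mulmxN addNr.
have {}XE : r.+1%:R *: X =
    - \sum_(s in Sym (A :\: B)) (\sum_(i in B | g^-1%g i \notin B) a i s) *: (e *m rG s).
  move: XE; rewrite (bigID (fun i => g^-1%g i \in B)) /=.
  rewrite (eq_bigr (fun=> X)) => [|i /andP[iB lB]]; last first.
    by rewrite sB // repr_mxM ?tperm_Sym ?(subsetP BA) // mulmxA symsum_mulr // tperm_Sym.
  rewrite sumr_const (_ : #|_| = r); last by apply: eq_card => i; rewrite !inE.
  rewrite opprD => /eqP; rewrite eq_sym addrC subr_eq eq_sym -[X in X + _]scale1r -scaler_nat -scalerDl.
  rewrite -mulrS => /eqP ->; congr (- _).
  rewrite (eq_bigr _ (fun i iP => aP i (andP iP).1 (andP iP).2 d rG peel)).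
  by rewrite exchange_big /=; apply: eq_bigr => s _; rewrite scaler_suml.
rewrite -[LHS](scalerK r1) XE scalerN scaler_sumr -sumrN.
by apply: eq_bigr => s _; rewrite scaleNr scalerA.
Qed.

End Peel.

(** The number of cycles is invariant under conjugation, so [Theta] is central and Schur's lemma
    applies; the trace gives the scalar. *)
Lemma Theta_scalar (T : finType) (A : {set T}) d
    (rG : mx_representation algC (Sym_group A) d) (x c : algC) :
  mx_irreducible rG ->
  \sum_(g in Sym A) x ^+ cycles A g * cfRepr rG g = cfRepr rG 1%g * c ->
  Theta rG A x = c%:M.
Proof.
move=> irr cE.
have /is_scalar_mxP[b bE] : is_scalar_mx (Theta rG A x).
  apply: mx_abs_irr_cent_scalar (group_closure_closed_field irr) _ _.
  apply/centgmxP => h hA; rewrite /Theta mulmx_suml mulmx_sumr.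
  rewrite (reindex_inj (conjg_inj h^-1%g)) /=; apply: eq_big => [g|g]; first by rewrite groupJr ?groupV.
  rewrite groupJr ?groupV // => gA.
  by rewrite cycles_conjg -scalemxAl -scalemxAr -!repr_mxM ?groupJ ?groupV // -conjgCV.
rewrite bE; congr (_%:M).
have d0 : (d != 0)%N.
  by case: irr => _ /eqP nz _; apply/eqP => d0; case: nz; apply/matrixP => i; case: i => i; rewrite d0.
have := congr1 mxtrace bE; rewrite mxtrace_scalar /Theta raddf_sum /=.
rewrite (eq_bigr (fun g => x ^+ cycles A g * cfRepr rG g)) => [|g gA]; last first.
  by rewrite mxtraceZ cfunE gA.
by rewrite cE cfRepr1 -[RHS]mulr_natl => /mulfI ->; rewrite ?pnatr_eq0.
Qed.

Section Irreducible.
Variables (T : finType) (A B : {set T}).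
Hypothesis BA : B \subset A.
Variables (d : nat) (rG : mx_representation algC (Sym_group A) d).
Let e := symsum rG B.
Let sDA : Sym (A :\: B) \subset Sym A. Proof. exact: SymS (subsetDl _ _). Qed.
Let rD := @subg_repr _ _ _ (Sym_group (A :\: B)) _ rG sDA.

Lemma symsum_module : mxmodule rD e.
Proof. by apply/mxmoduleP => s sD; rewrite /= (symsum_comm BA) // submxMl. Qed.

Hypotheses (peel : peelable B rG) (irrG : mx_irreducible rG) (e0 : e != 0).

(** A nonzero vector [v = v1 *m e] of a submodule [U] generates the whole space under [Sym A], so
    the image of [e] is spanned by the [v1 *m e *m rG g *m e]. By [peel_span] these are combinations
    of the [v *m rG s] with [s] in [Sym (A :\: B)], which lie in [U]. *)
Lemma symsum_simple : mxsimple rD e.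
Proof.
split; [exact: symsum_module|exact: e0|] => U Umod Ue U0.
have v0 : nz_row U != 0 by rewrite nz_row_eq0.
set v := nz_row U in v0.
have vU : (v <= U)%MS := nz_row_sub U.
have [v1 vE] := submxP (submx_trans vU Ue).
have cyc := mxsimple_cyclic irrG v0 (submx1 v).
apply/row_subP => i; rewrite rowE.
have := submx1 (delta_mx 0 i : 'rV[algC]_d); rewrite cyc.
case/cyclic_mxP => X /envelop_mxP[c ->] ->.
rewrite [v *m _]mulmx_sumr [X in (X <= _)%MS]mulmx_suml; apply: summx_sub => g gA; rewrite vE.
have [a aP] := peel_span BA gA.
rewrite -scalemxAr -scalemxAl -!mulmxA [e *m _]mulmxA aP // [v1 *m _]mulmx_sumr.
apply/scalemx_sub/summx_sub => s sD; rewrite -scalemxAr mulmxA -vE; apply: scalemx_sub.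
by apply: submx_trans (submxMr _ vU) _; exact: (mxmoduleP Umod).
Qed.

Lemma symsum_constituent : exists j : Iirr (Sym_group (A :\: B)),
  (forall s, s \in Sym (A :\: B) -> \tr (e *m rG s) = (#|B| `!)%:R * 'chi_j s) /\
  (forall c x, (\sum_(s in Sym (A :\: B)) x ^+ cycles (A :\: B) s * 'chi_j s = 'chi_j 1%g * c) ->
     e *m Theta rG (A :\: B) x = c *: e).
Proof.
pose rU := submod_repr symsum_module.
have irrU : mx_irreducible rU by apply/submod_mx_irr; exact: symsum_simple.
have /irrP[j jE] : cfRepr rU \in irr (Sym_group (A :\: B)).
  by apply/irr_reprP; exists (Representation rU).
have MrU s : s \in Sym (A :\: B) -> rU s *m row_base e = row_base e *m rG s.
  move=> sD; have := val_submodJ symsum_module 1%:M sD.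
  by rewrite /= mul1mx /val_submod /= mul1mx.
have MN : row_base e *m col_base e = (#|B| `!)%:R%:M.
  apply: (row_free_inj (row_base_free e)) => /=; rewrite -mulmxA mulmx_base mul_scalar_mx.
  have /submxP[K ->] : (row_base e <= e)%MS by rewrite eq_row_base.
  by rewrite -mulmxA (symsum_idem BA) scalemxAr.
exists j; split=> [s sD|c x cE].
  have ->: 'chi_j s = \tr (rU s) by rewrite -jE cfunE sD.
  have -> : e *m rG s = col_base e *m (row_base e *m rG s) by rewrite mulmxA mulmx_base.
  by rewrite mxtrace_mulC -MrU // -mulmxA MN mul_mx_scalar mxtraceZ.
have -> : e *m Theta rG (A :\: B) x = col_base e *m (row_base e *m Theta rG (A :\: B) x).
  by rewrite mulmxA mulmx_base.
suff -> : row_base e *m Theta rG (A :\: B) x = c *: row_base e.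
  by rewrite -scalemxAr mulmx_base.
transitivity (Theta rU (A :\: B) x *m row_base e).
  rewrite mulmx_sumr mulmx_suml; apply: eq_bigr => s sD.
  by rewrite -scalemxAr -scalemxAl MrU.
by rewrite (@Theta_scalar _ _ _ rU x c) ?mul_scalar_mx // jE.
Qed.
End Irreducible.

(** * Invariants of the groups Sym B in terms of characters *)

Section FixSum.
Variables (T : finType) (A : {set T}).
Implicit Types (B : {set T}) (i : Iirr (Sym_group A)).

Lemma trace_symsum B i : B \subset A -> \tr (symsum 'Chi_i B) = symsum 'chi_i B.
Proof.
move=> BA; rewrite /symsum raddf_sum; apply: eq_bigr => h hB /=.
by rewrite -irrRepr cfunE (subsetP (SymS BA) _ hB).
Qed.

Lemma symsum_mx_eq0 B d (rG : mx_representation algC (Sym_group A) d) : B \subset A ->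
  \tr (symsum rG B) = 0 -> symsum rG B = 0.
Proof.
set e := symsum rG B => BA tr0.
have MN : row_base e *m col_base e = (#|B| `!)%:R%:M.
  apply: (row_free_inj (row_base_free e)); rewrite -mulmxA mulmx_base mul_scalar_mx.
  have /submxP[K ->] : (row_base e <= e)%MS by rewrite eq_row_base.
  by rewrite -mulmxA (symsum_idem BA) scalemxAr.
move: tr0; rewrite -{1}(mulmx_base e) mxtrace_mulC MN mxtrace_scalar => /eqP.
rewrite mulrn_eq0 pnatr_eq0 [_`! == _]eqn0Ngt fact_gt0 orbF => /eqP r0.
by apply/eqP; rewrite -mxrank_eq0 r0.
Qed.

Lemma symsum_mx_neq0 B i : B \subset A -> (symsum 'Chi_i B == 0) = (symsum 'chi_i B == 0).
Proof.
move=> BA; rewrite -trace_symsum //; apply/eqP/eqP => [->|]; first by rewrite raddf0.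
exact: symsum_mx_eq0.
Qed.

Lemma Sym_imset (g : {perm T}) B (h : {perm T}) : ((h ^ g)%g \in Sym (g @: B)) = (h \in Sym B).
Proof.
apply/SymP/SymP => hB x xB; last first.
  have := hB (g^-1%g x); rewrite /conjg !permM => ->; first by rewrite permKV.
  by apply: contraNN xB => xB; apply/imsetP; exists (g^-1%g x); rewrite ?permKV.
have := hB (g x); rewrite /conjg !permM permK => /(_ _)/perm_inj -> //.
by rewrite (mem_imset _ _ (@perm_inj _ g)).
Qed.

Lemma symsum_imset i B (g : {perm T}) : g \in Sym A -> B \subset A ->
  symsum 'chi_i (g @: B) = symsum 'chi_i B.
Proof.
move=> gA BA; rewrite /symsum (reindex_inj (conjg_inj g)) /=.
by apply: eq_big => [h|h hB]; rewrite ?Sym_imset // cfunJ.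
Qed.

(** [B] and [B'] are conjugate under [Sym A]: each step exchanges a point of [B :\: B'] with one of
    [B' :\: B]. *)
Lemma symsum_card i B B' : B \subset A -> B' \subset A -> #|B| = #|B'| ->
  symsum 'chi_i B = symsum 'chi_i B'.
Proof.
have [n] := ubnP #|B :\: B'|; elim: n B => // n IH B lt_n BA B'A eqBB'.
have [BB'|[x xB]] := set_0Vmem (B :\: B').
  suff /eqP -> : B == B' by [].
  by rewrite eqEcard eqBB' leqnn andbT -setD_eq0 BB'.
have [y yB'] : exists y, y \in B' :\: B.
  apply/set0Pn; rewrite -card_gt0; have := cardsID B B'; have := cardsID B' B.
  have : (0 < #|B :\: B'|)%N by rewrite card_gt0; apply/set0Pn; exists x.
  rewrite setIC -eqBB'; move: #|B :\: B'| #|B' :\: B| #|B' :&: B| #|B| => a b c e; clear; lia.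
case/setDP: xB => xB xB'; case/setDP: yB' => yB' yB.
have tA : tperm x y \in Sym A by apply: tperm_Sym; [exact: (subsetP BA)|exact: (subsetP B'A)].
have tBA : tperm x y @: B \subset A.
  by apply/subsetP => _ /imsetP[z zB ->]; rewrite Sym_closed // (subsetP BA).
rewrite -(symsum_imset i tA BA); apply: IH => //; last first.
  by rewrite card_imset //; exact: perm_inj.
rewrite -ltnS; apply: leq_trans lt_n; rewrite ltnS; apply: proper_card.
apply/properP; split; last first.
  by exists x; rewrite ?inE ?xB ?xB' //= -[x in x \in _](tpermR x y)
      (mem_imset _ _ (@perm_inj _ _)) (negbTE yB).
apply/subsetP => z; rewrite !inE => /andP[zB' /imsetP[w wB]]; rewrite zB' /=.
case: tpermP => [wx zy|wy|_ _ ->//].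
  by rewrite zy yB' in zB'.
by rewrite wy (negbTE yB) in wB.
Qed.

Lemma symsum_set1 i x : x \in A -> symsum 'chi_i [set x] != 0.
Proof.
move=> xA; rewrite /symsum (_ : Sym [set x] = [set 1%g]) ?big_set1 ?irr1_neq0 //.
apply/setP => g; rewrite [in RHS]inE; apply/idP/eqP => [|->]; last exact: (group1 (Sym_group _)).
by rewrite inE => /perm_on_id -> //; rewrite cards1.
Qed.

(** The convolution of [\sum_(h in Sym B) 'chi_i (h * g)] with ['chi_i1] is a nonzero multiple of
    [symsum 'chi_i1 B] for [i = i1], and vanishes for every other [i]. *)
Lemma symsum_translate_inj i1 i2 B : B \subset A -> symsum 'chi_i1 B != 0 ->
  (forall g, g \in Sym A ->
    \sum_(h in Sym B) 'chi_i1 (h * g)%g = \sum_(h in Sym B) 'chi_i2 (h * g)%g) ->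
  i1 = i2.
Proof.
move=> BA n0 eqF; apply/eqP; apply: contraT => i12.
have orth i : \sum_(g in Sym_group A) (\sum_(h in Sym B) 'chi_i (h * g)%g) * 'chi_i1 g^-1%g =
    #|Sym A|%:R * ((i == i1)%:R * (symsum 'chi_i B / 'chi_i 1%g)).
  under eq_bigr do rewrite mulr_suml.
  rewrite exchange_big /= /symsum mulr_suml !mulr_sumr; apply: eq_bigr => h hB.
  have hA : h \in Sym_group A := subsetP (SymS BA) _ hB.
  rewrite -generalized_orthogonality_relation mulVKf ?pnatr_eq0 -?lt0n ?cardG_gt0 //.
  apply: eq_bigr => g gA; congr (_ * _).
  by have -> : (g * h = (h * g) ^ h)%g; rewrite ?cfunJ // /conjg -!mulgA mulKg.
have := orth i1; rewrite (eq_bigr _ (fun g gA => congr1 (fun z => z * _) (eqF g gA))).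
rewrite orth eq_sym (negbTE i12) eqxx !(mul0r, mulr0) mul1r => /esym/eqP.
by rewrite !mulf_eq0 invr_eq0 (negbTE n0) (negbTE (irr1_neq0 _)) pnatr_eq0 eqn0Ngt
  (cardG_gt0 (Sym_group A)).
Qed.

Lemma symsum_translate i B : B \subset A -> peelable B 'Chi_i ->
  forall i', peelable B 'Chi_i' ->
  (forall s, s \in Sym (A :\: B) ->
    \sum_(h in Sym B) 'chi_i (h * s)%g = \sum_(h in Sym B) 'chi_i' (h * s)%g) ->
  forall g, g \in Sym A ->
    \sum_(h in Sym B) 'chi_i (h * g)%g = \sum_(h in Sym B) 'chi_i' (h * g)%g.
Proof.
move=> BA peel i' peel' eqs g gA.
have trE (k : Iirr (Sym_group A)) g' : g' \in Sym A ->
    \tr (symsum 'Chi_k B *m 'Chi_k g') = \sum_(h in Sym B) 'chi_k (h * g')%g.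
  move=> gA'; rewrite /symsum mulmx_suml raddf_sum; apply: eq_bigr => h hB /=.
  have hA : h \in Sym_group A := subsetP (SymS BA) _ hB.
  rewrite -irrRepr cfunE. by rewrite (groupM hA gA') (repr_mxM 'Chi_k hA gA').
have [a aP] := peel_span BA gA.
have FE (k : Iirr (Sym_group A)) : peelable B 'Chi_k -> #|B| `!%:R * \sum_(h in Sym B) 'chi_k (h * g)%g =
    \sum_(s in Sym (A :\: B)) a s * \sum_(h in Sym B) 'chi_k (h * s)%g.
  move=> /aP /(congr1 mxtrace); rewrite mxtrace_mulC mulmxA (symsum_idem BA).
  rewrite -scalemxAl mxtraceZ trE // => ->; rewrite raddf_sum; apply: eq_bigr => s sD /=.
  by rewrite mxtraceZ trE // (subsetP (SymS (subsetDl A B))).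
have /mulfI : (#|B| `!%:R : algC) != 0 by rewrite pnatr_eq0 -lt0n fact_gt0.
apply; rewrite !FE //; apply: eq_bigr => s sD; congr (_ * _); exact: eqs.
Qed.

End FixSum.

(* Contents of the boxes of the Young diagram with rows l. *)
Fixpoint contents (l : seq nat) : seq int :=
  if l is m :: l' then [seq j%:Z | j <- iota 0 m] ++ [seq c - 1 | c <- contents l'] else [::].

Definition is_part n l := [&& sorted geq l, all (ltn 0) l & sumn l == n].

Definition content_prod {R : comPzRingType} (l : seq nat) (x : R) :=
  \prod_(c <- contents l) (x + c%:~R).

Lemma content_prod_cons (R : comPzRingType) m l (x : R) :
  content_prod (m :: l) x = rising x m * content_prod l (x - 1).
Proof.
have iotaE : iota 0 m = index_iota 0 m by rewrite /index_iota subn0.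
rewrite /content_prod big_cat !big_map iotaE big_mkord.
congr (_ * _); apply: eq_bigr => c _.
by rewrite rmorphB /= mulr1z addrAC addrA.
Qed.

Definition cycle_mean (T : finType) (A : {set T}) (i : Iirr (Sym_group A)) (x : algC) :=
  \sum_(g in Sym A) x ^+ cycles A g * 'chi_i g.

(** Injectivity lets a sum over characters be bounded by one over partitions. The bound on [#|B|]
    identifies the diagram of the trivial character, and the set that attains it shows, in the
    induction, that the rows decrease. *)
Definition irr_shape (T : finType) (A : {set T}) (f : Iirr (Sym_group A) -> seq nat) :=
  injective f /\ forall i,
  [/\ is_part #|A| (f i),
      forall x, cycle_mean i x = 'chi_i 1%g * content_prod (f i) x,
      forall B : {set T}, B \subset A -> symsum 'chi_i B != 0 -> (#|B| <= head 0 (f i))%N &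
      exists B : {set T}, [/\ B \subset A, #|B| = head 0%N (f i) & symsum 'chi_i B != 0]].

Lemma irr_shape_set0 (T : finType) : @irr_shape T set0 (fun=> [::]).
Proof.
have S1 : #|Sym (@set0 T)| = 1%N by rewrite card_Sym cards0.
split=> [i j _|i].
  have : (#|Iirr (Sym_group (@set0 T))| <= 1)%N.
    by rewrite card_Iirr_abelian ?S1 // card_le1_trivg ?abelian1 //= S1.
  by move/card_le1_eqP; apply; rewrite inE.
have SE : Sym (@set0 T) = 1%g by apply: (@card_le1_trivg _ (Sym_group set0)); rewrite S1.
split=> [|x|B|].
- by rewrite /is_part cards0.
- rewrite /cycle_mean SE big_set1 /content_prod big_nil mulr1.
  suff -> : cycles (@set0 T) 1%g = 0%N by rewrite expr0 mul1r.
  rewrite /cycles setC0 cardsT; apply/eqP; rewrite subn_eq0; exact: leq_imset_card.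
- by rewrite subset0 => /eqP ->; rewrite cards0.
- by exists set0; rewrite sub0set cards0 /symsum SE big_set1 irr1_neq0.
Qed.

(** * Removal of the first row *)

Section Step.
Variables (T : finType) (A : {set T}).
Hypothesis A0 : A != set0.

(** One fixed set for each size, so that characters with equal first rows lead to characters of the
    same group [Sym_group (A :\: C m)], whose shapes can be compared. *)
Let C m : {set T} := [set x in take m (enum A)].
Let CA m : C m \subset A.
Proof. by apply/subsetP => x; rewrite inE => /mem_take; rewrite mem_enum. Qed.

Let cardC m : (m <= #|A|)%N -> #|C m| = m.
Proof.
move=> mA; rewrite cardsE (card_uniqP (take_uniq _ (enum_uniq _))).
by rewrite size_takel // -cardE.
Qed.

Let E i := \max_(B : {set T} | (B \subset A) && (symsum 'chi[Sym_group A]_i B != 0)) #|B|.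

Let E_ub i (B : {set T}) : B \subset A -> symsum 'chi_i B != 0 -> (#|B| <= E i)%N.
Proof. by move=> BA n0; rewrite /E (bigD1 B) ?BA //= leq_maxl. Qed.

Let E_gt0 i : (0 < E i)%N.
Proof.
have [x xA] := set0Pn _ A0.
by rewrite -(cards1 x) E_ub ?sub1set // symsum_set1.
Qed.

Let E_le i : (E i <= #|A|)%N.
Proof. by apply/bigmax_leqP => B /andP[/subset_leq_card]. Qed.

Let E_neq0 i : symsum 'chi_i (C (E i)) != 0.
Proof.
have [x xA] := set0Pn _ A0.
have [|B BP EB] := @eq_bigmax_cond _ [pred B : {set T} | (B \subset A) && (symsum 'chi_i B != 0)]
    (fun B => #|B|).
  by apply/card_gt0P; exists [set x]; rewrite !inE sub1set xA symsum_set1.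
have /andP[BA n0] : (B \subset A) && (symsum 'chi_i B != 0) := BP.
by rewrite (symsum_card i (CA _) BA) // cardC.
Qed.

Let E_peel i : peelable (C (E i)) 'Chi_i.
Proof.
move=> k /setDP[kA kC].
have kCA : k |: C (E i) \subset A by rewrite subUset sub1set kA CA.
apply/eqP; rewrite symsum_mx_neq0 //; apply: contraT => /(E_ub kCA).
by rewrite cardsU1 kC cardC // add1n ltnn.
Qed.

Lemma irr_shape_step :
  (forall D : {set T}, (#|D| < #|A|)%N -> exists f : Iirr (Sym_group D) -> seq nat, irr_shape f) ->
  exists f : Iirr (Sym_group A) -> seq nat, irr_shape f.
Proof.
move=> IH.
have IHm m : exists f : Iirr (Sym_group (A :\: C m)) -> seq nat, (0 < m <= #|A|)%N -> irr_shape f.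
  have [/andP[m0 mA]|_] := boolP (0 < m <= #|A|)%N; last by exists (fun=> [::]).
  have [|f fP] := IH (A :\: C m); last by exists f.
  rewrite cardsD (setIidPr (CA m)) cardC //; lia.
pose g m := projT1 (cid (IHm m)).
have gP m : (0 < m <= #|A|)%N -> irr_shape (g m) := projT2 (cid (IHm m)).
have mP i : (0 < E i <= #|A|)%N by rewrite E_gt0 E_le.
(* The type of [j] depends on the first row. It is a variable [m] with [m = E i], so that two equal
   first rows can be identified by substitution in the proof of injectivity. *)
have /choice[f fP] : forall i, exists l : seq nat,
    exists m (j : Iirr (Sym_group (A :\: C m))), [/\ m = E i, l = m :: g m j,
    (forall s, s \in Sym (A :\: C m) ->
       \tr (symsum 'Chi_i (C m) *m 'Chi_i s) = #|C m| `!%:R * 'chi_j s) &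
    (forall x, symsum 'Chi_i (C m) *m Theta 'Chi_i (A :\: C m) x =
       content_prod (g m j) x *: symsum 'Chi_i (C m))].
  move=> i; have [||j [trj Thj]] := @symsum_constituent _ A (C (E i)) (CA _) _ 'Chi_i (@E_peel i).
  - exact: socle_irr.
  - by rewrite symsum_mx_neq0.
  exists (E i :: g (E i) j), (E i), j; split=> // x; apply: Thj.
  by have [_ /(_ j) [_ mean _ _]] := gP _ (mP i); exact: mean.
have trE (i : Iirr (Sym_group A)) m s : s \in Sym (A :\: C m) ->
    \tr (symsum 'Chi_i (C m) *m 'Chi_i s) = \sum_(h in Sym (C m)) 'chi_i (h * s)%g.
  move=> sD; rewrite /symsum mulmx_suml raddf_sum; apply: eq_bigr => h hB /=.
  have hA : h \in Sym_group A := subsetP (SymS (CA _)) _ hB.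
  have sA : s \in Sym_group A := subsetP (SymS (subsetDl _ _)) _ sD.
  by rewrite -irrRepr cfunE (groupM hA sA) (repr_mxM 'Chi_i hA sA).
exists f; split=> [i1 i2|i].
  have [m1 [j1 [e1 -> t1 _]]] := fP i1; have [m2 [j2 [e2 -> t2 _]]] := fP i2.
  case=> eqm; move: e2; subst m2 => e2; have m1A : (0 < m1 <= #|A|)%N by rewrite e1.
  have [g_inj _] := gP _ m1A; move=> /g_inj eqj; subst j2.
  apply: (symsum_translate_inj (CA m1)); first by rewrite e1 E_neq0.
  apply: (symsum_translate (CA m1)); first by rewrite e1; exact: E_peel.
    by rewrite e2; exact: E_peel.
  by move=> s sD; rewrite -!trE // t1 // t2.
have [m [j [mE -> tj Tj]]] := fP i.
have mA : (0 < m <= #|A|)%N by rewrite mE.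
have [m0 m_le] := andP mA.
have [_ /(_ j) [/and3P[g_sort g_pos g_sum] _ g_ub [B2 [B2D cB2 B2n0]]]] := gP _ mA.
have peel : peelable (C m) 'Chi_i by rewrite mE; exact: E_peel.
have n0 : symsum 'chi_i (C m) != 0 by rewrite mE E_neq0.
have n0' : symsum 'Chi_i (C m) != 0 by rewrite symsum_mx_neq0.
split=> [|x|B BA /(E_ub BA)|]; last 2 first.
- by rewrite /= mE.
- by exists (C m); rewrite CA cardC.
- have B2A : B2 \subset A := subset_trans B2D (subsetDl _ _).
  (* Invariants of [Sym B2] in the representation of [Sym_group (A :\: C m)] come from invariants in
     ['Chi_i], so [B2] is one of the sets over which [E i] is maximal. *)
  have headm : (head 0%N (g m j) <= m)%N.
    rewrite -cB2 {1}mE; apply: (E_ub B2A); rewrite -symsum_mx_neq0 //.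
    apply: contraNneq B2n0 => B20.
    have : \tr (symsum 'Chi_i (C m) *m symsum 'Chi_i B2) = #|C m| `!%:R * symsum 'chi_j B2.
      rewrite {2}/symsum mulmx_sumr raddf_sum /= mulr_sumr; apply: eq_bigr => s sB2.
      by rewrite tj // (subsetP (SymS B2D)).
    rewrite B20 mulmx0 raddf0 => /esym/eqP; rewrite mulf_eq0 pnatr_eq0.
    by rewrite eqn0Ngt fact_gt0.
  rewrite /is_part /= m0 g_pos (eqP g_sum) cardsD (setIidPr (CA m)) cardC //.
  rewrite subnKC // eqxx !andbT.
  by case: (g m j) g_sort headm => //= a l -> ->.
have Th : Theta 'Chi_i A x = (content_prod (m :: g m j) x)%:M.
  have [c cE] : exists c : algC, Theta 'Chi_i A x = c%:M.
    exists (cycle_mean i x / 'chi_i 1%g); apply: Theta_scalar; first exact: socle_irr.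
    by rewrite irrRepr mulrC divfK ?irr1_neq0.
  rewrite cE; congr (_%:M).
  (* Both sides become multiples of the nonzero matrix [symsum 'Chi_i (C m)], so that the scalars
     agree. *)
  have := peel_Theta (CA m) peel x (subxx (A :\: C m)).
  have -> : C m :|: A :\: C m = A by rewrite setDE setUIr setUCr setIT; exact/setUidPr.
  rewrite cE mul_mx_scalar Tj scalerA cardC // -content_prod_cons.
  by move/eqP; rewrite -subr_eq0 -scalerBl scaler_eq0 (negbTE n0') orbF subr_eq0 => /eqP.
have := congr1 mxtrace Th; rewrite mxtrace_scalar.
rewrite -irrRepr cfRepr1 mulr_natl => <-; rewrite /cycle_mean /Theta raddf_sum.
apply: eq_bigr => h hA /=.
by rewrite -irrRepr cfunE hA mxtraceZ.
Qed.
End Step.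

Lemma irr_shape_exists (T : finType) (A : {set T}) :
  exists f : Iirr (Sym_group A) -> seq nat, irr_shape f.
Proof.
have [n] := ubnP #|A|; elim: n A => // n IH A lt_n.
have [->|A0] := eqVneq A set0; first by exists (fun=> [::]); exact: irr_shape_set0.
by apply: irr_shape_step => // D lt_D; apply: IH; lia.
Qed.

Lemma poly_eq_horner (R : numDomainType) (p q : {poly R}) :
  (forall x, p.[x] = q.[x]) -> p = q.
Proof.
move=> eqpq; apply/eqP; rewrite -subr_eq0; apply/eqP.
pose rs := [seq i%:R : R | i <- iota 0 (size (p - q))].
apply: (@roots_geq_poly_eq0 _ _ rs); last by rewrite size_map size_iota.
  by apply/allP => _ /mapP[i _ ->]; rewrite rootE hornerD hornerN eqpq subrr.
rewrite map_inj_uniq ?iota_uniq // => i j /eqP.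
by rewrite eqr_nat => /eqP.
Qed.

(** * The number of cycles of a commutator *)

Section CommutatorCycles.
Variables (gT : finGroupType) (G : {group gT}).

(* The sum of the conjugates of b is scalar in each irreducible representation. *)
Lemma sum_irr_commutator (i : Iirr G) :
  \sum_(a in G) \sum_(b in G) 'chi_i [~ a, b]%g = #|G|%:R ^+ 2 / 'chi_i 1%g.
Proof.
pose rho := 'Chi_i.
have scal b : b \in G ->
    \sum_(a in G) rho (b ^ a)%g = (#|G|%:R * 'chi_i b / 'chi_i 1%g)%:M.
  move=> bG; set M := \sum_(a in G) _.
  have /is_scalar_mxP[c cE] : is_scalar_mx M.
    apply: (mx_abs_irr_cent_scalar (group_closure_closed_field (socle_irr _))).
    apply/centgmxP => h hG; rewrite /M mulmx_suml mulmx_sumr.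
    rewrite [RHS](reindex_inj (mulIg h)) /=; apply: eq_big => [a|a aG].
      by rewrite groupMr.
    by rewrite -!repr_mxM ?groupJ ?groupM // conjgM -conjgC.
  rewrite cE; congr (_%:M); apply: (canRL (mulfK (irr1_neq0 i))).
  have := congr1 mxtrace cE; rewrite mxtrace_scalar -irrRepr cfRepr1 mulr_natr => <-.
  rewrite raddf_sum /= (eq_bigr (fun=> cfRepr rho b)) => [|a aG].
    by rewrite sumr_const mulr_natl.
  by rewrite -(cfunJ _ b aG) [RHS]cfunE groupJ.
rewrite exchange_big /=.
(* The commutator is the product of a conjugate of [b^-1] by [a] and of [b]; summed over [a], the
   first factor becomes the scalar of [scal]. *)
transitivity (\sum_(b in G) #|G|%:R / 'chi_i 1%g * ('chi_i b * 'chi_i b^-1%g)).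
  apply: eq_bigr => b bG.
  have := congr1 mxtrace (congr1 (mulmx^~ (rho b)) (scal _ (groupVr bG))).
  rewrite /= mul_scalar_mx mxtraceZ mulmx_suml raddf_sum /=.
  have trE g : g \in G -> \tr (rho g) = 'chi_i g by move=> gG; rewrite -irrRepr cfunE gG.
  rewrite trE // => eq; transitivity (\sum_(a in G) \tr (rho (b^-1 ^ a)%g *m rho b)).
    apply: eq_bigr => a aG; rewrite -repr_mxM ?groupJ ?groupV // trE ?groupM ?groupJ ?groupV //.
    by rewrite /commg /conjg !mulgA.
  by rewrite eq; ring.
rewrite -mulr_sumr.
have /(canRL (mulKf _)) -> := first_orthogonality_relation i i.
  by rewrite eqxx mulr1n invrK; ring.
by rewrite invr_neq0 // pnatr_eq0 -lt0n.
Qed.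

End CommutatorCycles.

Section SymmetricGroup.
Variable n : nat.
Local Notation G := (Sym_group [set: 'I_n]).

Lemma in_SymT (g : 'S_n) : g \in G.
Proof. by apply/SymP => x; rewrite inE. Qed.

Lemma cyclesT (g : 'S_n) : cycles setT g = #|porbits g|.
Proof. by rewrite /cycles setCT cards0 subn0. Qed.

Lemma card_SymT : #|G| = n`!.
Proof. by rewrite card_Sym cardsT card_ord. Qed.

Lemma sum_SymT (V : nmodType) (F : 'S_n -> V) : \sum_(g in G) F g = \sum_g F g.
Proof. by apply: eq_bigl => g; rewrite in_SymT. Qed.

Fact cfCycles_subproof (x : algC) :
  is_class_fun <<G>>%g [ffun g => x ^+ cycles setT g *+ (g \in G)].
Proof.
rewrite genGid; apply: intro_class_fun => [g h gG hG | _ /negbTE-> //].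
by rewrite groupJ // gG cycles_conjg.
Qed.
Definition cfCycles x := Cfun 0 (cfCycles_subproof x).

(** The coefficient of ['chi_i] in the class function [cfCycles x] has the factor ['chi_i 1], which
    cancels the denominator of [sum_irr_commutator]. *)
Lemma sum_commutator_cycles (f : Iirr G -> seq nat) (x : algC) : irr_shape f ->
  \sum_(a : 'S_n) \sum_(b : 'S_n) x ^+ #|porbits [~ a, b]%g| =
  n`!%:R * \sum_i content_prod (f i) x.
Proof.
case=> _ fP.
have G0 : #|G|%:R != 0 :> algC by rewrite pnatr_eq0 -lt0n cardG_gt0.
have dotE i : '[cfCycles x, 'chi_i] = 'chi_i 1%g * content_prod (f i) x / #|G|%:R.
  have [_ <- _ _] := fP i; rewrite cfdotE mulrC; congr (_ / _).
  rewrite (reindex_inj invg_inj) /=; apply: eq_big => [g|g gG]; first by rewrite groupV.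
  by rewrite cfunE gG -irr_inv invgK cycles_invg.
have cycE g : x ^+ #|porbits g| = cfCycles x g.
  by rewrite cfunE in_SymT cyclesT.
rewrite -sum_SymT; under eq_bigr do rewrite -sum_SymT.
transitivity (\sum_(a in G) \sum_(b in G) \sum_i '[cfCycles x, 'chi_i] * 'chi_i [~ a, b]%g).
  apply: eq_bigr => a _; apply: eq_bigr => b _.
  by rewrite cycE {1}[cfCycles x]cfun_sum_cfdot sum_cfunE; apply: eq_bigr => i _; rewrite cfunE.
under eq_bigr do rewrite exchange_big /=.
rewrite exchange_big /= mulr_sumr; apply: eq_bigr => i _.
under eq_bigr do rewrite -mulr_sumr.
rewrite -mulr_sumr sum_irr_commutator dotE -card_SymT.
by field; rewrite G0 irr1_neq0.
Qed.

Fact sgn_repr_subproof : mx_repr G (fun g : 'S_n => ((-1) ^+ odd_perm g)%:M : 'M[algC]_1).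
Proof.
split=> [|g h _ _]; first by rewrite odd_perm1.
by rewrite odd_permM signr_addb -scalar_mxM.
Qed.
Definition cfSgn := cfRepr (MxRepresentation sgn_repr_subproof).

Lemma cfSgnE (g : 'S_n) : cfSgn g = (-1) ^+ odd_perm g.
Proof. by rewrite cfunE in_SymT mxtrace_scalar. Qed.

Lemma cfSgn_lin : cfSgn \is a linear_char.
Proof. by rewrite qualifE /= cfRepr_char cfSgnE odd_perm1 eqxx. Qed.

Definition sgn_Iirr (i : Iirr G) := cfIirr (cfSgn * 'chi_i).

Lemma sgn_IirrE i : 'chi_(sgn_Iirr i) = cfSgn * 'chi_i.
Proof. by rewrite cfIirrE // mul_lin_irr ?cfSgn_lin ?mem_irr. Qed.

Lemma cfSgnK : cfSgn * cfSgn = 1.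
Proof.
apply/cfun_inP => g gG; rewrite cfunE cfun1E gG cfSgnE.
by rewrite -signr_addb addbb.
Qed.

Lemma sgn_IirrK : involutive sgn_Iirr.
Proof. by move=> i; apply: irr_inj; rewrite !sgn_IirrE mulrA cfSgnK mul1r. Qed.

(** The sign of a permutation is -1 to the power [n] minus the number of its cycles. *)
Lemma cycle_mean_sgn i x : cycle_mean (sgn_Iirr i) x = (-1) ^+ n * cycle_mean i (- x).
Proof.
rewrite /cycle_mean mulr_sumr; apply: eq_bigr => g _; rewrite sgn_IirrE cfunE cfSgnE.
rewrite cyclesT /odd_perm card_ord signr_addb !signr_odd [(- x) ^+ _]exprNn.
by rewrite !mulrA [x ^+ _ * _]mulrC -!mulrA; congr (_ * _); rewrite mulrCA !mulrA.
Qed.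

End SymmetricGroup.

Lemma size_contents l : size (contents l) = sumn l.
Proof. by elim: l => //= m l IH; rewrite size_cat !size_map size_iota IH. Qed.

Section SignTwist.
Variable n : nat.
Local Notation G := (Sym_group [set: 'I_n]).
Variable f : Iirr G -> seq nat.
Hypothesis fP : irr_shape f.

Lemma shape_is_part i : is_part n (f i).
Proof. by have [_ /(_ i)[]] := fP; rewrite cardsT card_ord. Qed.

Lemma content_prod_sgn i (x : algC) :
  content_prod (f (sgn_Iirr i)) x = \prod_(c <- contents (f i)) (x - c%:~R).
Proof.
have [_ fP'] := fP; have [_ m1 _ _] := fP' (sgn_Iirr i); have [_ m2 _ _] := fP' i.
apply: (mulfI (irr1_neq0 (sgn_Iirr i))); rewrite -m1 cycle_mean_sgn m2.
rewrite sgn_IirrE cfunE cfSgnE odd_perm1 mul1r mulrCA; congr (_ * _).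
have /and3P[_ _ /eqP <-] := shape_is_part i; rewrite -size_contents /content_prod.
elim: (contents _) => [|c s IH]; first by rewrite !big_nil mulr1.
by rewrite !big_cons -IH exprS; ring.
Qed.

(** Takes the place of transposing the diagram: the content polynomials determine the contents, as a
    product of monic linear factors determines the multiset of its roots. *)
Lemma contents_sgn i : perm_eq (contents (f (sgn_Iirr i))) (map -%R (contents (f i))).
Proof.
have intr_inj' : injective (fun c : int => - (c%:~R : algC)).
  by move=> a b /oppr_inj /intr_inj.
apply: (perm_map_inj intr_inj'); apply: prod_XsubC_eq; apply: poly_eq_horner => x.
rewrite !horner_prod !big_map.
transitivity (content_prod (f (sgn_Iirr i)) x).
  by apply: eq_bigr => c _; rewrite !hornerE opprK.
rewrite content_prod_sgn; apply: eq_bigr => c _.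
by rewrite !hornerE rmorphN opprK.
Qed.

End SignTwist.

(* The partitions of n with parts at most m; [k] is fuel and has to exceed n. *)
Fixpoint parts (k n m : nat) : seq (seq nat) :=
  if k is k'.+1 then
    if n is 0 then [:: [::]]
    else flatten [seq [seq l :: p | p <- parts k' (n - l) l] | l <- iota 1 (minn m n)]
  else [::].

Lemma mem_parts k n m l : (n < k)%N -> is_part n l -> (head 0 l <= m)%N ->
  l \in parts k n m.
Proof.
elim: k n m l => // k IH n m [|a l] nk /and3P[srt pos /eqP sum] hm /=.
  by rewrite -sum inE.
have a0 : (0 < a)%N by move: pos => /= /andP[].
case: n nk sum => [|n] nk /= sum; first by lia.
apply/flatten_mapP; exists a; first by rewrite mem_iota; move: hm => /=; lia.
apply/mapP; exists l => //; apply: IH; first by lia.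
  move: pos srt => /= /andP[_ pos] srt; rewrite /is_part (path_sorted srt) pos /=.
  by apply/eqP; lia.
by case: l srt {pos sum hm} => //= b l /andP[].
Qed.

Definition good_shapes n := [seq l <- parts n.+1 n n | (size l <= head 0 l < n)%N].

Lemma contents_lt_head n l c : is_part n l -> c \in contents l -> (c < (head 0 l)%:Z)%R.
Proof.
move=> /and3P[srt _ _]; elim: l srt c => //= m l IH srt c.
rewrite mem_cat => /orP[/mapP[j]|/mapP[d dl ->]].
  by rewrite mem_iota add0n => /= jm ->; rewrite ltz_nat.
have := IH (path_sorted srt) d dl.
by case: l srt {IH dl} => //= [_|b l /andP[bm _]]; lia.
Qed.

Lemma first_column_contents n l : is_part n l -> (0 < size l)%N ->
  - (size l).-1%:Z \in contents l.
Proof.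
move=> /and3P[_ pos _]; elim: l pos => //= m l IH /andP[m0 pos] _.
case: l IH pos => [|b l] IH pos; first by case: m m0 => //= m _; rewrite oppr0 mem_head.
rewrite mem_cat; apply/orP; right; apply/mapP; exists (- (size l)%:Z).
  exact: IH.
by rewrite /= -addn1 PoszD opprD.
Qed.

Lemma is_part_full n l : (0 < n)%N -> is_part n l -> (n <= head 0 l)%N -> l = [:: n].
Proof.
case: l => [|m l] n0 /and3P[srt pos /eqP sum] //=; first by lia.
move: sum => /= sum mn; have l0 : sumn l = 0%N by lia.
case: l pos l0 {srt} sum => [|b l] /=; first by rewrite addn0 => _ _ ->.
by case/and3P; lia.
Qed.

Lemma sum_le_subset (R : numDomainType) (T : eqType) (s t : seq T) (F : T -> R) :
  uniq s -> {subset s <= t} -> (forall x, 0 <= F x) ->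
  \sum_(x <- s) F x <= \sum_(x <- t) F x.
Proof.
move=> + + F0; elim: s t => [|x s IH] t /=; first by rewrite big_nil sumr_ge0.
move=> /andP[xs us] st; rewrite big_cons.
rewrite [leRHS](big_rem x) /=; last by apply: st; rewrite mem_head.
rewrite lerD2l; apply: IH => // y ys.
have := st y; rewrite inE ys orbT => /(_ isT) yt.
have := perm_to_rem (st x (mem_head x s)) => /perm_mem/(_ y); rewrite yt inE.
by case: eqVneq ys => [-> xs'|_ _ /esym //]; rewrite xs' in xs.
Qed.

Definition abs_content_prod {R : numDomainType} (l : seq nat) (y : R) :=
  \prod_(c <- contents l) (y + `|c|%:~R).

(* The list L consists of the contents of the characters other than the trivial
   one and the sign. Twisting by the sign negates contents, so that each of these
   characters or its twist has a good shape. *)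
Lemma sum_commutator_cycles_poly n : (1 < n)%N -> exists L : seq (seq int),
  \sum_(a : 'S_n) \sum_(b : 'S_n) 'X ^+ #|porbits [~ a, b]%g| =
    n`!%:R * (rising 'X n + \prod_(j < n) ('X - j%:R)
              + \sum_(s <- L) \prod_(c <- s) ('X + c%:P)) :> {poly int} /\
  forall (R : numDomainType) (y : R), 0 <= y ->
    \sum_(s <- L) \prod_(c <- s) (y + `|c|%:~R) <=
    2 * \sum_(l <- good_shapes n) abs_content_prod l y.
Proof.
move=> n1; have n0 : (0 < n)%N by apply: ltn_trans n1.
have [f fP] := irr_shape_exists [set: 'I_n].
have [f_inj fP'] := fP.
pose i0 : Iirr (Sym_group [set: 'I_n]) := 0.
pose i1 := sgn_Iirr i0.
have f0 : f i0 = [:: n].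
  apply: is_part_full => //; first exact: shape_is_part.
  have [_ _ ub _] := fP' i0.
  rewrite -[X in (X <= _)%N](card_ord n) -cardsT; apply: ub => //.
  rewrite /symsum irr0 (eq_bigr (fun=> 1)) => [|h hS].
    by rewrite sumr_const pnatr_eq0 card_Sym -lt0n fact_gt0.
  by rewrite cfun1E hS.
have i01 : i1 != i0.
  have x01 : Ordinal n0 != Ordinal n1 by [].
  apply/negP => /eqP /(congr1 (fun i => 'chi_i (tperm (Ordinal n0) (Ordinal n1)))).
  rewrite sgn_IirrE irr0 mulr1 cfSgnE odd_tperm cfun1E in_SymT x01 expr1.
  by move/eqP; rewrite eq_sym -addr_eq0 (pnatr_eq0 _ 2).
pose nl i := (i != i0) && (i != i1).
pose L := [seq contents (f i) | i <- enum (Iirr (Sym_group [set: 'I_n])) & nl i].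
exists L; split.
  (* The identity is proved over [algC], where the characters live, but stated over the integers,
     from where it passes to the reals. *)
  apply: (map_inj_poly (f := intr : int -> algC)); [exact: intr_inj|exact: rmorph0|].
  apply: poly_eq_horner => x.
  have hornerZ c : (map_poly (intr : int -> algC) ('X + c%:P)).[x] = x + c%:~R.
    by rewrite rmorphD /= map_polyX map_polyC /= !hornerE.
  transitivity (\sum_(a : 'S_n) \sum_(b : 'S_n) x ^+ #|porbits [~ a, b]%g|).
    rewrite rmorph_sum horner_sum; apply: eq_bigr => a _.
    rewrite rmorph_sum horner_sum; apply: eq_bigr => b _.
    by rewrite rmorphXn /= map_polyX hornerXn.
  rewrite (sum_commutator_cycles x fP) rmorphM /= hornerM rmorph_nat.
  rewrite -[X in X.[x]]polyC_natr hornerC; congr (_ * _).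
  rewrite (bigD1 i0) //= (bigD1 i1) //= addrA !rmorphD /= !hornerD; congr (_ + _ + _).
  - rewrite f0 content_prod_cons /content_prod big_nil mulr1 /rising rmorph_prod horner_prod.
    apply: eq_bigr => j _; rewrite -[j%:R in RHS]polyC_natr hornerZ.
    by rewrite natz.
  - rewrite content_prod_sgn // f0 /= cats0 big_map.
    have iotaE : iota 0 n = index_iota 0 n by rewrite /index_iota subn0.
    rewrite iotaE big_mkord rmorph_prod horner_prod.
    apply: eq_bigr => j _; rewrite -polyC_natr -[in RHS]polyCN hornerZ.
    by rewrite natz rmorphN.
  - rewrite rmorph_sum horner_sum /L big_map big_filter big_enum_cond /=.
    apply: eq_big => [i|i _]; first by rewrite /nl.
    rewrite /content_prod rmorph_prod horner_prod.
    by apply: eq_bigr => c _; rewrite hornerZ.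
move=> R y y0.
have F0 l : 0 <= abs_content_prod l y.
  by apply: prodr_ge0 => c _; rewrite addr_ge0 // ler0z.
have Fsgn i : abs_content_prod (f (sgn_Iirr i)) y = abs_content_prod (f i) y.
  rewrite /abs_content_prod (perm_big _ (contents_sgn fP i)) big_map.
  by apply: eq_bigr => c _; rewrite normrN.
have head_lt i : nl i -> (head 0 (f i) < n)%N.
  move=> /andP[ni0 _]; rewrite ltnNge; apply: contraNN ni0 => hn.
  by apply/eqP/f_inj; rewrite f0; apply: is_part_full => //; exact: shape_is_part.
have nl_sgn i : nl i -> nl (sgn_Iirr i).
  case/andP => ni0 ni1; rewrite /nl (inv_eq (@sgn_IirrK n)) ni1.
  by rewrite /i1 (inj_eq (inv_inj (@sgn_IirrK n))) ni0.
have f_pos i : (0 < size (f i))%N.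
  have /and3P[_ _ /eqP sum] := shape_is_part fP i.
  by case: (f i) sum => //= eq; rewrite -eq in n0.
(* The lowest box of the first column has content [1 - size (f i)]. The twist has the opposite
   content, which is less than its first row. Hence whichever of a character and its twist has the
   longer first row is good. *)
have size_le i : (size (f i) <= head 0 (f (sgn_Iirr i)))%N.
  have cin : (size (f i)).-1%:Z \in contents (f (sgn_Iirr i)).
    rewrite (perm_mem (contents_sgn fP i)) -[_%:Z]opprK; apply: map_f.
    exact: first_column_contents (shape_is_part fP i) _.
  have := contents_lt_head (shape_is_part fP _) cin; rewrite ltz_nat.
  by rewrite prednK.
have good i : nl i -> (f i \in good_shapes n) || (f (sgn_Iirr i) \in good_shapes n).
  move=> nli; rewrite !mem_filter !mem_parts ?shape_is_part ?(ltnW (head_lt _ _)) ?nl_sgn //.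
  rewrite !andbT !head_lt ?nl_sgn // !andbT.
  have := size_le i; have := size_le (sgn_Iirr i); rewrite sgn_IirrK.
  by case: (leqP (head 0%N (f (sgn_Iirr i))) (head 0%N (f i))); lia.
(* Each character of [L] is counted in [S + S] for itself or for its twist, which have the same
   product by [Fsgn]. *)
pose S := \sum_(i | f i \in good_shapes n) abs_content_prod (f i) y.
have Sle : S <= \sum_(l <- good_shapes n) abs_content_prod l y.
  have -> : S = \sum_(l <- [seq f i | i <- enum (Iirr (Sym_group [set: 'I_n])) &
      f i \in good_shapes n]) abs_content_prod l y.
    by rewrite big_map big_filter big_enum_cond.
  apply: sum_le_subset => //; first by rewrite map_inj_uniq // filter_uniq // enum_uniq.
  by move=> l /mapP[i]; rewrite mem_filter => /andP[? _] ->.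
rewrite -[leRHS]mulrC mulr_natr mulr2n; apply: le_trans (lerD Sle Sle).
rewrite /L big_map big_filter big_enum_cond /=.
have -> : S + S = \sum_i ((f i \in good_shapes n)%:R + (f (sgn_Iirr i) \in good_shapes n)%:R)
    * abs_content_prod (f i) y.
  under [RHS]eq_bigr do rewrite mulrDl.
  rewrite big_split /=; congr (_ + _); rewrite /S big_mkcond /=.
    by apply: eq_bigr => i _; case: ifP; rewrite ?mul1r ?mul0r.
  rewrite (reindex_inj (inv_inj (@sgn_IirrK n))) /=; apply: eq_bigr => i _.
  by rewrite Fsgn; case: ifP; rewrite ?mul1r ?mul0r.
rewrite [leLHS]big_mkcond /=; apply: ler_sum => i _; case: ifP => [/good|_].
  rewrite -[X in X <= _]mul1r => g; apply: ler_wpM2r; first exact: F0.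
  by case: (f i \in _) g => /= [_|->]; rewrite ?lerDl ?lerDr ?ler0n //.
by apply: mulr_ge0; rewrite ?addr_ge0 ?ler0n.
Qed.

(** * Bounds on content polynomials *)

Section Rising.
Variable R : realFieldType.
Implicit Types (x y : R).

Lemma rising_gt0 y m : 0 < y -> 0 < rising y m.
Proof. by move=> y0; apply: prodr_gt0 => j _; rewrite ltr_wpDr. Qed.

Lemma risingD y m k : rising y (m + k) = rising y m * rising (y + m%:R) k.
Proof.
rewrite /rising big_split_ord /=; congr (_ * _).
by apply: eq_bigr => j _; rewrite natrD addrA.
Qed.

Lemma risingS y m : rising y m.+1 = rising y m * (y + m%:R).
Proof. by rewrite /rising big_ord_recr. Qed.

Lemma rising_le x y m : 0 <= x -> x <= y -> rising x m <= rising y m.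
Proof.
move=> x0 xy; apply: ler_prod => j _.
by rewrite addr_ge0 //= lerD2r.
Qed.

Lemma rising3 m : rising 3 m = m.+2`!%:R / 2 :> R.
Proof.
elim: m => [|m IH]; first by rewrite /rising big_ord0 divff.
by rewrite risingS IH [in RHS]factS natrM -[m.+3]/(3 + m)%N natrD; ring.
Qed.

Lemma rising54_sqr m : rising (5 / 4) m ^+ 2 <= m`!%:R ^+ 2 * m.+1%:R :> R.
Proof.
elim: m => [|m IH]; first by rewrite /rising big_ord0 expr1n mulr1.
rewrite risingS exprMn factS natrM.
apply: (@le_trans _ _ (m`!%:R ^+ 2 * m.+1%:R * (5 / 4 + m%:R) ^+ 2)).
  by apply: ler_wpM2r => //; rewrite sqr_ge0.
have -> : m.+2%:R = m%:R + 2 :> R by rewrite -[m.+2]/(2 + m)%N natrD addrC.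
rewrite -natr1; set f := m`!%:R; set z := m%:R.
have z0 : 0 <= z by rewrite ler0n.
have -> : ((z + 1) * f) ^+ 2 * (z + 2) = f ^+ 2 * (z + 1) * ((z + 1) * (z + 2)) by ring.
apply: ler_wpM2l; last by nra.
by rewrite mulr_ge0 ?sqr_ge0 // addr_ge0.
Qed.

End Rising.

Section AbsContent.
Variable R : realFieldType.
Implicit Types (x y : R).

Lemma abs_content_prod_cons m l y : 0 <= y ->
  abs_content_prod (m :: l) y <= rising y m * abs_content_prod l (y + 1).
Proof.
move=> y0; have iotaE : iota 0 m = index_iota 0 m by rewrite /index_iota subn0.
rewrite /abs_content_prod big_cat !big_map iotaE big_mkord /=.
apply: ler_pM; [by apply: prodr_ge0 => j _; rewrite addr_ge0 // ler0z| |exact: lexx|].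
  by apply: prodr_ge0 => j _; rewrite addr_ge0 // ler0z.
apply: ler_prod => c _; rewrite addr_ge0 ?ler0z //= -addrA lerD2l.
rewrite -[1 in leRHS](mulr1z 1) -intrD ler_int.
by apply: le_trans (ler_normB c 1) _; rewrite normr1 addrC.
Qed.

(** If the boxes are numbered from 0, row after row, the content of each is at most its number in
    absolute value, as every row above it has at least one box. *)
Lemma abs_content_prod_le l y : 0 < y -> all (ltn 0) l ->
  abs_content_prod l y <= rising y (sumn l).
Proof.
elim: l y => [|m l IH] y y0 /=; first by rewrite /abs_content_prod big_nil /rising big_ord0.
move=> /andP[m0 pos]; apply: le_trans (abs_content_prod_cons _ _ (ltW y0)) _.
rewrite risingD; apply: ler_wpM2l; first exact/ltW/rising_gt0.
apply: le_trans (IH _ _ pos) _; first by rewrite addr_gt0.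
by apply: rising_le; [rewrite addr_ge0 // ltW|rewrite lerD2l ler1n].
Qed.

Lemma contents_ge l c : c \in contents l -> - (size l).-1%:Z <= c.
Proof.
elim: l c => //= m l IH c; rewrite mem_cat => /orP[/mapP[j _ ->]|/mapP[d dl ->]].
  by lia.
have := IH _ dl; case: l dl {IH} => //= b l _; lia.
Qed.

Lemma abs_content_prod_good n l y : 0 <= y -> is_part n l ->
  (size l <= head 0 l)%N -> abs_content_prod l y <= (y + (head 0 l)%:R) ^+ n.
Proof.
move=> y0 lP lh; have /and3P[_ _ /eqP <-] := lP.
have -> : (y + (head 0%N l)%:R) ^+ sumn l = \prod_(c <- contents l) (y + (head 0%N l)%:R).
  by rewrite -size_contents big_const_seq count_predT iter_mulr_1.
rewrite /abs_content_prod !big_seq; apply: ler_prod => c cl.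
rewrite addr_ge0 ?ler0z //= lerD2l -[_%:R]/(_%:Z%:~R) ler_int.
have := contents_ge cl; have := contents_lt_head lP cl.
by case: l lh {lP cl} => //= m l; lia.
Qed.

End AbsContent.

(** * Counting partitions *)

Section CountParts.
Variable R : realFieldType.

(* Any bounded sequence with values at least 1 that satisfies [parts_cap_step]
   would do: it replaces the product of the 1 / (1 - (4 / 5) ^ i), i <= l. *)
Definition parts_cap l : R :=
  if (l <= 7)%N then 5 ^+ l else 4 * 5 ^+ 7 * (1 - 4 * (4 / 5) ^+ l).

Let t8 l : (8 <= l)%N -> (4 / 5) ^+ l <= 17 / 100 :> R.
Proof.
move=> l8; apply: (@le_trans _ _ ((4 / 5) ^+ 8)); first by apply: ler_wiXn2l => //; lra.
have t4 : (4 / 5) ^+ 4 <= 41 / 100 :> R.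
  by rewrite (exprM _ 2 2) !expr2; lra.
rewrite (exprM _ 4 2); apply: (@le_trans _ _ ((41 / 100) ^+ 2)); last by rewrite expr2; lra.
by apply: lerXn2r t4; rewrite nnegrE ?exprn_ge0 //; lra.
Qed.

(** Up to 7 the factor [1 - (4 / 5) ^+ l.+1] is at least 1/5. Beyond, with [t = (4 / 5) ^+ l], the
    linear terms of [(1 - 16 t / 5) (1 - 4 t / 5)] add up to [- 4 t], and a positive multiple of
    [t^2] is left over. The change of formula is covered by [(4 / 5) ^+ 8 <= 17 / 100]. *)
Lemma parts_cap_step l : parts_cap l <= parts_cap l.+1 * (1 - (4 / 5) ^+ l.+1).
Proof.
rewrite /parts_cap; case: (ltngtP l 7) => [l7|l7|->].
- rewrite exprSr -mulrA -[leLHS]mulr1; apply: ler_wpM2l; first by rewrite exprn_ge0.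
  have : (4 / 5) ^+ l.+1 <= (4 / 5) ^+ 1 :> R by apply: ler_wiXn2l => //; lra.
  by rewrite expr1; lra.
- rewrite -[leRHS]mulrA; apply: ler_wpM2l; first by rewrite mulr_ge0 ?exprn_ge0.
  by rewrite exprSr; have := sqr_ge0 ((4 / 5) ^+ l : R); nra.
- have z0 : 0 < 5 ^+ 7 :> R by rewrite exprn_gt0.
  have := t8 (leqnn 8); move: z0; move: (5 ^+ 7) ((4 / 5) ^+ 8) => z t z0 t8'.
  rewrite /= -[leLHS]mulr1 [4 * z]mulrC -!mulrA ler_pM2l //.
  by nra.
Qed.

Lemma parts_cap_ge1 l : 1 <= parts_cap l.
Proof.
rewrite /parts_cap; case: leqP => l7; first by rewrite exprn_ege1 // ler1n.
have := t8 l7.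
have : 1 <= 5 ^+ 7 :> R by rewrite exprn_ege1 // ler1n.
by move: (5 ^+ 7) ((4 / 5) ^+ l) => z u; nra.
Qed.

Lemma parts_cap_le l : parts_cap l <= 4 * 5 ^+ 7.
Proof.
have z1 : 1 <= 5 ^+ 7 :> R by rewrite exprn_ege1 // ler1n.
rewrite /parts_cap; case: leqP => l7.
  apply: (@le_trans _ _ (5 ^+ 7)); first by rewrite ler_weXn2l // ler1n.
  by move: z1; move: (5 ^+ 7) => z; lra.
rewrite -[leRHS]mulr1; apply: ler_wpM2l; first by move: z1; move: (5 ^+ 7) => z; lra.
by have : 0 <= (4 / 5) ^+ l :> R by rewrite exprn_ge0 //; lra.
Qed.

(** Choosing the largest part [l] costs a factor [(4 / 5) ^+ l], and by [parts_cap_step] the product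
    [parts_cap l * (4 / 5) ^+ l] is at most an increment of [parts_cap]: the sum over [l]
    telescopes. *)
Lemma size_parts_cap k n m : (size (parts k n m))%:R <= parts_cap m * (5 / 4) ^+ n.
Proof.
elim: k n m => [|k IH] n m /=.
  by rewrite mulr_ge0 ?exprn_ge0 ?(le_trans _ (parts_cap_ge1 _)) //; lra.
case: n => [|n] /=; first by rewrite expr0 mulr1 parts_cap_ge1.
set N := n.+1; rewrite size_flatten /shape -map_comp sumnE big_map natr_sum.
apply: (@le_trans _ _ (\sum_(1 <= l < (minn m N).+1) (parts_cap l - parts_cap l.-1) * (5 / 4) ^+ N)).
  rewrite /index_iota subSS subn0 !big_seq; apply: ler_sum => l.
  rewrite mem_iota add1n ltnS leq_min => /andP[l0 /andP[_ lN]] /=.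
  rewrite size_map; apply: le_trans (IH _ _) _.
  have -> : (5 / 4) ^+ (N - l) = (5 / 4) ^+ N * (4 / 5) ^+ l :> R.
    rewrite -[in RHS](subnK lN) exprD -mulrA -exprMn.
    by rewrite (_ : 5 / 4 * (4 / 5) = 1 :> R) ?expr1n ?mulr1 //; lra.
  rewrite mulrCA mulrC; apply: ler_wpM2r; first by rewrite exprn_ge0 //; lra.
  by have := parts_cap_step l.-1; rewrite prednK //; lra.
rewrite -mulr_suml; apply: ler_wpM2r; first by rewrite exprn_ge0 //; lra.
apply: (@le_trans _ _ (parts_cap (minn m N))).
  rewrite big_add1 /= (telescope_sumr (fun l => parts_cap l)) // gerBl.
  exact: le_trans (parts_cap_ge1 _).
have mono i j : (i <= j)%N -> parts_cap i <= parts_cap j.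
  move=> /subnK <-; elim: (j - i)%N => // d; rewrite addSn => /le_trans; apply.
  apply: le_trans (parts_cap_step _) _; rewrite -[leRHS]mulr1; apply: ler_wpM2l.
    exact: le_trans (parts_cap_ge1 _).
  by have : 0 <= (4 / 5) ^+ (d + i).+1 :> R by rewrite exprn_ge0 //; lra.
by apply: mono; exact: geq_minl.
Qed.

Lemma size_parts k n m : (size (parts k n m))%:R <= 4 * 5 ^+ 7 * (5 / 4) ^+ n :> R.
Proof.
apply: le_trans (size_parts_cap _ _ _) _; apply: ler_wpM2r.
  by rewrite exprn_ge0 //; lra.
exact: parts_cap_le.
Qed.
End CountParts.

Lemma parts_sound k n m l : l \in parts k n m -> is_part n l /\ (head 0 l <= m)%N.
Proof.
elim: k n m l => // k IH [|n] m l /=; first by rewrite inE => /eqP ->.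
move=> /flatten_mapP[a]; rewrite mem_iota add1n ltnS leq_min => /andP[a0 /andP[am an]].
move=> /mapP[p /IH[/and3P[srt pos /eqP sum] hp] ->]; split=> //=.
rewrite /is_part /= a0 pos sum subnKC // eqxx !andbT.
by case: p srt hp {pos sum} => //= b p -> ->.
Qed.

(** Induction by n binomial(n - 1, k - 1) = k binomial(n, k), since n / k <= (n - 1) / (k - 1) for 1
    < k <= n. *)
Lemma leq_exp_bin n k : (k <= n)%N -> (n ^ k <= k ^ k * 'C(n, k))%N.
Proof.
elim: k n => [|k IH] [|n] // kn.
rewrite !expnS -mulnA mulnCA -mul_bin_diag mulnCA leq_mul2l /=.
case: k IH kn => [|k] IH kn; first by rewrite bin0.
have := IH n kn; set K := k.+1; set b := 'C(_, _) => IHn.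
have Kpos : (0 < K ^ K)%N by rewrite expn_gt0.
rewrite -(leq_pmul2l Kpos) -expnMn; apply: (@leq_trans ((K.+1 * n) ^ K)%N).
  by rewrite leq_exp2r //; nia.
by rewrite expnMn mulnCA leq_mul2l IHn orbT.
Qed.

(** * The contribution of the good shapes *)

Section GoodShapes.
Variable R : realType.

Lemma sum_good_shapes n (F : seq nat -> R) (b : nat -> R) : (0 < n)%N ->
  (forall m, 0 <= b m) ->
  (forall m l, (0 < m < n)%N -> is_part n (m :: l) -> (size (m :: l) <= m)%N ->
     F (m :: l) <= b m) ->
  \sum_(l <- good_shapes n) F l <=
  \sum_(1 <= m < n) 4 * 5 ^+ 7 * (5 / 4) ^+ (n - m) * b m.
Proof.
case: n => // n _ b0 Fb; set N := n.+1.
have -> : good_shapes N = [seq l <- flatten [seq [seq m :: p | p <- parts N (N - m) m]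
  | m <- iota 1 N] | (size l <= head 0 l < N)%N] by rewrite /good_shapes /= minnn.
rewrite big_filter big_flatten big_map.
have -> : iota 1 N = index_iota 1 N.+1 by rewrite /index_iota subSS subn0.
rewrite big_nat_recr //= [X in _ + X]big_map [X in _ + X]big1 ?addr0; last first.
  by move=> p; rewrite ltnn andbF.
rewrite !big_nat; apply: ler_sum => m mN; rewrite big_map /=.
apply: (@le_trans _ _ (\sum_(p <- parts N (N - m) m) b m)); last first.
  by rewrite big_const_seq count_predT iter_addr_0 -[_ *+ _]mulr_natl ler_wpM2r // size_parts.
rewrite big_mkcond /= !big_seq; apply: ler_sum => p pP; case: ifP => // /andP[sp _].
have [/and3P[srt pos /eqP sum] hp] := @parts_sound N (N - m) m p pP.
apply: Fb => //; have [m0 mlt] := andP mN.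
rewrite /is_part /= m0 pos sum subnKC ?(ltnW mlt) // eqxx !andbT.
by case: p srt hp {pos sum sp pP} => //= c p -> ->.
Qed.

Lemma fact_ge_exp n : n%:R ^+ n <= 3 ^+ n * n`!%:R :> R.
Proof.
case: n => [|n]; first by rewrite !expr0 mul1r.
(* From [expR (- (1 / 8)) >= 7 / 8] one gets [expR 1 <= (8 / 7) ^+ 8], which is about 2.91. *)
have e3 : expR 1 <= 3 :> R.
  have e8 : expR (1 / 8) <= 8 / 7 :> R.
    have := expR_ge1Dx (- (1 / 8) : R); rewrite expRN => h.
    rewrite -[expR _]invrK -[8 / 7]invrK lef_pV2 ?posrE ?invr_gt0 ?expR_gt0 //; lra.
  have -> : 1 = 8%:R * (1 / 8) :> R by lra.
  rewrite expRM_natl; apply: (@le_trans _ _ ((8 / 7) ^+ 8)).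
    by apply: lerXn2r e8; rewrite nnegrE ?expR_ge0 //; lra.
  have -> : 8%N = (2 * (2 * 2))%N by []; rewrite !exprM.
  have h2 : (8 / 7) ^+ 2 <= 131 / 100 :> R by rewrite expr2; lra.
  have h4 : ((8 / 7) ^+ 2) ^+ 2 <= 172 / 100 :> R.
    apply: (@le_trans _ _ ((131 / 100) ^+ 2)); last by rewrite expr2; lra.
    by apply: lerXn2r h2; rewrite nnegrE ?exprn_ge0 //; lra.
  apply: (@le_trans _ _ ((172 / 100) ^+ 2)); last by rewrite expr2; lra.
  by apply: lerXn2r h4; rewrite nnegrE ?exprn_ge0 //; lra.
have := expR_ge1Dxn n (ler0n R n.+1) => h.
have h3 : expR n.+1%:R <= 3 ^+ n.+1 :> R.
  rewrite -[n.+1%:R]mulr1 expRM_natl; apply: lerXn2r e3; rewrite nnegrE ?expR_ge0 //.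
rewrite -ler_pdivrMr ?ltr0n ?fact_gt0 //.
by apply: le_trans h3; apply: le_trans h; rewrite lerDr.
Qed.

Lemma exp_decay : exists2 B : R, 0 <= B &
  forall n, (0 < n)%N -> (15 / 16) ^+ (n %/ 4) * n%:R ^+ 6 <= B.
Proof.
(* 96 = 6 . 16: the exponential of - q / 16 is split evenly among the six factors [n%:R]. *)
have [c ce] : {c : R | c = 96} by exists 96.
have c0 : 0 < c by rewrite ce.
have c4 : 4 <= c by rewrite ce; lra.
exists ((4 * c) ^+ 6) => [|n n0]; first by rewrite exprn_ge0 // mulr_ge0 // ltW.
set q := (n %/ 4)%N.
have n0' : 0 < n%:R :> R by rewrite ltr0n.
have h1 : 15 / 16 <= expR (- (1 / 16)) :> R.
  by have := expR_ge1Dx (- (1 / 16) : R); lra.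
have h2 : expR (- (q%:R / c)) * n%:R <= 4 * c.
  have h := expR_ge1Dx (q%:R / c).
  have nq : n%:R <= 4 * q%:R + 4 :> R.
    by rewrite -natrM -natrD ler_nat; have := ltn_pmod n (isT : (0 < 4)%N);
       have := divn_eq n 4; rewrite -/q; lia.
  rewrite expRN mulrC ler_pdivrMr ?expR_gt0 //.
  have : 4 * c * (1 + q%:R / c) <= 4 * c * expR (q%:R / c).
    by rewrite ler_wpM2l // mulr_ge0 // ltW.
  have -> : 4 * c * (1 + q%:R / c) = 4 * c + 4 * q%:R by field; rewrite gt_eqF.
  by lra.
have h3 : (15 / 16) ^+ q <= expR (- (q%:R / c)) ^+ 6.
  apply: (@le_trans _ _ (expR (- (1 / 16)) ^+ q)).
    by apply: lerXn2r h1; rewrite nnegrE ?expR_ge0 //; lra.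
  by rewrite -!expRM_natl ler_expR ce; lra.
apply: (@le_trans _ _ ((expR (- (q%:R / c)) * n%:R) ^+ 6)).
  by rewrite [leRHS]exprMn ler_wpM2r // exprn_ge0 // ltW.
apply: lerXn2r h2; rewrite nnegrE; first by rewrite mulr_ge0 ?expR_ge0 // ltW.
by rewrite mulr_ge0 // ltW.
Qed.

(** Bounds, up to [Num.sqrt n%:R / 2], the contribution of the shapes with [k] boxes below a long
    first row: there are O((5/4)^k) of them, those boxes contribute at most (k + 2)! / 2, and (k +
    2)! (n - k)! / n! is (k + 2)(k + 1) divided by the binomial coefficient. *)
Let S n k : R := k.+2%:R * k.+1%:R * (5 / 4) ^+ k / 'C(n, k)%:R.

Let S_ge0 n k : 0 <= S n k.
Proof.
by rewrite /S divr_ge0 ?mulr_ge0 ?exprn_ge0 //; lra.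
Qed.

Let S_step n k : (k < n)%N -> S n k.+1 = S n k * (5 / 4 * k.+3%:R / (n - k)%:R).
Proof.
move=> kn; have nk0 : (n - k)%:R != 0 :> R by rewrite pnatr_eq0; lia.
have b0 : 'C(n, k)%:R != 0 :> R by rewrite pnatr_eq0 -lt0n bin_gt0 ltnW.
have b1 : 'C(n, k.+1)%:R != 0 :> R by rewrite pnatr_eq0 -lt0n bin_gt0.
have k1 : k.+1%:R != 0 :> R by rewrite pnatr_eq0.
have e : k.+1%:R * 'C(n, k.+1)%:R = (n - k)%:R * 'C(n, k)%:R :> R.
  by rewrite -!natrM mul_bin_left.
rewrite /S exprS; have -> : 'C(n, k.+1)%:R = (n - k)%:R * 'C(n, k)%:R / k.+1%:R :> R.
  by rewrite -e mulrC mulKf.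
rewrite -[k.+3]/(2 + k.+1)%N -[k.+2]/(1 + k.+1)%N !natrD.
by move: k1 nk0 b0; move: (k.+1%:R) => w k1 nk0 b0; field; rewrite nk0 b0 k1.
Qed.

(** [S n 1] is 15/2 divided by n, and successive terms decrease at least by the factor 1/2 in this
    range. *)
Let S_small n k : (60 <= n)%N -> (k < n %/ 4)%N -> S n k.+1 <= (1 / 2) ^+ k * (15 / 2 / n%:R).
Proof.
move=> n60; have n0 : 0 < n%:R :> R by rewrite ltr0n; lia.
elim: k => [|k IH] kq.
  rewrite /S bin1 expr0 expr1 mul1r ler_pM2r ?invr_gt0 //; lra.
have nk : (k.+1 < n)%N by lia.
rewrite S_step // exprSr [leRHS]mulrAC.
have h : 5 / 4 * k.+4%:R / (n - k.+1)%:R <= 1 / 2 :> R.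
  have d0 : 0 < (n - k.+1)%:R :> R by rewrite ltr0n; lia.
  rewrite ler_pdivrMr // natrB ?(ltnW nk) //.
  (* With k + 1 <= n / 4 this follows from n >= 60, as then 7 n / 4 + 15 <= 2 n. *)
  have : 7 * k.+1%:R + 15 <= 2 * n%:R :> R by rewrite -!natrM -natrD ler_nat; lia.
  by rewrite -[k.+4]/(3 + k.+1)%N natrD; lra.
apply: ler_pM h; [exact: S_ge0| |exact: IH (ltnW kq)].
by rewrite divr_ge0 ?mulr_ge0 ?ler0n //; lra.
Qed.

(** By [leq_exp_bin] the exponential part is at most (5 k / (4 n))^k, whose base is at most 15/16
    because k <= 3 n / 4. *)
Let S_large n k : (0 < n)%N -> (n %/ 4 <= k)%N -> (4 * k <= 3 * n)%N ->
  S n k <= n.+2%:R ^+ 2 * (15 / 16) ^+ (n %/ 4).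
Proof.
move=> n0 qk kn; have kn' : (k <= n)%N by lia.
have b0 : 0 < 'C(n, k)%:R :> R by rewrite ltr0n bin_gt0.
rewrite /S -mulrA; apply: ler_pM.
- by rewrite mulr_ge0.
- by rewrite divr_ge0 ?exprn_ge0 ?ltW //; lra.
- by rewrite expr2; apply: ler_pM; rewrite ?ler0n // ler_nat; lia.
apply: (@le_trans _ _ ((15 / 16) ^+ k)); last first.
  by apply: ler_wiXn2l => //; lra.
rewrite ler_pdivrMr //.
have nn0 : 0 < n%:R ^+ k :> R by rewrite exprn_gt0 // ltr0n.
rewrite -(ler_pM2r nn0).
have := leq_exp_bin kn'; rewrite -(ler_nat R) natrM !natrX => h.
apply: (@le_trans _ _ ((5 / 4) ^+ k * (k%:R ^+ k * 'C(n, k)%:R))).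
  by rewrite ler_wpM2l // exprn_ge0 //; lra.
rewrite mulrA [leRHS]mulrAC -!exprMn ler_pM2r //; apply: lerXn2r; rewrite ?nnegrE ?mulr_ge0 //; try lra.
have : 4 * k%:R <= 3 * n%:R :> R by rewrite -!natrM ler_nat.
by lra.
Qed.

(* m is the first row. If it is short, all contents are at most m in absolute
   value; otherwise the number of the remaining boxes is bounded by 3 n / 4. *)
Lemma good_shapes_term n m : (60 <= n)%N -> (0 < m < n)%N ->
  (5 / 4) ^+ (n - m) * (if (4 * m < n)%N then (5 / 4 + m%:R) ^+ n
                        else rising (5 / 4) m * rising (9 / 4) (n - m)) / n`!%:R <=
  expR 5 * (15 / 16) ^+ (n %/ 4) +
  Num.sqrt n%:R / 2 * ((1 / 2) ^+ (n - m).-1 * (15 / 2 / n%:R)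
                       + n.+2%:R ^+ 2 * (15 / 16) ^+ (n %/ 4)) :> R.
Proof.
move=> n60 /andP[m0 mn]; have n0 : 0 < n%:R :> R by rewrite ltr0n; lia.
have f0 j : 0 < j`!%:R :> R by rewrite ltr0n fact_gt0.
have E0 : 0 <= (15 / 16) ^+ (n %/ 4) :> R by rewrite exprn_ge0 //; lra.
have h0 : 0 <= (1 / 2) ^+ (n - m).-1 * (15 / 2 / n%:R) :> R.
  by rewrite mulr_ge0 ?exprn_ge0 ?divr_ge0 ?ler0n //; lra.
case: ltnP => mn4.
  rewrite -[leLHS]addr0; apply: lerD; last first.
    by rewrite mulr_ge0 ?divr_ge0 ?sqrtr_ge0 // addr_ge0 // mulr_ge0 ?exprn_ge0.
  rewrite ler_pdivrMr //.
  (* The 5 of [expR 5]: n/4 + 5/4 is n/4 times 1 + 5/n. *)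
  have h1 : 5 / 4 + m%:R <= (n%:R / 4) * (1 + 5 / n%:R) :> R.
    rewrite mulrDr mulr1 mulrCA -[_ / 4 * _]mulrAC divff ?gt_eqF // mul1r.
    have : 4 * m%:R <= n%:R :> R by rewrite -natrM ler_nat ltnW.
    by lra.
  have h2 : (1 + 5 / n%:R) ^+ n <= expR 5 :> R.
    have E5 : n%:R * (5 / n%:R) = 5 :> R by field; rewrite gt_eqF.
    rewrite -[in leRHS]E5 expRM_natl; apply: lerXn2r (expR_ge1Dx (5 / n%:R)); last by rewrite nnegrE expR_ge0.
    by rewrite nnegrE addr_ge0 // divr_ge0 // ltW.
  have h3 := fact_ge_exp n.
  have c0 : 0 <= 1 + 5 / n%:R :> R by rewrite addr_ge0 // divr_ge0 // ltW.
  apply: (@le_trans _ _ ((5 / 4) ^+ n * ((n%:R / 4) * (1 + 5 / n%:R)) ^+ n)).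
    apply: ler_pM; rewrite ?exprn_ge0 ?addr_ge0 //; try lra.
      by apply: ler_weXn2l; [lra|rewrite leq_subr].
    have n4 : 0 <= n%:R / 4 :> R by lra.
    apply: lerXn2r h1; rewrite nnegrE; last exact: mulr_ge0.
    by rewrite addr_ge0 //; lra.
  rewrite [(_ * (1 + _)) ^+ n]exprMn mulrA -exprMn.
  (* By [fact_ge_exp] the powers of n/3 are compensated by the factorial, which leaves those of
     15/16. *)
  have -> : 5 / 4 * (n%:R / 4) = 15 / 16 * (n%:R / 3) :> R by field.
  have q1 : (15 / 16) ^+ n <= (15 / 16) ^+ (n %/ 4) :> R.
    by apply: ler_wiXn2l; [lra|lra|exact: leq_div].
  have q2 : (n%:R / 3) ^+ n <= n`!%:R :> R.
    by rewrite expr_div_n ler_pdivrMr ?exprn_gt0 // mulrC.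
  have n3 : 0 <= n%:R / 3 :> R by rewrite divr_ge0 // ltW.
  have p0 : 0 <= 15 / 16 :> R by lra.
  rewrite exprMn -mulrA [expR 5 * _]mulrC; apply: (@le_trans _ _
    ((15 / 16) ^+ (n %/ 4) * (n`!%:R * expR 5))); last by rewrite mulrA mulrAC.
  apply: ler_pM; rewrite ?mulr_ge0 ?exprn_ge0 //.
  by apply: ler_pM; rewrite ?exprn_ge0.
rewrite -[leLHS]add0r; apply: lerD; first by rewrite mulr_ge0 ?expR_ge0.
set k := (n - m)%N; have k0 : (0 < k)%N by rewrite /k subn_gt0.
have kn : (k <= n)%N by rewrite /k leq_subr.
have r1 : rising (5 / 4) m <= m`!%:R * Num.sqrt n%:R :> R.
  have r0 : 0 <= rising (5 / 4) m :> R by apply/ltW/rising_gt0; lra.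
  rewrite -(@ler_pXn2r _ 2) ?nnegrE ?mulr_ge0 ?sqrtr_ge0 // exprMn (sqr_sqrtr (ltW n0)).
  by apply: (le_trans (rising54_sqr R m)); rewrite ler_wpM2l ?sqr_ge0 // ler_nat.
have r2 : rising (9 / 4) k <= k.+2`!%:R / 2 :> R.
  by rewrite -rising3; apply: rising_le; lra.
apply: (@le_trans _ _ (Num.sqrt n%:R / 2 * S n k)).
  rewrite ler_pdivrMr // -(bin_fact kn) !natrM.
  have -> : (n - k)%N = m by rewrite /k subKn // ltnW.
  have b0 : 'C(n, k)%:R != 0 :> R by rewrite pnatr_eq0 -lt0n bin_gt0.
  have -> : Num.sqrt n%:R / 2 * S n k * ('C(n, k)%:R * (k`!%:R * m`!%:R)) =
      (5 / 4) ^+ k * ((m`!%:R * Num.sqrt n%:R) * (k.+2`!%:R / 2)) :> R.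
    by rewrite /S !factS !natrM; field.
  apply: ler_wpM2l; first by rewrite exprn_ge0 //; lra.
  by apply: ler_pM => //; apply/ltW/rising_gt0; lra.
apply: ler_wpM2l; first by rewrite divr_ge0 ?sqrtr_ge0.
have [kq|kq] := ltnP k.-1 (n %/ 4).
  have := S_small n60 kq; rewrite prednK // => /le_trans; apply.
  by rewrite lerDl mulr_ge0 // exprn_ge0.
apply: (@le_trans _ _ (n.+2%:R ^+ 2 * (15 / 16) ^+ (n %/ 4))); last by rewrite lerDr.
by apply: S_large; rewrite /k; lia.
Qed.

Theorem good_shapes_bound : exists K : R, forall n, (60 <= n)%N ->
  (\sum_(l <- good_shapes n) abs_content_prod l (5 / 4)) / n`!%:R <= K / Num.sqrt n%:R.
Proof.
have [D DE] : {D : R | D = 4 * 5 ^+ 7} by exists (4 * 5 ^+ 7).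
have [A A0 AP] := exp_decay.
(* After multiplication by the square root of n, the short first rows give [expR 5 * A] by [e1], the
   geometric sum gives 15 by [e3], and the remaining terms give [9 * A] by [e2], where 9 comes from
   n + 2 <= 3 n. *)
exists (D * (expR 5 * A + (15 + 9 * A) / 2)) => n n60.
have n0 : 0 < n%:R :> R by rewrite ltr0n; lia.
have n1 : 1 <= n%:R :> R by rewrite ler1n; lia.
have f0 j : 0 < j`!%:R :> R by rewrite ltr0n fact_gt0.
pose b m : R := if (4 * m < n)%N then (5 / 4 + m%:R) ^+ n
                else rising (5 / 4) m * rising (9 / 4) (n - m).
have b0 m : 0 <= b m.
  rewrite /b; case: ifP => _; first by rewrite exprn_ge0 // addr_ge0 //; lra.
  by rewrite mulr_ge0 //; apply/ltW/rising_gt0; lra.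
have Db : forall m l, (0 < m < n)%N -> is_part n (m :: l) -> (size (m :: l) <= m)%N ->
     abs_content_prod (m :: l) (5 / 4) <= b m.
  move=> m l _ lP lm; rewrite /b; case: ifP => _.
    by apply: abs_content_prod_good lP lm; lra.
  have /and3P[_ /= /andP[_ pos] /eqP sum] := lP.
  apply: le_trans (abs_content_prod_cons _ _ _) _; first lra.
  rewrite ler_wpM2l //; first by apply/ltW/rising_gt0; lra.
  have -> : (n - m)%N = sumn l by lia.
  have -> : 9 / 4 = 5 / 4 + 1 :> R by lra.
  by apply: abs_content_prod_le => //; lra.
have D0 : 0 <= D by rewrite DE mulr_ge0 ?exprn_ge0.
have [E EE] : {E : R | E = (15 / 16) ^+ (n %/ 4)} by exists ((15 / 16) ^+ (n %/ 4)).
have E0 : 0 <= E by rewrite EE exprn_ge0 //; lra.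
have EA : E * n%:R ^+ 6 <= A.
  by rewrite EE AP //; lia.
have [s sE] : {s : R | s = Num.sqrt n%:R} by exists (Num.sqrt n%:R).
have s0 : 0 < s by rewrite sE sqrtr_gt0.
have ss : s * s = n%:R by rewrite sE -expr2 sqr_sqrtr // ltW.
rewrite -sE.
have s1 : 1 <= s by nra.
apply: (@le_trans _ _ (\sum_(1 <= m < n) D * (expR 5 * E +
    s / 2 * ((1 / 2) ^+ (n - m).-1 * (15 / 2 / n%:R) + n.+2%:R ^+ 2 * E)))).
  rewrite ler_pdivrMr //; apply: le_trans (sum_good_shapes _ b0 Db) _; first lia.
  rewrite -ler_pdivrMr // mulr_suml !big_nat; apply: ler_sum => m mn.
  apply: (@le_trans _ _ (D * ((5 / 4) ^+ (n - m) * b m / n`!%:R))); first by rewrite DE !mulrA.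
  by rewrite sE EE; apply: ler_wpM2l => //; exact: good_shapes_term.
rewrite -mulr_sumr -[leRHS]mulrA; apply: ler_wpM2l => //.
clear DE EE sE AP.
rewrite big_split /= sumr_const_nat -mulr_sumr big_split /= -mulr_suml sumr_const_nat.
have geo : \sum_(1 <= m < n) (1 / 2) ^+ (n - m).-1 <= 2 :> R.
  rewrite big_nat_rev /= (eq_big_nat _ _ (F2 := fun i => (1 / 2) ^+ i.-1)); last first.
    by move=> i /andP[i0 iln]; congr (_ ^+ _); lia.
  rewrite big_add1 /=; have : \sum_(0 <= i < n.-1) (1 / 2) ^+ i = 2 - 2 * (1 / 2) ^+ n.-1 :> R.
    elim: n.-1 => [|j IH]; first by rewrite big_nil expr0; lra.
    by rewrite big_nat_recr //= IH exprS; lra.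
  by move=> ->; have : 0 <= (1 / 2) ^+ n.-1 :> R; [rewrite exprn_ge0 //; lra|lra].
rewrite ler_pdivlMr // -[expR 5 * E *+ _]mulr_natr -[n.+2%:R ^+ 2 * E *+ _]mulr_natr.
set G := \sum_(1 <= m < n) _ in geo *.
have nn : (n - 1)%:R <= n%:R :> R by rewrite ler_nat leq_subr.
have n2 : n.+2%:R <= 3 * n%:R :> R by rewrite -[n.+2]addn2 natrD; lra.
have e1 : E * (n - 1)%:R * s <= A.
  apply: le_trans EA; rewrite -mulrA; apply: ler_wpM2l => //.
  apply: (@le_trans _ _ (n%:R ^+ 2)).
    have sn : s <= n%:R by rewrite -ss -[leLHS]mulr1 ler_wpM2l // ltW.
    by rewrite expr2; apply: ler_pM => //; exact: ltW.
  by apply: ler_weXn2l.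
have e2 : s * (n.+2%:R ^+ 2 * E * (n - 1)%:R) * s <= 9 * A.
  have -> : s * (n.+2%:R ^+ 2 * E * (n - 1)%:R) * s = n.+2%:R ^+ 2 * (E * (n - 1)%:R * n%:R).
    by rewrite -ss; ring.
  apply: (@le_trans _ _ ((9 * n%:R ^+ 2) * (E * n%:R * n%:R))).
    apply: ler_pM; rewrite ?exprn_ge0 ?mulr_ge0 ?ler0n //.
      have -> : 9 = 3 ^+ 2 :> R by rewrite expr2; lra.
      by rewrite -exprMn; apply: lerXn2r n2; rewrite nnegrE ?mulr_ge0 ?ler0n.
    by rewrite ler_wpM2r ?ler0n // ler_wpM2l.
  rewrite -mulrA ler_wpM2l //; apply: le_trans EA.
  have -> : n%:R ^+ 2 * (E * n%:R * n%:R) = E * n%:R ^+ 4 by ring.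
  by apply: ler_wpM2l => //; apply: ler_weXn2l.
have e3 : s * (G * (15 / 2 / n%:R)) * s <= 15.
  have -> : s * (G * (15 / 2 / n%:R)) * s = G * (15 / 2).
    by rewrite -ss; field; rewrite gt_eqF.
  by lra.
have e4 := ler_wpM2l (expR_ge0 (5 : R)) e1.
rewrite mulrDl mulrDr mulrDl.
have -> : expR 5 * E * (n - 1)%:R * s = expR 5 * (E * (n - 1)%:R * s) by ring.
have -> : s / 2 * (G * (15 / 2 / n%:R)) * s = s * (G * (15 / 2 / n%:R)) * s / 2 by ring.
have -> : s / 2 * (n.+2%:R ^+ 2 * E * (n - 1)%:R) * s =
   s * (n.+2%:R ^+ 2 * E * (n - 1)%:R) * s / 2 by ring.
by lra.
Qed.
End GoodShapes.

(** * Moments *)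

(* If [p] is the probability generating function of [C], this is the expectation of [F C]. *)
Definition pexp (R : nzRingType) (p : {poly R}) (F : nat -> R) := \sum_(i < size p) p`_i * F i.

Section Pexp.
Variable R : comNzRingType.
Implicit Types (p q : {poly R}) (F : nat -> R).

Lemma pexp_wide N p F : (size p <= N)%N -> pexp p F = \sum_(i < N) p`_i * F i.
Proof.
move=> pN; rewrite /pexp (big_ord_widen N (fun i => p`_i * F i)) // big_mkcond /=.
apply: eq_bigr => i _; case: ltnP => // ip.
by rewrite nth_default // mul0r.
Qed.

Lemma pexpDl p q F : pexp (p + q) F = pexp p F + pexp q F.
Proof.
pose N := maxn (size p) (size q).
rewrite (@pexp_wide N (p + q)) ?size_polyD // (@pexp_wide N p) ?leq_maxl //.
rewrite (@pexp_wide N q) ?leq_maxr // -big_split /=.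
by apply: eq_bigr => i _; rewrite coefD mulrDl.
Qed.

Lemma pexpZl a p F : pexp (a *: p) F = a * pexp p F.
Proof.
rewrite (@pexp_wide (size p)) ?size_scale_leq // /pexp mulr_sumr.
by apply: eq_bigr => i _; rewrite coefZ mulrA.
Qed.

Lemma pexp0l F : pexp 0 F = 0.
Proof. by rewrite /pexp size_poly0 big_ord0. Qed.

Lemma pexp_suml (I : Type) (r : seq I) (P : pred I) (p : I -> {poly R}) F :
  pexp (\sum_(i <- r | P i) p i) F = \sum_(i <- r | P i) pexp (p i) F.
Proof. by elim/big_rec2: _ => [|i x y _ <-]; rewrite ?pexp0l ?pexpDl. Qed.

Lemma eq_pexp p F F' : F =1 F' -> pexp p F = pexp p F'.
Proof. by move=> eqF; apply: eq_bigr => i _; rewrite eqF. Qed.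

Lemma pexpDr p F F' : pexp p (fun k => F k + F' k) = pexp p F + pexp p F'.
Proof. by rewrite /pexp -big_split /=; apply: eq_bigr => i _; rewrite mulrDr. Qed.

Lemma pexpZr p a F : pexp p (fun k => a * F k) = a * pexp p F.
Proof. by rewrite /pexp mulr_sumr; apply: eq_bigr => i _; rewrite mulrCA. Qed.

Lemma pexp_Xn k F : pexp 'X^k F = F k.
Proof.
rewrite /pexp size_polyXn big_ord_recr /= coefXn eqxx mul1r big1 ?add0r // => i _.
by rewrite coefXn ltn_eqF ?mul0r.
Qed.

Lemma pexp1l F : pexp 1 F = F 0%N.
Proof. by rewrite -(expr0 'X) pexp_Xn. Qed.

Lemma pexp_Xl p F : pexp ('X * p) F = pexp p (fun k => F k.+1).
Proof.
rewrite (@pexp_wide (size p).+1); last first.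
  by rewrite (leq_trans (size_polyMleq _ _)) // size_polyX.
rewrite big_ord_recl coefXM eqxx mul0r add0r /pexp.
by apply: eq_bigr => i _; rewrite coefXM.
Qed.

(** Multiplication by ['X + a] acts on [F] as the shift plus [a]. Products of linear factors, with
    coefficients of any sign, can thus be treated by recursion on [F]. *)
Lemma pexp_XaddC p a F : pexp (('X + a%:P) * p) F = pexp p (fun k => F k.+1 + a * F k).
Proof. by rewrite mulrDl pexpDl pexp_Xl mul_polyC pexpZl pexpDr pexpZr. Qed.

Lemma pexp_XaddN p n F :
  pexp (('X + n%:R) * p) F = pexp p (fun k => F k.+1 + n%:R * F k).
Proof. by rewrite -polyC_natr pexp_XaddC. Qed.

Lemma pexp_cst p : pexp p (fun=> 1) = p.[1].
Proof. by rewrite horner_coef; apply: eq_bigr => i _; rewrite expr1n. Qed.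

Lemma pexp_id p : pexp p (fun k => k%:R) = p^`().[1].
Proof.
rewrite -pexp_cst (@pexp_wide (size p).-1 p^`()); last first.
  case: (ltnP 0 (size p)) => [p0|]; first by rewrite -ltnS prednK // lt_size_deriv // -size_poly_gt0.
  by rewrite leqn0 size_poly_eq0 => /eqP ->; rewrite deriv0 size_poly0.
rewrite /pexp; case: (size p) => [|n]; first by rewrite !big_ord0.
rewrite big_ord_recl mulr0 add0r; apply: eq_bigr => i _.
by rewrite coef_deriv mulr1 mulr_natr.
Qed.
End Pexp.

(** The factor ['X + c] turns the bound [M * y ^+ k] into itself times [y + |c|], so exponential
    bounds pass through the whole product. *)
Lemma pexp_prod_bound (R : numDomainType) (s : seq int) (F : nat -> R) (M y : R) : 0 <= y ->
  (forall k, `|F k| <= M * y ^+ k) ->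
  `|pexp (\prod_(c <- s) ('X + (c%:~R)%:P)) F| <= M * \prod_(c <- s) (y + `|c|%:~R).
Proof.
move=> y0; elim: s F M => [|c s IH] F M FM.
  by rewrite !big_nil pexp1l; have := FM 0%N; rewrite expr0.
rewrite !big_cons pexp_XaddC mulrA; apply: IH => k.
apply: le_trans (ler_normD _ _) _; rewrite mulrDr mulrDl normrM; apply: lerD.
  by rewrite -mulrA -exprS.
by rewrite -intr_norm mulrAC mulrC ler_wpM2r ?ler0z.
Qed.

Section Moments.
Variable R : realType.
Implicit Types (F : nat -> R).

Definition unif_pgf n : {poly R} := n`!%:R^-1 *: rising 'X n.

(** The point added to a uniform permutation of [n] points forms a cycle of its own with probability
    [n.+1%:R^-1]; otherwise it joins an existing cycle. *)
Lemma pexp_unif_pgfS n F : pexp (unif_pgf n.+1) F =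
  pexp (unif_pgf n) (fun k => (F k.+1 + n%:R * F k) / n.+1%:R).
Proof.
have n1 : n.+1%:R != 0 :> R by rewrite pnatr_eq0.
have f0 : n`!%:R != 0 :> R by rewrite pnatr_eq0 -lt0n fact_gt0.
rewrite /unif_pgf !pexpZl /rising big_ord_recr [X in pexp X]mulrC pexp_XaddN.
have -> : pexp (\prod_(i < n) ('X + i%:R)) (fun k => (F k.+1 + n%:R * F k) / n.+1%:R) =
  n.+1%:R^-1 * pexp (\prod_(i < n) ('X + i%:R)) (fun k => F k.+1 + n%:R * F k).
  by rewrite -pexpZr; apply: eq_pexp => k; rewrite mulrC.
by rewrite factS natrM invfM mulrA [_^-1 * _^-1]mulrC.
Qed.

Definition harm n : R := \sum_(i < n) i.+1%:R^-1.
Definition harm2 n : R := \sum_(i < n) (i.+1%:R^-1) ^+ 2.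

Lemma unif_pgf0 : unif_pgf 0 = 1.
Proof. by rewrite /unif_pgf /rising big_ord0 invr1 scale1r. Qed.

Lemma unif_total n : pexp (unif_pgf n) (fun=> 1) = 1.
Proof.
elim: n => [|n IH]; first by rewrite unif_pgf0 pexp1l.
rewrite pexp_unif_pgfS -[RHS]IH; apply: eq_pexp => k.
by rewrite mulr1 nat1r divff // pnatr_eq0.
Qed.

Lemma unif_mean n : pexp (unif_pgf n) (fun k => k%:R) = harm n.
Proof.
elim: n => [|n IH]; first by rewrite unif_pgf0 pexp1l /harm big_ord0.
have n1 : n.+1%:R != 0 :> R by rewrite pnatr_eq0.
rewrite pexp_unif_pgfS (@eq_pexp _ _ _ (fun k => k%:R + n.+1%:R^-1 * 1)).
  by rewrite pexpDr pexpZr IH unif_total mulr1 /harm big_ord_recr.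
by move=> k; rewrite -[k.+1%:R]natr1 -[n.+1%:R]natr1 in n1 *; field.
Qed.

Lemma unif_second n : pexp (unif_pgf n) (fun k => k%:R ^+ 2) = harm n ^+ 2 + harm n - harm2 n.
Proof.
elim: n => [|n IH]; first by rewrite unif_pgf0 pexp1l /harm /harm2 !big_ord0; ring.
have n1 : n.+1%:R != 0 :> R by rewrite pnatr_eq0.
rewrite pexp_unif_pgfS
  (@eq_pexp _ _ _ (fun k => k%:R ^+ 2 + (2 / n.+1%:R * k%:R + n.+1%:R^-1 * 1))).
  rewrite !pexpDr !pexpZr IH unif_total unif_mean mulr1.
  have -> : harm n.+1 = harm n + n.+1%:R^-1 by rewrite /harm big_ord_recr.
  have -> : harm2 n.+1 = harm2 n + n.+1%:R^-1 ^+ 2 by rewrite /harm2 big_ord_recr.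
  ring.
by move=> k; rewrite -[k.+1%:R]natr1 -[n.+1%:R]natr1 in n1 *; field.
Qed.

Definition sgn_pgf n : {poly R} := n`!%:R^-1 *: \prod_(j < n) ('X - j%:R).

Let alt_prod n : {poly R} := \prod_(2 <= j < n) ('X - j%:R).

(** The factor ['X] shifts [F] and the factor ['X - 1] takes its difference; [alt_prod] is the rest
    of the product. *)
Lemma sgn_pgfE n F : (1 < n)%N ->
  pexp (sgn_pgf n) F = n`!%:R^-1 * pexp (alt_prod n) (fun k => F k.+2 - F k.+1).
Proof.
case: n => [|[|n]] // _; rewrite /sgn_pgf pexpZl; congr (_ * _).
rewrite -(big_mkord xpredT (fun j => 'X - j%:R)) big_nat_recl // big_nat_recl //= subr0.
rewrite pexp_Xl -[1%:R]polyC1 -polyCN pexp_XaddC.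
have -> : \prod_(0 <= i < n) ('X - i.+2%:R) = alt_prod n.+2 by rewrite /alt_prod !big_add1.
by apply: eq_pexp => k; rewrite mulN1r.
Qed.

Lemma alt_prod_bound n F M : (1 < n)%N -> (forall k, `|F k| <= M) ->
  `|pexp (alt_prod n) F| <= M * (n`!%:R / 2).
Proof.
move=> n1 FM.
have -> : alt_prod n = \prod_(c <- [seq - j%:Z | j <- index_iota 2 n]) ('X + (c%:~R)%:P).
  by rewrite /alt_prod big_map; apply: eq_bigr => j _; rewrite rmorphN /= polyCN polyC_natr.
apply: le_trans (@pexp_prod_bound _ _ F M 1 _ _) _ => //.
  by move=> k; rewrite expr1n mulr1.
have M0 : 0 <= M by apply: le_trans (FM 0%N).
rewrite big_map ler_wpM2l //.
case: n n1 => [|[|n]] // _; rewrite !big_add1 /= big_mkord.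
elim: n => [|n IH]; first by rewrite big_ord0 divff.
rewrite big_ord_recr /= factS natrM -[leRHS]mulrA [leRHS]mulrC; apply: ler_pM => //.
  by apply: prodr_ge0 => j _; rewrite addr_ge0 // ler0z.
Qed.

Lemma sgn_pgf_bound n F M : (1 < n)%N -> (forall k, `|F k.+1 - F k| <= M) ->
  `|pexp (sgn_pgf n) F| <= M / 2.
Proof.
move=> n1 FM; have f0 : 0 < n`!%:R :> R by rewrite ltr0n fact_gt0.
rewrite sgn_pgfE // normrM gtr0_norm ?invr_gt0 // mulrC ler_pdivrMr //.
apply: le_trans (@alt_prod_bound n _ M n1 _) _ => [k|]; first exact: FM.
by rewrite mulrCA mulrC.
Qed.

(** For the mean, [sgn_pgf_bound] yields only 1/2, since it makes all signs positive. Keeping the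
    signs, the value of [alt_prod n.+2] at 1 is [n]![up to sign, which is small against]n.+2[!]. *)
Let alt_prod_mom n :
  `|(alt_prod n.+2).[1]| <= n`!%:R /\ `|(alt_prod n.+2)^`().[1]| <= n`!%:R * n%:R.
Proof.
rewrite /alt_prod !big_add1 /=.
elim: n => [|n [IH1 IH2]]; first by rewrite big_nil derivC !hornerE normr1 normr0.
rewrite big_nat_recr //= derivM derivB derivX -polyC_natr derivC subr0 mulr1.
rewrite !(hornerM, hornerD, hornerN, hornerX, hornerC).
have h : `|1 - n.+2%:R| <= n.+1%:R :> R.
  by rewrite -[n.+2]/(1 + n.+1)%N natrD opprD addNKr normrN ger0_norm.
have f1 : 1 <= n`!%:R :> R by rewrite ler1n fact_gt0.
split; first by rewrite normrM factS natrM [leRHS]mulrC; apply: ler_pM.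
apply: le_trans (ler_normD _ _) _; rewrite factS natrM.
apply: (@le_trans _ _ (n`!%:R * n%:R * n.+1%:R + n`!%:R)).
  by apply: lerD => //; rewrite normrM; apply: ler_pM.
rewrite -[n.+1%:R]natr1; have n0 : 0 <= n%:R :> R by [].
nra.
Qed.

Lemma sgn_mean n : (1 < n)%N -> `|pexp (sgn_pgf n) (fun k => k%:R)| <= n%:R^-1.
Proof.
case: n => [|[|n]] // _.
have f0 j : 0 < j`!%:R :> R by rewrite ltr0n fact_gt0.
rewrite sgn_pgfE // normrM gtr0_norm ?invr_gt0 // mulrC ler_pdivrMr //.
rewrite (@eq_pexp _ _ _ (fun=> 1)) ?pexp_cst => [|k]; last first.
  by rewrite -[k.+2]/(1 + k.+1)%N natrD addrK.
apply: le_trans (alt_prod_mom n).1 _; rewrite mulrC ler_pdivlMr // -natrM ler_nat.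
by rewrite !factS mulnC leq_mul2l mulnC leq_pmulr ?orbT.
Qed.

Lemma sgn_second n : (1 < n)%N -> `|pexp (sgn_pgf n) (fun k => k%:R ^+ 2)| <= 3 / n%:R.
Proof.
case: n => [|[|n]] // _.
have f0 j : 0 < j`!%:R :> R by rewrite ltr0n fact_gt0.
rewrite sgn_pgfE // normrM gtr0_norm ?invr_gt0 // mulrC ler_pdivrMr //.
rewrite (@eq_pexp _ _ _ (fun k => 2 * k%:R + 3 * 1)) => [|k]; last first.
  by rewrite -[k.+2]/(2 + k)%N -[k.+1]/(1 + k)%N !natrD; ring.
rewrite pexpDr !pexpZr pexp_cst pexp_id.
have [h1 h2] := alt_prod_mom n.
apply: le_trans (ler_normD _ _) _; rewrite !normrM !normr_nat.
apply: (@le_trans _ _ (2 * (n`!%:R * n%:R) + 3 * n`!%:R)).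
  by apply: lerD; rewrite ler_pM2l.
have n2 : n.+2%:R != 0 :> R by rewrite pnatr_eq0.
rewrite !factS !natrM -[n.+2%:R * _]mulrC [leRHS]mulrC mulrCA -!mulrA.
have -> : n.+1%:R * (n`!%:R * (n.+2%:R * (3 / n.+2%:R))) = 3 * (n.+1%:R * n`!%:R) :> R by field.
rewrite -[n.+1%:R]natr1; have := f0 n; have n0 : 0 <= n%:R :> R by [].
by move: (n`!%:R) => u u0; nra.
Qed.
End Moments.

(** * Commutators compared with uniform permutations *)

Section Law.
Variable R : realType.

Definition comm_exp n (F : nat -> R) : R :=
  (n`!%:R ^+ 2)^-1 * \sum_(a : 'S_n) \sum_(b : 'S_n) F #|porbits [~ a, b]%g|.

Lemma comm_exp_approx : exists2 K : R, 0 <= K & forall n M F, (60 <= n)%N ->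
  (forall k, `|F k| <= M * (5 / 4) ^+ k) ->
  `|comm_exp n F - pexp (unif_pgf R n) F - pexp (sgn_pgf R n) F| <= M * K / Num.sqrt n%:R.
Proof.
have [K KP] := good_shapes_bound R.
have f0 j : 0 < j`!%:R :> R by rewrite ltr0n fact_gt0.
have s0 : 0 < Num.sqrt 60%:R :> R by rewrite sqrtr_gt0.
exists (2 * K) => [|n M F n60 FM].
  (* The sign of [K] is read off from the bound at n = 60, whose left side is nonnegative. *)
  rewrite mulr_ge0 // -(pmulr_lge0 _ (_ : 0 < (Num.sqrt 60%:R)^-1)) ?invr_gt0 //.
  apply: le_trans (KP 60 (leqnn _)); apply: divr_ge0; last exact: ltW.
  apply: sumr_ge0 => l _; apply: prodr_ge0 => c _.
  by rewrite addr_ge0 ?ler0z //; lra.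
have n1 : (1 < n)%N by lia.
have M0 : 0 <= M by apply: le_trans (normr_ge0 (F 0%N)) _; rewrite -[M]mulr1 -(expr0 (5 / 4)).
have [L [LE Lb]] := sum_commutator_cycles_poly n1.
pose E : {poly R} := \sum_(s <- L) \prod_(c <- s) ('X + (c%:~R)%:P).
have eqE : comm_exp n F = pexp (unif_pgf R n) F + pexp (sgn_pgf R n) F + n`!%:R^-1 * pexp E F.
  have := congr1 (map_poly (intr : int -> R)) LE.
  rewrite rmorphM /= rmorph_nat !rmorphD /= => eqL.
  have : pexp (\sum_(a : 'S_n) \sum_(b : 'S_n) 'X ^+ #|porbits [~ a, b]%g|) F =
    n`!%:R * pexp (rising 'X n + \prod_(j < n) ('X - j%:R) + E) F.
    rewrite -pexpZl scaler_nat -mulr_natl.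
    transitivity (pexp (map_poly (intr : int -> R)
       (\sum_(a : 'S_n) \sum_(b : 'S_n) 'X ^+ #|porbits [~ a, b]%g|)) F).
      congr (pexp _ F); rewrite rmorph_sum; apply: eq_bigr => a _.
      by rewrite rmorph_sum; apply: eq_bigr => b _; rewrite rmorphXn /= map_polyX.
    rewrite eqL; congr (pexp (_ * (_ + _ + _)) F).
    - rewrite /rising rmorph_prod; apply: eq_bigr => j _.
      by rewrite rmorphD /= map_polyX rmorph_nat.
    - rewrite rmorph_prod; apply: eq_bigr => j _.
      by rewrite rmorphB /= map_polyX rmorph_nat.
    - rewrite rmorph_sum; apply: eq_bigr => s _; rewrite rmorph_prod; apply: eq_bigr => c _.
      by rewrite rmorphD /= map_polyX map_polyC.
  rewrite !pexpDl pexp_suml; under eq_bigr do rewrite pexp_suml.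
  under eq_bigr do under eq_bigr do rewrite pexp_Xn.
  rewrite /comm_exp /unif_pgf /sgn_pgf !pexpZl => ->.
  by field; rewrite gt_eqF.
rewrite eqE [X in `|X|](_ : _ = n`!%:R^-1 * pexp E F); last by ring.
rewrite normrM gtr0_norm ?invr_gt0 //.
apply: (@le_trans _ _ (n`!%:R^-1 * (M * \sum_(s <- L) \prod_(c <- s) (5 / 4 + `|c|%:~R)))).
  rewrite ler_pM2l ?invr_gt0 // /E pexp_suml mulr_sumr; apply: le_trans (ler_norm_sum _ _ _) _.
  by apply: ler_sum => s _; apply: pexp_prod_bound FM; lra.
have y0 : 0 <= 5 / 4 :> R by lra.
rewrite mulrCA -mulrA; apply: ler_wpM2l => //; rewrite mulrC ler_pdivrMr //.
apply: le_trans (Lb _ _ y0) _.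
by rewrite -!mulrA ler_wpM2l // mulrA -ler_pdivrMr // KP.
Qed.

Lemma linear_le_exp k : k%:R <= 4 * (5 / 4) ^+ k :> R.
Proof.
elim: k => [|k IH]; first by rewrite expr0 mulr1.
have : 1 <= (5 / 4) ^+ k :> R by rewrite exprn_ege1 //; lra.
by rewrite exprS -[k.+1%:R]natr1; move: ((5 / 4) ^+ k) IH => u IH u1; lra.
Qed.

(** 100 covers k <= 10, and from 11 on (k + 1)^2 <= (5/4) k^2. *)
Lemma square_le_exp k : k%:R ^+ 2 <= 100 * (5 / 4) ^+ k :> R.
Proof.
have [k10|] := leqP k 10.
  have h1 : 1 <= (5 / 4) ^+ k :> R by rewrite exprn_ege1 //; lra.
  have h2 : k%:R <= 10 :> R by rewrite ler_nat.
  have h3 : 0 <= k%:R :> R by [].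
  have h4 : k%:R * k%:R <= 10 * 10 :> R by apply: ler_pM.
  by rewrite expr2; lra.
elim: k => // k IH; rewrite ltnS leq_eqVlt => /orP[/eqP <-|k10].
  have h1 : 121 <= 100 * (5 / 4) ^+ 11 :> R.
    have : 1 <= (5 / 4) ^+ 9 :> R by rewrite exprn_ege1 //; lra.
    by rewrite -[11%N]/(9 + 2)%N exprD expr2; move: (_ ^+ 9) => u; lra.
  by apply: le_trans h1; rewrite expr2; lra.
have := IH k10; rewrite [(5 / 4) ^+ k.+1]exprS -[k.+1%:R]natr1 !expr2.
have h2 : 11 <= k%:R :> R by rewrite ler_nat.
have h3 : 11 * k%:R <= k%:R * k%:R :> R by apply: ler_pM.
clear IH; move: ((5 / 4) ^+ k) (k%:R : R) h2 h3 => u z h2 h3 h1.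
have -> : (z + 1) * (z + 1) = z * z + 2 * z + 1 by ring.
by lra.
Qed.

Lemma comm_moments : exists2 K : R, 0 <= K & forall n, (60 <= n)%N ->
  `|comm_exp n (fun k => k%:R) - harm R n| <= K / Num.sqrt n%:R /\
  `|comm_exp n (fun k => k%:R ^+ 2) - (harm R n ^+ 2 + harm R n - harm2 R n)| <= K / Num.sqrt n%:R.
Proof.
have [K K0 KP] := comm_exp_approx.
exists (100 * K + 3) => [|n n60]; first by lra.
have n1 : (1 < n)%N by lia.
have n0 : 1 <= n%:R :> R by rewrite ler1n; lia.
have s1 : 1 <= Num.sqrt n%:R :> R by have := ler_wsqrtr n0; rewrite sqrtr1.
have ns : n%:R^-1 <= (Num.sqrt n%:R)^-1 :> R.
  rewrite lef_pV2 ?posrE ?(lt_le_trans ltr01) //.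
  have := sqr_sqrtr (le_trans ler01 n0); rewrite expr2 => {2}<-.
  by rewrite -[X in X <= _]mulr1 ler_wpM2l // sqrtr_ge0.
have s0 : 0 <= (Num.sqrt n%:R)^-1 :> R by rewrite invr_ge0 (le_trans ler01).
split.
  have := KP n 4 (fun k => k%:R) n60; rewrite unif_mean.
  have := sgn_mean R n1.
  set u := pexp _ _; set c := comm_exp _ _ => h1 h2.
  have {}h2 : `|c - harm R n - u| <= 4 * K / Num.sqrt n%:R.
    by apply: h2 => k; rewrite ger0_norm // linear_le_exp.
  rewrite (_ : c - harm R n = (c - harm R n - u) + u); last by ring.
  apply: le_trans (ler_normD _ _) _; nra.
have := KP n 100 (fun k => k%:R ^+ 2) n60; rewrite unif_second.
have := sgn_second R n1.
set u := pexp _ _; set c := comm_exp _ _; set v := _ - harm2 R n => h1 h2.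
have {}h2 : `|c - v - u| <= 100 * K / Num.sqrt n%:R.
  by apply: h2 => k; rewrite ger0_norm ?sqr_ge0 // square_le_exp.
rewrite (_ : c - v = (c - v - u) + u); last by ring.
apply: le_trans (ler_normD _ _) _; nra.
Qed.

End Law.

Import classical_sets.
Local Open Scope classical_set_scope.
Local Open Scope ring_scope.

(** * Harmonic sums *)

Section Asymptotics.
Variable R : realType.
Local Notation H := (harm R).
Local Notation H2 := (harm2 R).

Lemma harmS n : H n.+1 = H n + n.+1%:R^-1.
Proof. by rewrite /harm big_ord_recr. Qed.

Lemma harm2S n : H2 n.+1 = H2 n + n.+1%:R^-1 ^+ 2.
Proof. by rewrite /harm2 big_ord_recr. Qed.

Lemma ln_step_le n : ln n.+2%:R - ln n.+1%:R <= n.+1%:R^-1 :> R.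
Proof.
rewrite -ln_div ?posrE // (_ : n.+2%:R / n.+1%:R = 1 + n.+1%:R^-1 :> R); last first.
  by rewrite -[n.+2]/(1 + n.+1)%N natrD mulrDl divff ?pnatr_eq0 // mul1r addrC.
by apply: le_ln1Dx; apply: lt_trans (_ : 0 < _); rewrite ?invr_gt0 // ltrN10.
Qed.

Lemma ln_step_ge n : n.+2%:R^-1 <= ln n.+2%:R - ln n.+1%:R :> R.
Proof.
rewrite -lerN2 opprB -ln_div ?posrE // (_ : n.+1%:R / n.+2%:R = 1 + - n.+2%:R^-1 :> R); last first.
  rewrite -[n.+2]/(1 + n.+1)%N natrD; have : 1 + n.+1%:R != 0 :> R by rewrite nat1r pnatr_eq0.
  by move=> ?; field.
apply: le_ln1Dx; rewrite ltrN2 invf_lt1 // ltr1n //.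
Qed.

Lemma harm_ge_ln n : ln n.+1%:R <= H n :> R.
Proof.
elim: n => [|n IH]; first by rewrite ln1 /harm big_ord0.
by rewrite harmS -lerBlDl; apply: le_trans (ln_step_le n); rewrite lerD2l lerN2.
Qed.

Lemma cvg_euler_gamma : (fun n => H n - ln n%:R) @ \oo --> euler_gamma R.
Proof.
have -> : (fun n => H n - ln n%:R) = (fun n => series harmonic n - ln n%:R : R).
  by apply/funext => n; rewrite /harm /series /= big_mkord.
rewrite /euler_gamma; apply/cvg_ex.
have -> : (fun n => series harmonic n - ln n%:R : R) = (fun n => H n - ln n%:R).
  by apply/funext => n; rewrite /harm /series /= big_mkord.
(* The index starts at 1, away from [ln 0]. *)
pose u n := H n.+1 - ln n.+1%:R.
have /cvg_ex[l ul] : cvgn u.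
  apply: nonincreasing_is_cvgn.
    apply/nonincreasing_seqP => n; rewrite /u [H n.+2]harmS.
    have := ln_step_ge n; move: (ln _) (ln _) (harm R _) (_^-1) => a b c e h; lra.
  exists 0 => _ [n _ <-]; rewrite /u.
  rewrite subr_ge0; apply: le_trans (harm_ge_ln n.+1).
  by rewrite ler_ln ?posrE // ler_nat.
by exists l; rewrite -cvg_shiftS.
Qed.

Lemma sin_bounds (x : R) : 0 < x -> x < pi / 2 -> x * cos x <= sin x <= x.
Proof.
move=> x0 xpi; have := pi_ge2 R => pi2.
have [|c] := @MVT R sin cos 0 x x0 (fun y _ => is_derive_sin y).
  by apply: continuous_subspaceT => y; exact: continuous_sin.
rewrite in_itv /= => /andP[c0 cx]; rewrite sin0 !subr0 => ->; apply/andP; split.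
  rewrite mulrC ler_pM2r //; apply: ltW; rewrite ltr_cos ?in_itv /=; lra.
by rewrite ger_pMl // cos_le1.
Qed.

(** The lower bound is the square of the cotangent, by [x * cos x <= sin x]. *)
Lemma invsqr_sin_bounds (x : R) : 0 < x -> x < pi / 2 ->
  (sin x ^+ 2)^-1 - 1 <= (x ^+ 2)^-1 <= (sin x ^+ 2)^-1.
Proof.
move=> x0 xpi; have /andP[lo hi] := sin_bounds x0 xpi.
have s0 : 0 < sin x by apply: sin_gt0_pihalf; rewrite x0.
have c0 : 0 < cos x by apply: cos_gt0_pihalf; rewrite xpi andbT; lra.
apply/andP; split; last first.
  rewrite lef_pV2 ?posrE ?exprn_gt0 //.
  by apply: lerXn2r => //; rewrite nnegrE ltW.
have -> : (sin x ^+ 2)^-1 - 1 = cos x ^+ 2 / sin x ^+ 2.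
  by rewrite cos2sin2; field; rewrite gt_eqF.
rewrite ler_pdivrMr ?exprn_gt0 // mulrC ler_pdivlMr ?exprn_gt0 // -exprMn.
by apply: lerXn2r; [rewrite nnegrE mulr_ge0 // ltW|rewrite nnegrE ltW|rewrite mulrC].
Qed.

Let ang m k : R := (k.*2.+1)%:R * pi / (2 ^ m.+2)%:R.

Let ang_bounds m k : (k < 2 ^ m)%N -> 0 < ang m k /\ ang m k < pi / 2.
Proof.
move=> km; have p0 : 0 < pi :> R := pi_gt0 R.
have t0 : 0 < (2 ^ m.+2)%:R :> R by rewrite ltr0n expn_gt0.
rewrite /ang; split; first by rewrite divr_gt0 // mulr_gt0.
rewrite ltr_pdivrMr // [ltLHS]mulrC -mulrA ltr_pM2l // mulrC ltr_pdivlMr // -natrM ltr_nat.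
by rewrite !expnS; move: (2 ^ m)%N km => N km; lia.
Qed.

(* Induction by the duplication formula 1 / sin^2 t + 1 / cos^2 t = 4 / sin^2 (2 t),
   as cos (ang m k) is the sine of another of these angles. *)
Lemma sum_invsqr_sin m : \sum_(k < 2 ^ m) (sin (ang m k) ^+ 2)^-1 = 2 * 4 ^+ m :> R.
Proof.
have arith (K N : nat) : (K < N)%N ->
    ((N + (N - K.+1)).*2.+1 = 2 * (2 * N) - K.*2.+1 /\ K.*2.+1 <= 2 * (2 * N))%N by lia.
elim: m => [|m IH].
  rewrite expn0 big_ord_recl big_ord0 addr0 mulr1.
  have E : ang 0 0 *+ 2 = pi / 2 by rewrite /ang mul1r -mulr_natr; field.
  have [a0 a1] := @ang_bounds 0 0 isT.
  have s0 : 0 < sin (ang 0 0) by apply: sin_gt0_pihalf; rewrite a0.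
  have c2 := cos_mulr2n (ang 0 0); rewrite E cos_pihalf in c2.
  have : sin (ang 0 0) ^+ 2 = 1 / 2.
    by have := cos2Dsin2 (ang 0 0); move: c2; rewrite -mulr_natr => ??; lra.
  by move=> ->; field.
have -> : (2 ^ m.+1 = 2 ^ m + 2 ^ m)%N by rewrite expnS mul2n addnn.
rewrite big_split_ord /= [X in _ + X](reindex_inj rev_ord_inj) /= -big_split /=.
rewrite exprS mulrCA -IH mulr_sumr; apply: eq_bigr => k _.
set t := ang m.+1 k.
have T2 : ang m k = t *+ 2.
  rewrite /t /ang -mulr_natr [(2 ^ m.+3)%N]expnS natrM.
  have : (2 ^ m.+2)%:R != 0 :> R by rewrite pnatr_eq0 expn_eq0.
  by move=> ?; field.
have -> : ang m.+1 (2 ^ m + (2 ^ m - k.+1))%N = pi / 2 - t.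
  rewrite /t /ang; have km := ltn_ord k.
  have -> : ((2 ^ m + (2 ^ m - k.+1)).*2.+1 = 2 ^ m.+2 - k.*2.+1)%N.
    by rewrite !expnS; exact: (arith _ _ km).1.
  rewrite natrB; last by rewrite !expnS; exact: (arith _ _ km).2.
  rewrite [(2 ^ m.+3)%N]expnS natrM.
  have : (2 ^ m.+2)%:R != 0 :> R by rewrite pnatr_eq0 expn_eq0.
  by move=> ?; field.
have [a0 a1] := @ang_bounds m.+1 k (leq_trans (ltn_ord k) (leq_pexp2l (isT : (0 < 2)%N) (leqnSn m))).
have s0 : 0 < sin t by apply: sin_gt0_pihalf; rewrite a0.
have c0 : 0 < cos t by apply: cos_gt0_pihalf; rewrite a1 andbT; rewrite /t; lra.
have -> : sin (pi / 2 - t) = cos t by rewrite sinB sin_pihalf cos_pihalf mul1r mul0r subr0.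
rewrite T2 sin_mulr2n -mulr_natr.
have E := cos2Dsin2 t.
have -> : (sin t ^+ 2)^-1 + (cos t ^+ 2)^-1 = (cos t ^+ 2 + sin t ^+ 2) / (sin t ^+ 2 * cos t ^+ 2).
  by field; rewrite !gt_eqF.
by rewrite E; field; rewrite !gt_eqF.
Qed.

Let O m : R := \sum_(k < 2 ^ m) (k.*2.+1)%:R ^- 2.

(** Replacing the sines by the angles changes each of the 2^m terms by at most 1, which is little
    against the total 2 . 4^m. *)
Let O_bounds m : pi ^+ 2 / 8 - pi ^+ 2 / 16 * (2 ^ m)%:R^-1 <= O m <= pi ^+ 2 / 8.
Proof.
have p0 : 0 < pi ^+ 2 :> R by rewrite exprn_gt0 // pi_gt0.
have N0 : 0 < (2 ^ m)%:R :> R by rewrite ltr0n expn_gt0.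
have E : \sum_(k < 2 ^ m) (ang m k ^+ 2)^-1 = 16 * (2 ^ m)%:R ^+ 2 / pi ^+ 2 * O m.
  rewrite mulr_sumr; apply: eq_bigr => k _.
  rewrite /ang !expnS !natrM.
  have k0 : (k.*2.+1)%:R != 0 :> R by rewrite pnatr_eq0.
  have pi0 : pi != 0 :> R by rewrite gt_eqF // pi_gt0.
  have n0 : (2 ^ m)%:R != 0 :> R by rewrite gt_eqF.
  move: (k.*2.+1%:R) ((2 ^ m)%:R) (pi : R) k0 n0 pi0 => z N p k0 n0 pi0.
  by field; rewrite k0 pi0 n0.
have S := sum_invsqr_sin m.
have S4 : 4 ^+ m = (2 ^ m)%:R ^+ 2 :> R by rewrite natrX -exprM mulnC exprM expr2 -natrM.
rewrite S4 in S.
have hi : \sum_(k < 2 ^ m) (ang m k ^+ 2)^-1 <= 2 * (2 ^ m)%:R ^+ 2.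
  rewrite -S; apply: ler_sum => k _; have [a0 a1] := ang_bounds (ltn_ord k).
  by have /andP[] := invsqr_sin_bounds a0 a1.
have lo : 2 * (2 ^ m)%:R ^+ 2 - (2 ^ m)%:R <= \sum_(k < 2 ^ m) (ang m k ^+ 2)^-1.
  have -> : (2 ^ m)%:R = \sum_(k < 2 ^ m) 1 :> R by rewrite sumr_const card_ord.
  have -> : (\sum_(k < 2 ^ m) 1) ^+ 2 = (2 ^ m)%:R ^+ 2 :> R by rewrite sumr_const card_ord.
  rewrite -S -sumrB; apply: ler_sum => k _; have [a0 a1] := ang_bounds (ltn_ord k).
  by have /andP[] := invsqr_sin_bounds a0 a1.
move: E lo hi; set A := \sum_(k < _) _; move: (2 ^ m)%:R N0 (pi ^+ 2 : R) p0 => N N0 P P0 E lo hi.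
have OE : O m = A * P / 16 / N ^+ 2 by rewrite E; field; rewrite !gt_eqF.
have N2 : 0 < N ^+ 2 by rewrite exprn_gt0.
rewrite OE; apply/andP; split.
  rewrite ler_pdivlMr //.
  have -> : (P / 8 - P / 16 / N) * N ^+ 2 = (2 * N ^+ 2 - N) * P / 16 by field; rewrite gt_eqF.
  by rewrite ler_pM2r // ler_pM2r.
rewrite ler_pdivrMr //.
have -> : P / 8 * N ^+ 2 = (2 * N ^+ 2) * P / 16 by field.
by rewrite ler_pM2r // ler_pM2r.
Qed.

Lemma harm2_double N : H2 N.*2 = \sum_(k < N) (k.*2.+1)%:R ^- 2 + H2 N / 4.
Proof.
elim: N => [|N IH]; first by rewrite /harm2 !big_ord0; lra.
rewrite doubleS !harm2S IH big_ord_recr /= !exprVn.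
have -> : N.*2.+2%:R = 2 * N.+1%:R :> R by rewrite -natrM mul2n doubleS.
have : N.+1%:R != 0 :> R by rewrite pnatr_eq0.
have : N.*2.+1%:R != 0 :> R by rewrite pnatr_eq0.
move: (N.*2.+1%:R) (N.+1%:R) => a b a0 b0.
by field; apply/andP.
Qed.

(** Along the powers of 2, splitting into odd and even terms gives l = pi^2 / 8 + l / 4 for the
    limit l, which exists by monotonicity and a telescoping bound. *)
Lemma basel : H2 @ \oo --> (pi ^+ 2 / 6 : R).
Proof.
have harm2_le n : H2 n.+1 <= 2 - n.+1%:R^-1.
  elim: n => [|n IH]; first by rewrite harm2S /harm2 big_ord0 invr1 expr1n; lra.
  rewrite harm2S; have n1 : 0 < n.+1%:R :> R by [].
  suff : n.+2%:R^-1 ^+ 2 + n.+2%:R^-1 <= n.+1%:R^-1 :> R by move: IH; move: (harm2 R n.+1) (n.+1%:R^-1) (n.+2%:R^-1) => a b c ? ?; lra.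
  rewrite -[n.+2]/(1 + n.+1)%N natrD; move: n1; move: (n.+1%:R) => z z0.
  have z1 : 0 < 1 + z by lra.
  rewrite -subr_ge0 (_ : _ - _ = (z * (1 + z) ^+ 2)^-1); last by field; rewrite !gt_eqF.
  by rewrite invr_ge0 mulr_ge0 ?exprn_ge0 // ltW.
have /cvg_ex[l Hl] : cvgn H2.
  apply: nondecreasing_is_cvgn.
    by apply/nondecreasing_seqP => n; rewrite harm2S lerDl sqr_ge0.
  exists 2 => _ [[|n] _ <-]; first by rewrite /harm2 big_ord0.
  by apply: le_trans (harm2_le n) _; rewrite gerBl.
suff -> : pi ^+ 2 / 6 = l :> R by [].
have pow_oo : (fun m => 2 ^ m)%N @ \oo --> \oo.
  apply/cvgnyPge => A; exists A => // m /= Am.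
  by apply: leq_trans Am _; apply/ltnW/ltn_expl.
have inv0 : (fun m => (2 ^ m)%:R^-1 : R) @ \oo --> (0 : R).
  have lt1 : `|1 / 2 : R| < 1 by rewrite ger0_norm; lra.
  apply: cvg_trans (cvg_expr lt1); apply: near_eq_cvg; apply: nearW => m.
  by rewrite natrX -exprVn div1r.
have O_cvg : O @ \oo --> (pi ^+ 2 / 8 : R).
  apply: (@squeeze_cvgr _ _ _ _ (fun m => pi ^+ 2 / 8 - pi ^+ 2 / 16 * (2 ^ m)%:R^-1)
    (fun=> pi ^+ 2 / 8)); last exact: cvg_cst.
    by apply: nearW => m; exact: O_bounds.
  rewrite -[X in _ --> X]subr0 -[X in _ - X](mulr0 (pi ^+ 2 / 16)).
  by apply: cvgB; [exact: cvg_cst|apply: cvgM => //; exact: cvg_cst].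
have c1 : (fun m => H2 (2 ^ m)%N) @ \oo --> l by exact: cvg_comp pow_oo Hl.
have c2 : (fun m => H2 (2 ^ m.+1)%N) @ \oo --> l.
  by have := c1; rewrite -cvg_shiftS.
have c3 : (fun m => H2 (2 ^ m.+1)%N) @ \oo --> pi ^+ 2 / 8 + l / 4.
  have -> : (fun m => H2 (2 ^ m.+1)%N) = (fun m => O m + H2 (2 ^ m)%N / 4).
    by apply/funext => m; rewrite expnS mul2n harm2_double.
  by apply: cvgD => //; apply: cvgM => //; exact: cvg_cst.
have h : (l : R) = pi ^+ 2 / 8 + l / 4 by apply: cvg_unique c2 c3.
by move: (pi ^+ 2 : R) (l : R) h => P L h; lra.
Qed.
End Asymptotics.

(** * Stein's method *)

Section Stein.
Variable R : realType.
Local Notation mu := (@lebesgue_measure R).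
Let p : R -> R := normal_pdf 0 1.

Let pE x : p x = normal_peak 1 * expR (- (x ^+ 2 / 2)).
Proof.
by rewrite /p normal_pdfE ?oner_neq0 // /normal_fun subr0 expr1n mulNr.
Qed.

Lemma std_pdf_gt0 x : 0 < p x.
Proof. by rewrite pE mulr_gt0 ?expR_gt0 // normal_peak_gt0 // oner_neq0. Qed.

Lemma std_pdf_even x : p (- x) = p x.
Proof. by rewrite !pE sqrrN. Qed.

Lemma std_pdf_decr x y : 0 <= x -> x <= y -> p y <= p x.
Proof.
move=> x0 xy; rewrite !pE ler_wpM2l ?normal_peak_ge0 // ler_expR lerN2.
by rewrite ler_pM2r // lerXn2r // nnegrE // (le_trans x0).
Qed.

Lemma is_derive_std_pdf (x : R) : is_derive x 1 p (- x * p x).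
Proof.
have -> : p = (fun x => normal_peak 1 * expR (- (x ^+ 2 / 2))) by apply/funext => y; rewrite pE.
have d1 : is_derive x 1 (fun x : R => - (x ^+ 2 / 2)) (- x).
  have -> : (fun x : R => - (x ^+ 2 / 2)) = (- 2^-1) *: ((@id R) ^+ 2).
    by apply/funext => y; rewrite /= fctE mulrC scaleNr.
  by apply: is_derive_eq; rewrite /GRing.scale /= mulr1 expr1; field.
apply: is_derive_eq.
by rewrite /GRing.scale /=; ring.
Qed.

Lemma continuous_std_pdf : continuous p.
Proof. by apply: continuous_normal_pdf; rewrite oner_neq0. Qed.

Lemma cvg_std_pdf : p x @[x --> +oo] --> 0.
Proof.
have c0 : 0 <= normal_peak 1 :> R := normal_peak_ge0 1.
apply: (@squeeze_cvgr _ _ _ _ (cst 0) (fun x => normal_peak 1 * expR (- x))).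
- near=> x; rewrite (ltW (std_pdf_gt0 x)) pE /= ler_wpM2l // ler_expR lerN2.
  have : 2 <= x by near: x; apply: nbhs_pinfty_ge.
  by move=> x2; rewrite ler_pdivlMr // expr2 ler_wpM2l // (le_trans _ x2).
- exact: cvg_cst.
- rewrite -[X in _ --> X](mulr0 (normal_peak 1)).
  by apply: cvgM; [exact: cvg_cst|exact: cvgr_expR].
Unshelve. all: by end_near.
Qed.

Let int_p D : measurable D -> mu.-integrable D (EFin \o p).
Proof.
move=> mD; apply: (@integrableS _ _ _ _ setT) => //.
exact: integrable_normal_pdf.
Qed.

(** On the domain of integration p(t) <= (t / w) p(t), and t p(t) is the derivative of - p. *)
Lemma gauss_tail w : 0 < w -> \int[mu]_(t in `[w, +oo[) p t <= p w / w.
Proof.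
move=> w0; have iE : (\int[mu]_(t in `[w, +oo[) (t * p t)%:E = (p w)%:E)%E.
  rewrite (@ge0_continuous_FTC2y _ _ (fun t => - p t) w 0).
  - by rewrite sub0e EFinN oppeK.
  - by move=> t wt; rewrite mulr_ge0 ?ltW ?std_pdf_gt0 // (lt_le_trans w0).
  - apply: continuous_subspaceT => t; apply: cvgM; first exact: cvg_id.
    exact: continuous_std_pdf.
  - by rewrite -oppr0; apply: cvgN; exact: cvg_std_pdf.
  - move=> t _; apply: ex_derive; apply: is_deriveN; exact: is_derive_std_pdf.
  - apply: cvg_at_right_filter; apply: cvgN; exact: continuous_std_pdf.
  - move=> t _; rewrite derive1E.
    have := is_deriveN (is_derive_std_pdf t) => d; rewrite derive_val.
    by rewrite mulNr opprK.
rewrite -lee_fin fineK; last first.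
  by apply: integrable_fin_num => //; exact: int_p.
rewrite EFinM muleC.
have -> : (w^-1%:E * (p w)%:E = \int[mu]_(t in `[w, +oo[) (w^-1 * (t * p t))%:E)%E.
  under eq_integral do rewrite EFinM.
  rewrite ge0_integralZl //= ?iE //.
  - apply/measurable_EFinP; apply: measurable_funM => //; apply: measurable_funTS.
    exact: measurable_normal_pdf.
  - move=> t; rewrite in_itv /= andbT => wt.
    by rewrite lee_fin mulr_ge0 ?ltW ?std_pdf_gt0 // (lt_le_trans w0).
  - by rewrite lee_fin invr_ge0 ltW.
apply: ge0_le_integral => //=.
- by move=> t _; rewrite lee_fin ltW // std_pdf_gt0.
- by apply/measurable_EFinP/measurable_funTS; exact: measurable_normal_pdf.
- apply/measurable_EFinP; apply: measurable_funM => //; apply: measurable_funM => //.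
  by apply: measurable_funTS; exact: measurable_normal_pdf.
- move=> t; rewrite in_itv /= andbT => wt; rewrite lee_fin mulrA.
  apply: ler_peMl; first exact/ltW/std_pdf_gt0.
  by rewrite mulrC ler_pdivlMr // mul1r.
Qed.

Lemma gauss_tailN w : w < 0 -> \int[mu]_(t in `]-oo, w]) p t <= p w / - w.
Proof.
move=> w0; have := @gauss_tail (- w); rewrite oppr_gt0 std_pdf_even => /(_ w0).
congr (_ <= _); congr fine.
rewrite -[in RHS](opprK w) ge0_integration_by_substitutionNy.
- by apply: eq_integral => t _; rewrite /= std_pdf_even.
- by apply: continuous_subspaceT; exact: continuous_std_pdf.
- by move=> t _; rewrite ltW // std_pdf_gt0.
Qed.

Section Solution.
Variables (h : R -> R) (L : R).
Hypothesis h01 : forall x, 0 <= h x <= 1.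
Hypothesis hL : forall x y, `|h x - h y| <= L * `|x - y|.

Let L0 : 0 <= L.
Proof. by have := hL 1 0; rewrite subr0 normr1 mulr1; apply: le_trans. Qed.

Let h_cont : continuous h.
Proof.
move=> x; apply/(@cvgrPdist_le _ R^o) => e e0; near=> y.
apply: le_trans (hL _ _) _; apply: (@le_trans _ _ ((L + 1) * `|x - y|)).
  by rewrite ler_wpM2r // lerDl.
rewrite mulrC -ler_pdivlMr ?ltr_wpDl //; near: y.
by apply: (@cvgr_dist_le _ R^o) => //; rewrite divr_gt0 // ltr_wpDl.
Unshelve. all: by end_near.
Qed.

Let h_meas : measurable_fun setT h.
Proof. exact: continuous_measurable_fun. Qed.

Let hp_int D : measurable D -> mu.-integrable D (EFin \o (fun t => h t * p t)).
Proof.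
move=> mD; apply: le_integrable (int_p mD) => //.
  apply/measurable_EFinP; apply: measurable_funM; apply: measurable_funTS => //.
  exact: measurable_normal_pdf.
move=> t _; have /andP[a0 a1] := h01 t; rewrite lee_fin !ger0_norm ?mulr_ge0 ?normal_pdf_ge0 //.
by rewrite ler_piMl // normal_pdf_ge0.
Qed.

Definition gauss_mean := \int[mu]_t (h t * p t).
Let N := gauss_mean.

Let p_total : \int[mu]_t p t = 1.
Proof. by rewrite /Rintegral /p integral_normal_pdf. Qed.

Lemma gauss_mean01 : 0 <= gauss_mean <= 1.
Proof.
apply/andP; split.
  apply: Rintegral_ge0 => t _; have /andP[a0 _] := h01 t.
  by rewrite mulr_ge0 // normal_pdf_ge0.
rewrite -p_total; apply: le_Rintegral; rewrite ?int_p ?hp_int // => t _.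
by have /andP[_ a1] := h01 t; rewrite ler_piMl // normal_pdf_ge0.
Qed.

Let patch_int D : mu.-integrable D (EFin \o p) -> measurable D ->
  mu.-integrable setT (EFin \o (p \_ D)).
Proof. by move=> pD mD; rewrite -restrict_EFin -(integrable_mkcond _ mD). Qed.

Lemma gauss_mean_ge y : (forall t, t <= y -> h t = 1) ->
  \int[mu]_(t in `]-oo, y]) p t <= gauss_mean.
Proof.
move=> h1; rewrite Rintegral_mkcond; apply: le_Rintegral; rewrite ?patch_int ?int_p ?hp_int //.
move=> t _; rewrite patchE; case: ifPn => [|_]; last first.
  by have /andP[a0 _] := h01 t; rewrite mulr_ge0 // normal_pdf_ge0.
by rewrite inE /= in_itv /= => ty; rewrite h1 // mul1r.
Qed.

Lemma gauss_mean_le z : (forall t, z < t -> h t = 0) ->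
  gauss_mean <= \int[mu]_(t in `]-oo, z]) p t.
Proof.
move=> h0; rewrite Rintegral_mkcond; apply: le_Rintegral; rewrite ?patch_int ?int_p ?hp_int //.
move=> t _; rewrite patchE; case: ifPn => [_|].
  by have /andP[_ a1] := h01 t; rewrite ler_piMl // normal_pdf_ge0.
by rewrite notin_setE /= in_itv /= => /negP; rewrite -ltNge => zt; rewrite h0 // mul0r.
Qed.

Let N01 : 0 <= N <= 1 := gauss_mean01.

Let g t := (h t - N) * p t.

Let gE : g = (fun t => h t * p t - N * p t).
Proof. by apply/funext => t; rewrite /g mulrBl. Qed.

Let Np_int D : measurable D -> mu.-integrable D (EFin \o (fun t => N * p t)).
Proof.
move=> mD; have := integrableZl mD N (int_p mD); apply: eq_integrable => // t _.
Qed.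

Let g_int D : measurable D -> mu.-integrable D (EFin \o g).
Proof.
move=> mD; rewrite gE; have := integrableB mD (hp_int mD) (Np_int mD).
by apply: eq_integrable.
Qed.

Let g_le t : `|g t| <= p t.
Proof.
have /andP[a0 a1] := h01 t; have /andP[b0 b1] := N01.
rewrite /g normrM [`|p t|]ger0_norm ?normal_pdf_ge0 // ler_piMl ?normal_pdf_ge0 //.
by rewrite ler_norml; lra.
Qed.

Let A w := \int[mu]_(t in `]-oo, w]) g t.

Let g_total : \int[mu]_t g t = 0.
Proof.
rewrite gE RintegralB ?hp_int ?Np_int // RintegralZl ?int_p //.
by rewrite p_total mulr1 subrr.
Qed.

Let A_le D : measurable D -> `|\int[mu]_(t in D) g t| <= \int[mu]_(t in D) p t.
Proof.
move=> mD; apply: le_trans (le_normr_Rintegral mD (g_int mD)) _.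
apply: le_Rintegral => //; last exact: int_p.
have := integrable_abse (g_int mD); exact: eq_integrable.
Qed.

(** As [g] has integral 0, [A w] is minus its integral over the upper tail. *)
Let A_tail w : 0 < w -> `|A w| <= \int[mu]_(t in `[w, +oo[) p t.
Proof.
move=> w0; have : A w + \int[mu]_(t in `]w, +oo[) g t = 0.
  rewrite -g_total -(setUv `]-oo, w]) setCitvl Rintegral_setU //.
  - by apply: g_int; exact: measurableU.
  - by rewrite -setCitvl; apply/disj_setPLR; rewrite setCK.
move/eqP; rewrite addr_eq0 => /eqP ->; rewrite normrN.
apply: le_trans (A_le _) _ => //.
by rewrite Rintegral_itv_obnd_cbnd //; exact: int_p.
Qed.

Let A_derive (w : R) : is_derive w 1 A (g w).
Proof.
have g_cont : continuous g.
  move=> x; apply: cvgM; last exact: continuous_std_pdf.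
  by apply: cvgB; [exact: h_cont|exact: cvg_cst].
have w1 : w < w + 1 by rewrite ltrDl.
have [||dA AE] := @continuous_FTC1 R g -oo%O w (w + 1) w1 (g_int (measurable_itv _)).
- by rewrite ltNyr.
- exact: g_cont.
by apply: DeriveDef; [exact: dA|rewrite -derive1E; exact: AE].
Qed.

Let q x : R := (normal_peak 1)^-1 * expR (x ^+ 2 / 2).

Let qE x : q x = (p x)^-1.
Proof. by rewrite pE invfM -expRN opprK. Qed.

Let q_derive (x : R) : is_derive x 1 q (x * q x).
Proof.
have d1 : is_derive x 1 (fun x : R => x ^+ 2 / 2) x.
  have -> : (fun x : R => x ^+ 2 / 2) = 2^-1 *: ((@id R) ^+ 2).
    by apply/funext => y; rewrite /= fctE mulrC.
  by apply: is_derive_eq; rewrite /GRing.scale /= mulr1 expr1; field.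
by apply: is_derive_eq; rewrite /q /GRing.scale /=; ring.
Qed.

(* The bounded solution of f' - w f = h - gauss_mean. *)
Definition stein_fun w := A w * q w.

Lemma stein_derive (w : R) : is_derive w 1 stein_fun (h w - gauss_mean + w * stein_fun w).
Proof.
have dA := A_derive w; have dq := q_derive w.
apply: is_derive_eq; rewrite /stein_fun /g /GRing.scale /= qE -/N.
by have := std_pdf_gt0 w; rewrite lt0r => /andP[p0 _]; field.
Qed.

(** [A w] is at most the Gaussian tail on the side of [w], hence at most p(w) / |w|, and [stein_fun]
    divides it by p(w). *)
Lemma stein_mul_le w : `|w * stein_fun w| <= 1.
Proof.
rewrite /stein_fun qE mulrA normrM [`|_^-1|]ger0_norm ?invr_ge0 ?normal_pdf_ge0 //.
rewrite ler_pdivrMr ?std_pdf_gt0 // mul1r normrM.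
have [w0|w0|->] := ltgtP w 0; last by rewrite normr0 mul0r normal_pdf_ge0.
- rewrite ltr0_norm // mulrC -ler_pdivlMr ?oppr_gt0 //.
  by apply: le_trans (gauss_tailN w0); exact: A_le.
- rewrite gtr0_norm // mulrC -ler_pdivlMr //.
  by apply: le_trans (gauss_tail w0); exact: A_tail.
Qed.

(** For |w| >= 1 this follows from [stein_mul_le]; elsewhere |A w| <= 1 and the density is at least
    [p 1]. *)
Lemma stein_bounded : exists2 C, 0 <= C & forall w, `|stein_fun w| <= C.
Proof.
exists (1 + (p 1)^-1) => [|w]; first by rewrite addr_ge0 // invr_ge0 normal_pdf_ge0.
have p1 : 0 <= (p 1)^-1 by rewrite invr_ge0 normal_pdf_ge0.
have [w1|w1] := leP 1 `|w|.
  apply: (@le_trans _ _ 1); last by rewrite lerDl.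
  by apply: le_trans (stein_mul_le w); rewrite [leRHS]normrM; apply: ler_peMl.
apply: (@le_trans _ _ (p 1)^-1); last by rewrite lerDr.
rewrite /stein_fun normrM qE [`|_^-1|]ger0_norm ?invr_ge0 ?normal_pdf_ge0 //.
rewrite -[leRHS]mul1r; apply: ler_pM; rewrite ?invr_ge0 ?normal_pdf_ge0 //.
  apply: le_trans (A_le _) _ => //; rewrite -p_total.
  rewrite Rintegral_mkcond; apply: le_Rintegral => //.
  - by rewrite -restrict_EFin; apply/integrable_restrict => //; rewrite setTI; exact: int_p.
  - exact: int_p.
  - by move=> t _; rewrite patchE; case: ifP => // _; rewrite normal_pdf_ge0.
rewrite lef_pV2 ?posrE ?std_pdf_gt0 //.
have -> : p w = p `|w| by case: ger0P => // _; rewrite std_pdf_even.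
by apply: std_pdf_decr => //; exact: ltW.
Qed.

End Solution.
End Stein.

(** * A Stein identity for the cycles of a uniform permutation *)

Section UnifStein.
Variable R : realType.
Local Notation E n F := (pexp (unif_pgf R n) F).
Local Notation H := (harm R).
Local Notation H2 := (harm2 R).
Implicit Types F G : nat -> R.

Lemma unif_ge0 n F : (forall k, 0 <= F k) -> 0 <= E n F.
Proof.
elim: n F => [|n IH] F F0; first by rewrite unif_pgf0 pexp1l.
by rewrite pexp_unif_pgfS; apply: IH => k; rewrite divr_ge0 // addr_ge0 // mulr_ge0.
Qed.

Lemma pexpBr (p : {poly R}) F G : pexp p (fun k => F k - G k) = pexp p F - pexp p G.
Proof.
rewrite -mulN1r -pexpZr -pexpDr; apply: eq_pexp => k; by rewrite mulN1r.
Qed.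

Lemma unif_le n F G : (forall k, F k <= G k) -> E n F <= E n G.
Proof.
by move=> FG; rewrite -subr_ge0 -pexpBr; apply: unif_ge0 => k; rewrite subr_ge0.
Qed.

Lemma unif_norm n F G : (forall k, `|F k| <= G k) -> `|E n F| <= E n G.
Proof.
move=> FG; rewrite ler_norml; apply/andP; split.
  rewrite -mulN1r -pexpZr; apply: unif_le => k.
  by have := FG k; rewrite mulN1r ler_norml => /andP[].
by apply: unif_le => k; apply: le_trans (FG k); exact: ler_norm.
Qed.

Definition cycle_var n : R := H n - H2 n.

Lemma cycle_var_ge0 n : 0 <= cycle_var n.
Proof.
rewrite subr_ge0 /harm2 /harm; apply: ler_sum => i _.
by rewrite expr2 ler_piMl ?invr_ge0 // invf_le1 // ler1n.
Qed.

Let T n F := E n (fun k => (k%:R - H n) * F k) - cycle_var n * E n (fun k => F k.+1 - F k).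

Let shift n F k : R := (F k.+1 + n%:R * F k) / n.+1%:R.

(** For a Bernoulli variable of parameter p = 1 / (n + 1) the identity is exact with the difference
    taken before the variable is added. Taking it afterwards costs p^2 (1 - p) times a second
    difference, and p^2 (1 - p) is the coefficient here. *)
Let T_step n F : T n.+1 F = T n (shift n F)
  - n%:R / n.+1%:R ^+ 3 * E n (fun k => F k.+2 - F k.+1 *+ 2 + F k).
Proof.
rewrite /T !pexp_unif_pgfS -!pexpZr -!pexpBr; apply: eq_pexp => k.
rewrite /cycle_var !harmS harm2S /shift.
have n1 : n.+1%:R != 0 :> R by rewrite pnatr_eq0.
rewrite -[k.+1%:R]natr1 -[n.+1%:R]natr1 in n1 *.
by move: (harm R n) (harm2 R n) (n%:R : R) (k%:R : R) n1 => u v z w z0; field.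
Qed.

(* An approximate Stein identity: both terms nearly satisfy the recursion of
   [pexp_unif_pgfS], up to a second difference. *)
Lemma cycle_stein n F G :
  (forall k, `|F k.+2 - F k.+1 *+ 2 + F k| <= G k) ->
  `|E n (fun k => (k%:R - H n) * F k) - cycle_var n * E n (fun k => F k.+1 - F k)| <= E n G.
Proof.
rewrite -/(T n F); case: n => [|n] FG.
  have G0 : 0 <= G 0%N by apply: le_trans (FG 0%N).
  rewrite /T unif_pgf0 !pexp1l /cycle_var /harm /harm2 !big_ord0.
  by rewrite !(subr0, mul0r) normr0.
have G0 k : 0 <= G k by apply: le_trans (FG k).
(* A strengthening fit for induction: the step from n + 1 to n + 2 adds at most 1 / (n + 2)^2, which
   is less than 1 / (n + 1) - 1 / (n + 2). *)
suff : `|T n.+1 F| <= (1 - n.+1%:R^-1) * E n.+1 G.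
  move=> /le_trans; apply; rewrite ler_piMl ?unif_ge0 // gerBl invr_ge0 //.
elim: n F G FG G0 => [|n IH] F G FG G0.
  rewrite T_step mul0r mul0r subr0 invr1 subrr mul0r.
  rewrite /T unif_pgf0 !pexp1l /cycle_var /harm /harm2 !big_ord0.
  by rewrite !(subr0, mul0r) normr0.
rewrite T_step; apply: le_trans (ler_normB _ _) _.
have h1 : `|T n.+1 (shift n.+1 F)| <= (1 - n.+1%:R^-1) * E n.+2 G.
  rewrite [E n.+2 G]pexp_unif_pgfS; apply: IH => k; last by rewrite divr_ge0 // addr_ge0 // mulr_ge0.
  rewrite /shift (_ : _ + _ = ((F k.+3 - F k.+2 *+ 2 + F k.+1)
     + n.+1%:R * (F k.+2 - F k.+1 *+ 2 + F k)) / n.+2%:R); last first.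
    have : n.+2%:R != 0 :> R by rewrite pnatr_eq0.
    by rewrite !mulr2n => ?; field.
  rewrite normrM [`|_^-1|]ger0_norm ?invr_ge0 // ler_wpM2r ?invr_ge0 //.
  apply: le_trans (ler_normD _ _) _; apply: lerD; first exact: FG.
  by rewrite normrM normr_nat ler_wpM2l // FG.
have h2 : n.+1%:R / n.+2%:R * E n.+1 G <= E n.+2 G.
  rewrite [leRHS]pexp_unif_pgfS -pexpZr; apply: unif_le => k.
  by rewrite mulrAC ler_wpM2r ?invr_ge0 // lerDr.
have h3 : `|n.+1%:R / n.+2%:R ^+ 3 * E n.+1 (fun k => F k.+2 - F k.+1 *+ 2 + F k)| <=
    n.+2%:R^-1 ^+ 2 * E n.+2 G.
  rewrite normrM ger0_norm ?divr_ge0 ?exprn_ge0 //.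
  apply: (@le_trans _ _ (n.+2%:R^-1 ^+ 2 * (n.+1%:R / n.+2%:R * E n.+1 G))); last first.
    by rewrite ler_wpM2l // exprn_ge0 // invr_ge0.
  have n2 : n.+2%:R != 0 :> R by rewrite pnatr_eq0.
  have -> : n.+2%:R^-1 ^+ 2 * (n.+1%:R / n.+2%:R * E n.+1 G) =
      n.+1%:R / n.+2%:R ^+ 3 * E n.+1 G by field.
  by rewrite ler_wpM2l ?divr_ge0 ?exprn_ge0 // unif_norm.
apply: le_trans (lerD h1 h3) _; rewrite -mulrDl ler_wpM2r ?unif_ge0 //.
have n1 : n.+1%:R != 0 :> R by rewrite pnatr_eq0.
have n2 : n.+2%:R != 0 :> R by rewrite pnatr_eq0.
have p1 : 0 < n.+1%:R :> R by rewrite ltr0n.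
rewrite -[n.+2]/(1 + n.+1)%N natrD in n2 *; move: (n.+1%:R : R) n1 n2 p1 => z n1 n2 p1.
rewrite -subr_ge0 (_ : _ - _ = (z * (1 + z) ^+ 2)^-1); last by field; rewrite n1 n2.
by rewrite invr_ge0 mulr_ge0 ?exprn_ge0 // ?addr_ge0 // ltW.
Qed.

End UnifStein.

(** * Normal approximation with given centre and scale *)

Section SteinBound.
Variable R : realType.
Variables (h : R -> R) (L : R).
Hypothesis h01 : forall x, 0 <= h x <= 1.
Hypothesis hL : forall x y, `|h x - h y| <= L * `|x - y|.
Local Notation f := (stein_fun h).
Local Notation N := (gauss_mean h).
Let D w := h w - N + w * f w.

Let fD (w : R) : is_derive w 1 f (D w).
Proof. exact: stein_derive h01 hL w. Qed.

Let f_mvt x y : exists2 c, `|c - x| <= `|y - x| & f y - f x = D c * (y - x).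
Proof.
have cf (a b : R) : {within `[a, b], continuous f}%classic.
  apply: continuous_subspaceT => z; apply: differentiable_continuous.
  by apply/derivable1_diffP; have d := fD z; exact: ex_derive.
have [xy|yx|<-] := ltgtP x y.
- have [c] := MVT xy (fun z _ => fD z) (@cf x y); rewrite in_itv /= => /andP[xc cy] E.
  by exists c => //; rewrite gtr0_norm ?subr_gt0 // gtr0_norm ?subr_gt0 // lerD2r ltW.
- have [c] := MVT yx (fun z _ => fD z) (@cf y x); rewrite in_itv /= => /andP[yc cx] E.
  exists c; first by rewrite ltr0_norm ?subr_lt0 // ltr0_norm ?subr_lt0 // !opprB lerD2l lerN2 ltW.
  by rewrite -[LHS]opprB E -mulrN opprB.
- by exists x; rewrite !subrr ?mulr0.
Qed.

(** The centre [m] and the scale [d] are going to be those of the commutator; their mismatch with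
    the uniform case causes the first two terms. The last one involves a second moment, since the
    derivative of the Stein solution is Lipschitz near w only with the constant C + 2 |w|. *)
Lemma stein_clt_bound : exists2 C, 0 <= C & forall n (m d : R), 0 <= d ->
  `|pexp (unif_pgf R n) (fun k => h ((m - k%:R) * d)) - N| <=
  2 * `|1 - cycle_var R n * d ^+ 2| + C * `|(m - harm R n) * d| +
  (cycle_var R n + 6) * d ^+ 3 *
    (C + 2 * (1 + cycle_var R n * d ^+ 2 + ((m - harm R n) * d) ^+ 2)).
Proof.
have [C0 C00 fC0] := stein_bounded h01 hL.
have L0 : 0 <= L by have := hL 1 0; rewrite subr0 normr1 mulr1; apply: le_trans.
pose C := L + C0.
have C0' : 0 <= C by rewrite addr_ge0.
have fC w : `|f w| <= C by apply: le_trans (fC0 w) _; rewrite lerDr.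
have N01 : 0 <= N <= 1 := gauss_mean01 h01 hL.
have D2 w : `|D w| <= 2.
  have /andP[a0 a1] := h01 w; have /andP[b0 b1] := N01.
  have := stein_mul_le h01 hL w; rewrite /D !ler_norml => /andP[c0 c1].
  by apply/andP; split; lra.
have f2 x y : `|f y - f x| <= 2 * `|y - x|.
  by have [c _ ->] := f_mvt x y; rewrite normrM ler_wpM2r.
have DL w x : `|D x - D w| <= `|x - w| * (C + 2 * `|w|).
  have -> : D x - D w = (h x - h w) + ((x - w) * f x + w * (f x - f w)) by rewrite /D; ring.
  apply: le_trans (ler_normD _ _) _.
  apply: (@le_trans _ _ (L * `|x - w| + (`|x - w| * C0 + `|w| * (2 * `|x - w|)))).
    apply: lerD; first exact: hL.
    apply: le_trans (ler_normD _ _) _.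
    by apply: lerD; rewrite normrM; apply: ler_wpM2l.
  by rewrite /C le_eqVlt; apply/orP; left; apply/eqP; ring.
have f_taylor w x : `|f x - f w - (x - w) * D w| <= (x - w) ^+ 2 * (C + 2 * `|w|).
  have [c cw ->] := f_mvt w x.
  have -> : D c * (x - w) - (x - w) * D w = (D c - D w) * (x - w) by ring.
  rewrite normrM -(real_normK (num_real (x - w))) expr2 mulrAC; apply: ler_wpM2r => //.
  apply: le_trans (DL w c) _; apply: ler_wpM2r cw.
  by rewrite addr_ge0 // mulr_ge0.
exists C => // n m d d0.
set v := cycle_var R n; set b := (m - harm R n) * d.
have v0 : 0 <= v by exact: cycle_var_ge0.
pose W k := (m - k%:R) * d; pose F k := f (W k).
have W1 k : W k.+1 - W k = - d by rewrite /W -natr1; ring.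
have W2 k : W k.+2 - W k = - (2 * d) by rewrite /W -[k.+2]addn2 natrD; ring.
pose e k := F k.+1 - F k + d * D (W k).
have e_le k : `|e k| <= d ^+ 2 * (C + 2 * `|W k|).
  have := f_taylor (W k) (W k.+1); rewrite W1 sqrrN.
  by rewrite /e mulNr opprK.
(* 6 = 2^2 + 2: a second difference is the Taylor remainder for the step 2 d minus twice that for
   the step d. *)
pose G k := 6 * d ^+ 2 * (C + 2 * `|W k|).
have FG k : `|F k.+2 - F k.+1 *+ 2 + F k| <= G k.
  have := f_taylor (W k) (W k.+2); rewrite W2 sqrrN => h2.
  have -> : F k.+2 - F k.+1 *+ 2 + F k =
      (F k.+2 - F k - - (2 * d) * D (W k)) - 2 * e k.
    by rewrite /e mulr2n; ring.
  apply: le_trans (ler_normB _ _) _; rewrite normrM normr_nat.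
  apply: (@le_trans _ _ ((2 * d) ^+ 2 * (C + 2 * `|W k|) + 2 * (d ^+ 2 * (C + 2 * `|W k|)))).
    by apply: lerD h2 _; rewrite ler_wpM2l.
  by rewrite /G exprMn; lra.
set M := C + 2 * (1 + v * d ^+ 2 + b ^+ 2).
have M_le : pexp (unif_pgf R n) (fun k => C + 2 * `|W k|) <= M.
  apply: (@le_trans _ _ (pexp (unif_pgf R n) (fun k => (C + 2 + 2 * (m * d) ^+ 2) * 1 +
     (- (4 * m * d ^+ 2) * k%:R + 2 * d ^+ 2 * k%:R ^+ 2)))).
    apply: unif_le => k; have -> : (C + 2 + 2 * (m * d) ^+ 2) * 1 +
       (- (4 * m * d ^+ 2) * k%:R + 2 * d ^+ 2 * k%:R ^+ 2) = C + 2 * (1 + `|W k| ^+ 2).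
      by rewrite (real_normK (num_real _)) /W; ring.
    have := sqr_ge0 (`|W k| - 1); have := sqr_ge0 `|W k|; rewrite sqrrB1; move: `|W k| => u.
    by rewrite mulr2n; lra.
  rewrite !pexpDr !pexpZr unif_total unif_mean unif_second /M /v /cycle_var /b.
  by move: (harm R n) (harm2 R n) => u w; rewrite le_eqVlt; apply/orP; left; apply/eqP; ring.
have M0 : 0 <= M.
  apply: le_trans M_le; apply: unif_ge0 => k; by rewrite addr_ge0 // mulr_ge0.
have := @cycle_stein R n F G FG; rewrite -/v.
set S := pexp _ (fun k => (k%:R - harm R n) * F k).
have -> : pexp (unif_pgf R n) G = 6 * d ^+ 2 * pexp (unif_pgf R n) (fun k => C + 2 * `|W k|).
  by rewrite -pexpZr.
have -> : pexp (unif_pgf R n) (fun k => F k.+1 - F k) =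
    pexp (unif_pgf R n) e - d * pexp (unif_pgf R n) (fun k => D (W k)).
  by rewrite -pexpZr -pexpBr; apply: eq_pexp => k; rewrite /e; ring.
have Ee : `|pexp (unif_pgf R n) e| <= d ^+ 2 * M.
  apply: le_trans (unif_norm _ e_le) _; rewrite pexpZr ler_wpM2l //.
  by rewrite exprn_ge0.
have Ed : `|pexp (unif_pgf R n) (fun k => D (W k))| <= 2.
  apply: le_trans (@unif_norm _ _ _ (fun=> 2 * 1) _) _ => [k|]; first by rewrite mulr1; exact: D2.
  by rewrite pexpZr unif_total mulr1.
have EF : `|pexp (unif_pgf R n) F| <= C.
  apply: le_trans (@unif_norm _ _ _ (fun=> C * 1) _) _ => [k|]; first by rewrite mulr1; exact: fC.
  by rewrite pexpZr unif_total mulr1.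
(* The Stein equation at [W k], where W(k) f(W(k)) is split into [b * F k] and a multiple of
   [(k%:R - harm R n) * F k]. The latter is the subject of [cycle_stein], and the differences of [F]
   there turn into - d D, so that the coefficient of the mean of [D] becomes [1 - v * d ^+ 2]. *)
have -> : pexp (unif_pgf R n) (fun k => h ((m - k%:R) * d)) - N =
    pexp (unif_pgf R n) (fun k => D (W k)) - b * pexp (unif_pgf R n) F + d * S.
  have -> : pexp (unif_pgf R n) (fun k => h ((m - k%:R) * d)) =
      pexp (unif_pgf R n) (fun k => D (W k) + (N * 1 + (- b * F k + d * ((k%:R - harm R n) * F k)))).
    by apply: eq_pexp => k; rewrite /D /F /b -/(W k); move: (h (W k)) (f (W k)) => u y; rewrite /W; ring.
  by rewrite !pexpDr !pexpZr unif_total -/S; ring.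
move: Ee Ed EF; set x1 := pexp _ e; set x2 := pexp _ _; set x3 := pexp _ F => Ee Ed EF.
set t := S - _ => St.
have {}St : `|t| <= 6 * d ^+ 2 * M.
  by apply: le_trans St _; rewrite ler_wpM2l // mulr_ge0 ?exprn_ge0.
have -> : x2 - b * x3 + d * S = (1 - v * d ^+ 2) * x2 - b * x3 + (d * v * x1 + d * t).
  by rewrite /t; ring.
apply: le_trans (ler_normD _ _) _; apply: lerD.
  apply: le_trans (ler_normB _ _) _; rewrite !normrM; apply: lerD.
    by rewrite mulrC ler_wpM2r.
  by rewrite mulrC ler_wpM2r.
apply: le_trans (ler_normD _ _) _; rewrite !normrM (ger0_norm d0) (ger0_norm v0).
apply: (@le_trans _ _ (d * v * (d ^+ 2 * M) + d * (6 * d ^+ 2 * M))).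
  by apply: lerD; apply: ler_wpM2l => //; exact: mulr_ge0.
by rewrite le_eqVlt; apply/orP; left; apply/eqP; ring.
Qed.
End SteinBound.

(** * Limits *)

Section Limits.
Variable R : realType.
Implicit Types (u v e : nat -> R).

Lemma cvg_inv_nat : (fun n => n%:R^-1 : R) @ \oo --> (0 : R).
Proof. by rewrite -cvg_shiftS; exact: cvg_harmonic. Qed.

Lemma cvg_sqrt u l : u @ \oo --> l -> (fun n => Num.sqrt (u n)) @ \oo --> Num.sqrt l.
Proof. by move=> ul; apply: (cvg_comp _ _ ul); exact: sqrt_continuous. Qed.

Lemma cvg_inv_sqrt : (fun n => (Num.sqrt n%:R)^-1 : R) @ \oo --> (0 : R).
Proof.
have := cvg_sqrt cvg_inv_nat; rewrite sqrtr0; apply: cvg_trans.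
by apply: near_eq_cvg; apply: nearW => n; rewrite sqrtrV.
Qed.

(** With r the fourth root of n, ln n = 4 ln r <= 4 r, while the denominator is r^2. *)
Lemma cvg_ln_div_sqrt : (fun n => ln n%:R / Num.sqrt n%:R : R) @ \oo --> (0 : R).
Proof.
have c := cvg_sqrt cvg_inv_sqrt; rewrite sqrtr0 in c.
apply: (@squeeze_cvgr _ _ _ _ (cst 0) (fun n => 4 * Num.sqrt (Num.sqrt n%:R)^-1)).
- near=> n; have n1 : 1 <= n%:R :> R by rewrite ler1n; near: n; exact: nbhs_infty_gt.
  have n0 : 0 < n%:R :> R by apply: lt_le_trans n1.
  set s := Num.sqrt n%:R; have s0 : 0 < s by rewrite sqrtr_gt0.
  set r := Num.sqrt s; have r0 : 0 < r by rewrite sqrtr_gt0.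
  have rr : r ^+ 2 = s by rewrite sqr_sqrtr // ltW.
  have ss : s ^+ 2 = n%:R by rewrite sqr_sqrtr // ltW.
  apply/andP; split; first by rewrite divr_ge0 ?ln_ge0 // ltW.
  have lnE : ln n%:R = 4 * ln r by rewrite -ss -rr -exprM lnXn // -[LHS]mulr_natl.
  rewrite lnE sqrtrV ?(ltW s0) // -/r -rr.
  have -> : 4 * ln r / r ^+ 2 = 4 * r^-1 * (ln r / r) by field; rewrite gt_eqF.
  rewrite -[X in _ <= X]mulr1; apply: ler_wpM2l; first by rewrite mulr_ge0 // invr_ge0 ltW.
  by rewrite ler_pdivrMr // mul1r; apply/ltW/ln_sublinear.
- exact: cvg_cst.
- by rewrite -[X in _ --> X](mulr0 4); apply: cvgM => //; exact: cvg_cst.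
Unshelve. all: by end_near.
Qed.

Lemma cvg0_of_sqrt_bound (K : R) (w e : nat -> R) (N : nat) :
  (fun n => w n / Num.sqrt n%:R) @ \oo --> (0 : R) ->
  (forall n, (N <= n)%N -> 0 <= w n) ->
  (forall n, (N <= n)%N -> `|e n| <= K / Num.sqrt n%:R) ->
  (fun n => w n * e n) @ \oo --> (0 : R).
Proof.
move=> w0 wp eK; apply: norm_cvg0.
apply: (@squeeze_cvgr _ _ _ _ (cst 0) (fun n => K * (w n / Num.sqrt n%:R))).
- near=> n; have Nn : (N <= n)%N by near: n; exact: nbhs_infty_ge.
  rewrite normr_ge0 /= normrM ger0_norm ?wp // mulrCA.
  by apply: ler_wpM2l; [exact: wp|exact: eK].
- exact: cvg_cst.
- by rewrite -[X in _ --> X](mulr0 K); apply: cvgM => //; exact: cvg_cst.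
Unshelve. all: by end_near.
Qed.

Lemma cvg_ln_nat : (fun n => ln n%:R : R) @ \oo --> +oo.
Proof.
apply/cvgryPge => M; near=> n.
have h : expR M <= n%:R by near: n; exact: nbhs_infty_ger.
by rewrite -[M]expRK ler_ln ?posrE ?expR_gt0 // (lt_le_trans (expR_gt0 M)).
Unshelve. all: by end_near.
Qed.

Lemma cvg_inv_ln : (fun n => (ln n%:R)^-1 : R) @ \oo --> (0 : R).
Proof.
apply/gtr0_cvgV0; last exact: cvg_ln_nat.
near=> n; rewrite ln_gt0 //; rewrite ltr1n; near: n; exact: nbhs_infty_gt.
Unshelve. all: by end_near.
Qed.

(** The difference of the roots is [V n - ln n%:R] divided by their sum; times the root of the
    logarithm, this tends to a / 2. *)
Lemma sqrt_expansion (V : nat -> R) (a : R) :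
  (fun n => V n - ln n%:R) @ \oo --> a ->
  (fun n => (Num.sqrt (V n) - Num.sqrt (ln n%:R) - (a / 2) * (Num.sqrt (ln n%:R))^-1)
            * Num.sqrt (ln n%:R)) @ \oo --> (0 : R).
Proof.
move=> Va.
have VL : (fun n => 1 + (V n - ln n%:R) * (ln n%:R)^-1) @ \oo --> (1 : R).
  rewrite -[X in _ --> X]addr0 -[X in _ + X](mulr0 a).
  by apply: cvgD; [exact: cvg_cst|apply: cvgM Va cvg_inv_ln].
have den : (fun n => Num.sqrt (1 + (V n - ln n%:R) * (ln n%:R)^-1) + 1) @ \oo --> (2 : R).
  have -> : 2 = Num.sqrt 1 + 1 :> R by rewrite sqrtr1.
  by apply: cvgD; [exact: cvg_sqrt|exact: cvg_cst].
have den' : (fun n => (Num.sqrt (1 + (V n - ln n%:R) * (ln n%:R)^-1) + 1)^-1) @ \oo --> (2^-1 : R).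
  by apply: cvgV.
have lim : (fun n => (V n - ln n%:R) * (Num.sqrt (1 + (V n - ln n%:R) * (ln n%:R)^-1) + 1)^-1 - a / 2)
    @ \oo --> (0 : R).
  rewrite -(subrr (a / 2)); apply: cvgB; last exact: cvg_cst.
  exact: cvgM.
apply: cvg_trans lim; apply: near_eq_cvg; near=> n.
have l0 : 0 < ln n%:R :> R by rewrite ln_gt0 // ltr1n; near: n; exact: nbhs_infty_gt.
have v0 : 0 <= 1 + (V n - ln n%:R) * (ln n%:R)^-1.
  by near: n; apply: (cvgr_ge (1 : R)) => //.
set D := V n - ln n%:R in v0 *; set l := ln n%:R in l0 v0 *.
have VE : V n = l * (1 + D * l^-1) by rewrite mulrDr mulr1 mulrCA divff ?gt_eqF // mulr1 /D addrC subrK.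
rewrite VE sqrtrM ?ltW //; set s := Num.sqrt l; set t := Num.sqrt (1 + D / l).
have s0 : 0 < s by rewrite sqrtr_gt0.
have t0 : 0 <= t by rewrite sqrtr_ge0.
have ss : s ^+ 2 = l by rewrite sqr_sqrtr // ltW.
have tt : t ^+ 2 = 1 + D / l by rewrite sqr_sqrtr.
have DE : D = s ^+ 2 * (t ^+ 2 - 1) by rewrite ss tt addrAC subrr add0r mulrC divfK // gt_eqF.
have t1 : t + 1 != 0 by rewrite gt_eqF // ltr_wpDl.
by rewrite DE; field; rewrite t1 gt_eqF.
Unshelve. all: by end_near.
Qed.

End Limits.

Section CommutatorLimits.
Variable R : realType.
Local Notation lnn := (fun n => ln n%:R : R).

Definition comm_mean n : R := comm_exp n (fun k => k%:R).
Definition comm_var n : R := comm_exp n (fun k => k%:R ^+ 2) - comm_mean n ^+ 2.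

Let e1 n : R := comm_mean n - harm R n.
Let e2 n : R := comm_exp n (fun k => k%:R ^+ 2) - (harm R n ^+ 2 + harm R n - harm2 R n).

Let e_small (e : nat -> R) (K : R) :
  (forall n, (60 <= n)%N -> `|e n| <= K / Num.sqrt n%:R) ->
  e @ \oo --> (0 : R) /\ (fun n => lnn n * e n) @ \oo --> (0 : R).
Proof.
move=> eK; split.
  have -> : e = (fun n => 1 * e n) by apply/funext => n; rewrite mul1r.
  apply: (cvg0_of_sqrt_bound (w := fun=> 1)) eK => //.
  have -> : (fun n => 1 / Num.sqrt n%:R) = (fun n => (Num.sqrt n%:R)^-1 : R).
    by apply/funext => n; rewrite mul1r.
  exact: cvg_inv_sqrt.
apply: cvg0_of_sqrt_bound (@cvg_ln_div_sqrt R) _ eK => n n60.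
by rewrite ln_ge0 // ler1n (leq_trans _ n60).
Qed.

Lemma cvg_mean_sub_harm : e1 @ \oo --> (0 : R).
Proof.
have [K _ hK] := comm_moments R.
by apply: (e_small (K := K) _).1 => n n60; have [] := hK n n60.
Qed.

Lemma cvg_mean : (fun n => comm_mean n - lnn n) @ \oo --> euler_gamma R.
Proof.
have -> : (fun n => comm_mean n - lnn n) = (fun n => (harm R n - lnn n) + e1 n).
  by apply/funext => n; rewrite /e1 addrAC addrCA subrr addr0.
by rewrite -[X in _ --> X]addr0; apply: cvgD (@cvg_euler_gamma R) cvg_mean_sub_harm.
Qed.

Lemma cvg_cycle_var : (fun n => cycle_var R n - lnn n) @ \oo --> euler_gamma R - pi ^+ 2 / 6.
Proof.
have -> : (fun n => cycle_var R n - lnn n) = (fun n => (harm R n - lnn n) - harm2 R n).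
  by apply/funext => n; rewrite /cycle_var addrAC.
exact: cvgB (@cvg_euler_gamma R) (@basel R).
Qed.

(** The squared mean exceeds [harm R n ^+ 2] by [2 * harm R n * e1 n + e1 n ^+ 2], so it is the
    convergence of [ln n%:R * e1 n] to 0 that matters. *)
Lemma cvg_comm_var : (fun n => comm_var n - lnn n) @ \oo --> euler_gamma R - pi ^+ 2 / 6.
Proof.
have [K _ hK] := comm_moments R.
have [e1c le1c] : e1 @ \oo --> (0 : R) /\ (fun n => lnn n * e1 n) @ \oo --> (0 : R).
  by apply: (e_small (K := K)) => n n60; have [] := hK n n60.
have [e2c _] : e2 @ \oo --> (0 : R) /\ (fun n => lnn n * e2 n) @ \oo --> (0 : R).
  by apply: (e_small (K := K)) => n n60; have [] := hK n n60.
have -> : (fun n => comm_var n - lnn n) = (fun n => (cycle_var R n - lnn n) +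
    (e2 n - ((2 * ((harm R n - lnn n) * e1 n) + 2 * (lnn n * e1 n)) + e1 n * e1 n))).
  apply/funext => n; rewrite /comm_var /cycle_var /e2 /e1.
  move: (comm_mean n) (comm_exp _ _) (harm R n) (harm2 R n) (ln _) => a b c e f; ring.
rewrite -[X in _ --> X]addr0; apply: cvgD; first exact: cvg_cycle_var.
rewrite -[X in _ --> X](subrr 0); apply: cvgB => //.
have -> : 0 = 2 * (euler_gamma R * 0) + 2 * 0 + 0 * 0 :> R by rewrite !mulr0 !addr0.
apply: cvgD; last exact: cvgM.
apply: cvgD; apply: cvgM => //; try exact: cvg_cst.
by apply: cvgM => //; exact: cvg_euler_gamma.
Qed.

Lemma cvg_div_ln (u : nat -> R) (a : R) :
  (fun n => u n - lnn n) @ \oo --> a -> (fun n => u n / lnn n) @ \oo --> (1 : R).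
Proof.
move=> ua.
have c : (fun n => (u n - lnn n) * (lnn n)^-1 + 1) @ \oo --> (1 : R).
  rewrite -[X in _ --> X]add0r -[X in X + _](mulr0 a).
  by apply: cvgD; [apply: cvgM ua (@cvg_inv_ln R)|exact: cvg_cst].
apply: cvg_trans c; apply: near_eq_cvg; near=> n.
have l0 : 0 < lnn n by rewrite ln_gt0 // ltr1n; near: n; exact: nbhs_infty_gt.
by rewrite mulrBl divff ?gt_eqF // subrK.
Unshelve. all: by end_near.
Qed.

Lemma comm_var_gt0 : \forall n \near \oo, 0 < comm_var n.
Proof.
have c := cvg_div_ln cvg_comm_var; near=> n.
have l0 : 0 < lnn n by rewrite ln_gt0 // ltr1n; near: n; exact: nbhs_infty_gt.
rewrite -(pmulr_lgt0 _ (x := (lnn n)^-1)) ?invr_gt0 //.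
by near: n; apply: (cvgr_gt (1 : R)).
Unshelve. all: by end_near.
Qed.

Let d n : R := (Num.sqrt (comm_var n))^-1.

Let d0 n : 0 <= d n.
Proof. by rewrite invr_ge0 sqrtr_ge0. Qed.

Let cvg_d2 : (fun n => cycle_var R n * d n ^+ 2) @ \oo --> (1 : R).
Proof.
have c : (fun n => (cycle_var R n / lnn n) * (comm_var n / lnn n)^-1) @ \oo --> (1 : R).
  rewrite -[X in _ --> X](mulr1 1) -[X in _ * X]invr1; apply: cvgM.
    exact: cvg_div_ln cvg_cycle_var.
  by apply: cvgV; [exact: oner_neq0|exact: cvg_div_ln cvg_comm_var].
apply: cvg_trans c; apply: near_eq_cvg; near=> n.
have l0 : 0 < lnn n by rewrite ln_gt0 // ltr1n; near: n; exact: nbhs_infty_gt.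
have v0 : 0 < comm_var n by near: n; exact: comm_var_gt0.
rewrite /d exprVn sqr_sqrtr ?(ltW v0) //.
by rewrite invfM invrK -!mulrA; congr (_ * _); rewrite mulrCA mulVf ?mulr1 // gt_eqF.
Unshelve. all: by end_near.
Qed.

Let cvg_d : d @ \oo --> (0 : R).
Proof.
have c : (fun n => Num.sqrt ((comm_var n / lnn n)^-1 * (lnn n)^-1)) @ \oo --> (0 : R).
  rewrite -[X in _ --> X](@sqrtr0 R); apply: cvg_sqrt.
  rewrite -[X in _ --> X](mulr0 1) -[X in X * _]invr1; apply: cvgM.
    by apply: cvgV; [exact: oner_neq0|exact: cvg_div_ln cvg_comm_var].
  exact: cvg_inv_ln.
apply: cvg_trans c; apply: near_eq_cvg; near=> n.
have l0 : 0 < lnn n by rewrite ln_gt0 // ltr1n; near: n; exact: nbhs_infty_gt.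
have v0 : 0 < comm_var n by near: n; exact: comm_var_gt0.
rewrite /d -sqrtrV ?(ltW v0) //; congr Num.sqrt.
by rewrite invfM invrK -mulrA divff ?mulr1 // gt_eqF.
Unshelve. all: by end_near.
Qed.

Lemma comm_clt_lipschitz (h : R -> R) (L : R) : (forall x, 0 <= h x <= 1) ->
  (forall x y, `|h x - h y| <= L * `|x - y|) ->
  (fun n => comm_exp n (fun k => h ((comm_mean n - k%:R) / Num.sqrt (comm_var n)))) @ \oo
    --> gauss_mean h.
Proof.
move=> h01 hL.
have [C C0 hC] := stein_clt_bound h01 hL; have [K K0 hK] := comm_exp_approx R.
pose B n : R := K * (Num.sqrt n%:R)^-1 + L * d n / 2 +
  (2 * `|1 - cycle_var R n * d n ^+ 2| + C * `|e1 n * d n| +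
  (cycle_var R n * d n ^+ 2 * d n + 6 * (d n * d n * d n)) *
    (C + 2 * (1 + cycle_var R n * d n ^+ 2 + (e1 n * d n) * (e1 n * d n)))).
have B0 : B @ \oo --> (0 : R).
  have ed : (fun n => e1 n * d n) @ \oo --> (0 : R).
    by rewrite -[X in _ --> X](mulr0 0); apply: cvgM cvg_mean_sub_harm cvg_d.
  have -> : 0 = K * 0 + L * 0 / 2 + (2 * `|1 - 1| + C * `|0 : R| +
      (1 * 0 + 6 * (0 * 0 * 0)) * (C + 2 * (1 + 1 + 0 * 0))) :> R.
    by rewrite subrr normr0; ring.
  have kc (a : R) : (fun=> a) @ \oo --> a by exact: cvg_cst.
  apply: cvgD.
    apply: cvgD; first by apply: cvgM => //; exact: cvg_inv_sqrt.
    by apply: cvgM => //; apply: cvgM.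
  apply: cvgD.
    apply: cvgD; apply: cvgM => //; apply: cvg_norm => //.
    exact: cvgB.
  apply: cvgM.
    apply: cvgD; first exact: cvgM.
    by apply: cvgM => //; apply: cvgM => //; apply: cvgM.
  apply: cvgD => //; apply: cvgM => //; apply: cvgD; last exact: cvgM.
  exact: cvgD.
apply/subr_cvg0; apply: norm_cvg0; apply: (@squeeze_cvgr _ _ _ _ (cst 0) B) => //.
- near=> n; rewrite normr_ge0 /=.
  have n60 : (60 <= n)%N by near: n; exact: nbhs_infty_ge.
  have n1 : (1 < n)%N by apply: leq_trans n60.
  set F := fun k : nat => h ((comm_mean n - k%:R) * d n).
  have F1 k : `|F k| <= 1 * (5 / 4) ^+ k.
    rewrite mul1r; have /andP[a0 a1] := h01 ((comm_mean n - k%:R) * d n).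
    by rewrite ger0_norm // (le_trans a1) // exprn_ege1 //; lra.
  (* For the sign character: consecutive arguments of [h] differ by [d n], which tends to 0. *)
  have F2 k : `|F k.+1 - F k| <= L * d n.
    apply: le_trans (hL _ _) _.
    have -> : (comm_mean n - k.+1%:R) * d n - (comm_mean n - k%:R) * d n = - d n.
      by rewrite -(natr1 k); ring.
    by rewrite normrN ger0_norm.
  have b1 := hK n 1 F n60 F1.
  have b2 := sgn_pgf_bound n1 F2.
  have b3 := hC n (comm_mean n) (d n) (d0 n).
  have -> : comm_exp n F - gauss_mean h =
     (comm_exp n F - pexp (unif_pgf R n) F - pexp (sgn_pgf R n) F) +
     pexp (sgn_pgf R n) F + (pexp (unif_pgf R n) F - gauss_mean h) by ring.
  apply: le_trans (ler_normD _ _) _; apply: lerD.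
    apply: le_trans (ler_normD _ _) _; apply: lerD; last by [].
    by move: b1; rewrite mul1r.
  apply: le_trans b3 _; rewrite -/(e1 n).
  apply: lerD => //.
  set D := d n; set v := cycle_var R n; set w := e1 n * D.
  by rewrite le_eqVlt; apply/orP; left; apply/eqP; ring.
- exact: cvg_cst.
Unshelve. all: by end_near.
Qed.

End CommutatorLimits.

(** * From Lipschitz functions to distribution functions *)

Section ComparisonOfCdfs.
Variable R : realType.
Local Notation mu := (@lebesgue_measure R).
Local Notation cdf y := (\int[mu]_(t in `]-oo, y]) normal_pdf 0 1 t).

(* Equals 1 up to y and 0 from y + e on. *)
Definition ramp (y e t : R) : R :=
  (`|(y + e - t) / e| - `|(y + e - t) / e - 1| + 1) / 2.

Lemma ramp01 y e t : 0 <= ramp y e t <= 1.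
Proof.
rewrite /ramp; set u := _ / e.
have := ler_dist_dist u (u - 1); have -> : u - (u - 1) = 1 by rewrite opprB addrCA subrr addr0.
rewrite normr1 ler_norml.
by move/andP => [a b]; apply/andP; split; lra.
Qed.

Lemma ramp_lipschitz y e t s : 0 < e -> `|ramp y e t - ramp y e s| <= e^-1 * `|t - s|.
Proof.
move=> e0; rewrite /ramp; set u := _ / e; set v := _ / e.
have uv : `|u - v| = e^-1 * `|t - s|.
  rewrite /u /v -mulrBl normrM [`|e^-1|]gtr0_norm ?invr_gt0 // mulrC; congr (_ * _).
  by rewrite [RHS]distrC; congr (`|_|); ring.
have := ler_dist_dist u v; have := ler_dist_dist (u - 1) (v - 1).
have -> : u - 1 - (v - 1) = u - v by ring.
rewrite uv; set z := e^-1 * _; move: (`|u|) (`|v|) (`|u - 1|) (`|v - 1|) => p q r w.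
by rewrite !ler_norml => /andP[a b] /andP[c f]; apply/andP; split; lra.
Qed.

Lemma ramp_eq1 y e t : 0 < e -> t <= y -> ramp y e t = 1.
Proof.
move=> e0 ty; have u1 : 1 <= (y + e - t) / e by rewrite ler_pdivlMr // mul1r; lra.
rewrite /ramp; move: (_ / e) u1 => u u1.
by rewrite !ger0_norm; lra.
Qed.

Lemma ramp_eq0 y e t : 0 < e -> y + e <= t -> ramp y e t = 0.
Proof.
move=> e0 ty; have u1 : (y + e - t) / e <= 0.
  by rewrite pmulr_lle0 ?invr_gt0 // subr_le0.
rewrite /ramp; move: (_ / e) u1 => u u1.
by rewrite !ler0_norm; lra.
Qed.

Lemma ler_comm_exp n (F G : nat -> R) : (forall k, F k <= G k) -> comm_exp n F <= comm_exp n G.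
Proof.
move=> FG; apply: ler_wpM2l; first by rewrite invr_ge0 exprn_ge0 // ler0n.
by apply: ler_sum => a _; apply: ler_sum => b _.
Qed.

(** The indicator lies between the ramps that descend just before and just after [x]; their Gaussian
    means are compared with the distribution function at [x - q] and [x + q], where continuity
    applies. *)
Lemma comm_clt (x : R) : {for x, continuous (fun y : R => cdf y)} ->
  (fun n => comm_exp n (fun k =>
     ((comm_mean R n - k%:R) / Num.sqrt (comm_var R n) <= x)%R%:R)) @ \oo --> cdf x.
Proof.
move=> cx; apply/cvgrPdist_le => e e0.
have e20 : 0 < e / 2 by lra.
have [r /= r0 hr] : \forall r \near 0^'+, forall y, `|x - y| <= r -> `|cdf x - cdf y| <= e / 2.
  move/cvgrPdist_le : cx => /(_ _ e20) /nbhs_ballP[s /= s0 hs].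
  exists s => //= r; rewrite /= sub0r normrN => rs r0 y xy; apply: hs.
  by rewrite /ball /= (le_lt_trans xy) // -[r]gtr0_norm.
pose q := r / 2; have q0 : 0 < q by rewrite /q; move: r0 => /=; lra.
have hq y : `|x - y| <= q -> `|cdf x - cdf y| <= e / 2.
  apply: hr => //=; rewrite sub0r normrN gtr0_norm //; rewrite /q; move: r0 => /=; lra.
have lip y := comm_clt_lipschitz (ramp01 y q) (fun t s => ramp_lipschitz y t s q0).
have up : gauss_mean (ramp x q) <= cdf x + e / 2.
  apply: le_trans (_ : _ <= cdf (x + q)) _.
    by apply: gauss_mean_le (ramp01 x q) (fun t s => ramp_lipschitz x t s q0) _ _ => t /ltW; exact: ramp_eq0.
  have : `|x - (x + q)| <= q by rewrite opprD addNKr normrN gtr0_norm.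
  move/hq.
  by rewrite ler_norml; move: (cdf x) (cdf (x + q)) => a b; lra.
have lo : cdf x - e / 2 <= gauss_mean (ramp (x - q) q).
  apply: le_trans (_ : _ <= cdf (x - q)) _.
    have : `|x - (x - q)| <= q by rewrite opprB addrCA subrr addr0 gtr0_norm.
    move/hq.
    by rewrite ler_norml; move: (cdf x) (cdf (x - q)) => a b; lra.
  by apply: gauss_mean_ge (ramp01 (x - q) q) (fun t s => ramp_lipschitz (x - q) t s q0) _ _ => t; exact: ramp_eq1.
near=> n.
have a1 : `|gauss_mean (ramp x q) - comm_exp n (fun k => ramp x q
    ((comm_mean R n - k%:R) / Num.sqrt (comm_var R n)))| <= e / 2.
  by near: n; move/cvgrPdist_le: (lip x); apply.
have a2 : `|gauss_mean (ramp (x - q) q) - comm_exp n (fun k => ramp (x - q) q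
    ((comm_mean R n - k%:R) / Num.sqrt (comm_var R n)))| <= e / 2.
  by near: n; move/cvgrPdist_le: (lip (x - q)); apply.
set I := comm_exp n _.
have b1 : I <= comm_exp n (fun k => ramp x q ((comm_mean R n - k%:R) / Num.sqrt (comm_var R n))).
  apply: ler_comm_exp => k; case: (leP ((comm_mean R n - k%:R) / Num.sqrt (comm_var R n)) x) => [h|_]; first by rewrite ramp_eq1.
  by have /andP[] := ramp01 x q ((comm_mean R n - k%:R) / Num.sqrt (comm_var R n)).
have b2 : comm_exp n (fun k => ramp (x - q) q
    ((comm_mean R n - k%:R) / Num.sqrt (comm_var R n))) <= I.
  apply: ler_comm_exp => k; case: (leP ((comm_mean R n - k%:R) / Num.sqrt (comm_var R n)) x) => [_|h].
    by have /andP[] := ramp01 (x - q) q ((comm_mean R n - k%:R) / Num.sqrt (comm_var R n)).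
  by rewrite ramp_eq0 // subrK ltW.
move: a1 a2 b1 b2 up lo; rewrite !ler_norml.
move: (comm_exp _ _) (comm_exp _ _) (gauss_mean _) (gauss_mean _) (cdf x) I => c1 c2 g1 g2 f i.
by move=> /andP[a1 a2] /andP[a3 a4] b1 b2 up lo; apply/andP; split; lra.
Unshelve. all: by end_near.
Qed.

End ComparisonOfCdfs.

(** * Vertices of origamis *)

Section Vertices.
Variables (n : nat) (sa sb : 'S_n).

Let u := [~ sa^-1, sb^-1]%g.

Let uE i : u i = (sb^-1 (sa^-1 (sb (sa i))))%g.
Proof. by rewrite /u commgEl conjgE !invgK !permM. Qed.

(* Turning around a vertex through the four squares meeting there leads from
   the top right corner of i to that of u i; this gives the square whose top
   right corner is met on the way from the corner c. *)
Let top_right (c : corner n) : 'I_n :=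
  let: (i, r, t) := c in
  (if r then if t then i else sb^-1 i
   else if t then sa^-1 i else sa^-1 (sb^-1 i))%g.

Let e : rel (corner n) := fun c c' => glued sa sb c c' || glued sa sb c' c.

Let e_sym : connect_sym e.
Proof. by apply: sym_connect_sym => x y; rewrite /e orbC. Qed.

Let glued_top_right c c' : glued sa sb c c' ->
  porbit u (top_right c) = porbit u (top_right c').
Proof.
case: c => [[i r] t]; case: c' => [[i' r'] t'] /=.
case/orP => /and4P[-> /negbTE-> /eqP<- /eqP->]; rewrite !permK; last by case: r.
(* Only a gluing of bottom corners across a vertical edge changes [top_right], by one step of
   [u]. *)
case: t => //; apply/eqP; rewrite eq_porbit_mem; apply/porbitP; exists 1%N.
by rewrite expg1 uE !permKV permK.
Qed.

Let equiv_top_right c c' : corner_equiv sa sb c c' ->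
  porbit u (top_right c) = porbit u (top_right c').
Proof.
move/connectP => [p]; elim: p c => [|x p IH] c /=; first by move=> _ ->.
case/andP => ex ep lp; rewrite -(IH x ep lp).
by case/orP: ex => /glued_top_right.
Qed.

Let glue_h i t : corner_equiv sa sb (i, true, t) (sa i, false, t).
Proof. by apply: connect1; rewrite /= !eqxx. Qed.

Let glue_v i r : corner_equiv sa sb (i, r, true) (sb i, r, false).
Proof. by apply: connect1; rewrite /= !eqxx orbT. Qed.

Let corner_top_right c : corner_equiv sa sb c (top_right c, true, true).
Proof.
case: c => [[i []] []] /=; first exact: connect0.
all: rewrite /corner_equiv -/e e_sym.
- by rewrite -{2}[i](permKV sb); exact: glue_v.
- by rewrite -{2}[i](permKV sa); exact: glue_h.
- apply: (@connect_trans _ e (sb^-1 i, false, true)%g); last by rewrite -{2}[i](permKV sb); exact: glue_v.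
  by rewrite -{2}[(sb^-1)%g i](permKV sa); exact: glue_h.
Qed.

Let top_right_step i : corner_equiv sa sb (i, true, true) (u i, true, true).
Proof.
rewrite uE; apply: connect_trans (glue_h i true) _.
apply: connect_trans (glue_v _ _) _.
rewrite /corner_equiv -/e; apply: (@connect_trans _ e ((sa^-1)%g (sb (sa i)), true, false)).
  by rewrite e_sym -{2}[sb (sa i)](permKV sa); exact: glue_h.
by rewrite e_sym -{2}[(sa^-1)%g (sb (sa i))](permKV sb); exact: glue_v.
Qed.

(** Gluing preserves the orbit of [top_right]. Conversely every corner is equivalent to the top
    right corner of its [top_right], and one can pass along the orbit by [top_right_step]. *)
Lemma corner_equivE c c' :
  corner_equiv sa sb c c' = (porbit u (top_right c) == porbit u (top_right c')).
Proof.
apply/idP/eqP => [|h]; first exact: equiv_top_right.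
apply: connect_trans (corner_top_right c) _.
rewrite e_sym; apply: connect_trans (corner_top_right c') _.
have : top_right c \in porbit u (top_right c') by rewrite -h porbit_id.
case/porbitP => i ->; elim: i => [|i IH]; first by rewrite expg0 perm1 connect0.
by rewrite expgSr permM; apply: connect_trans IH (top_right_step _).
Qed.

Lemma card_vertices : #|vertices sa sb| = #|porbits [~ sa^-1, sb^-1]%g|.
Proof.
rewrite /vertices /equivalence_partition.
pose g c := porbit u (top_right c).
pose h (z : {set 'I_n}) : {set corner n} := [set c | z == g c]%SET.
have -> : [set [set y in [set: corner n] | corner_equiv sa sb x y] | x in [set: corner n]]%SET
    = (h @: porbits u)%SET.
  have -> : porbits u = [set g x | x in [set: corner n]]%SET.
    apply/setP => z; apply/imsetP/imsetP => [[i _ ->]|[c _ ->]]; last by exists (top_right c).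
    by exists (i, true, true).
  rewrite -imset_comp; apply: eq_imset => c /=.
  by apply/setP => c'; rewrite !inE corner_equivE.
rewrite card_in_imset // => _ y /imsetP[i _ ->] hy /setP /(_ (i, true, true)).
by rewrite !inE /g /= eqxx => /esym /eqP ->.
Qed.

End Vertices.

Section CommExpLinear.
Variable R : realType.
Implicit Types (F G : nat -> R).

Lemma comm_exp_cst n (a : R) : comm_exp n (fun=> a) = a.
Proof.
have f0 : n`!%:R != 0 :> R by rewrite pnatr_eq0 -lt0n fact_gt0.
rewrite /comm_exp !sumr_const card_Sn -!mulrnA -[a *+ _]mulr_natl natrM expr2 mulrA.
by rewrite mulVf ?mul1r // mulf_neq0.
Qed.

Lemma comm_expD n F G : comm_exp n (fun k => F k + G k) = comm_exp n F + comm_exp n G.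
Proof.
rewrite /comm_exp -mulrDr -big_split; congr (_ * _).
by apply: eq_bigr => a _; rewrite -big_split.
Qed.

Lemma comm_expZ n (a : R) F : comm_exp n (fun k => a * F k) = a * comm_exp n F.
Proof.
rewrite /comm_exp mulrCA; congr (_ * _).
by rewrite mulr_sumr; apply: eq_bigr => b _; rewrite mulr_sumr.
Qed.

Lemma eq_comm_exp n F G : F =1 G -> comm_exp n F = comm_exp n G.
Proof. by move=> FG; congr (_ * _); apply: eq_bigr => a _; apply: eq_bigr => b _. Qed.

Lemma comm_exp_sqr n : comm_exp n (fun k => (comm_mean R n - k%:R) ^+ 2) = comm_var R n.
Proof.
set m := comm_mean R n.
rewrite (eq_comm_exp _ (G := fun k => m ^+ 2 + ((- 2 * m) * k%:R + k%:R ^+ 2))); last first.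
  by move=> k /=; ring.
rewrite comm_expD comm_expD comm_exp_cst comm_expZ /comm_var -/m.
by rewrite -[comm_exp n (fun k => k%:R)]/m; ring.
Qed.

End CommExpLinear.

(** * Random origamis *)

Section RandomPair.
Context d (T : measurableType d) (R : realType) (P : probability T R) (n : nat).
Variables s1 s2 : {RV P >-> 'S_n}.
Hypothesis u1 : uniform_perm s1.
Hypothesis u2 : uniform_perm s2.
Hypothesis ind : independent_RV s1 s2.

Let A (p : 'S_n * 'S_n) := s1 @^-1` [set p.1] `&` s2 @^-1` [set p.2].

Let mA p : measurable (A p).
Proof.
by apply: measurableI; rewrite -[X in measurable X]setTI;
  apply: measurable_funPT => //.
Qed.

Let PA p : P (A p) = ((n`!%:R ^+ 2)^-1)%:E.
Proof. by rewrite /A ind // u1 u2 -EFinM -invfM expr2. Qed.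

Lemma pair_expectation (G : 'S_n -> 'S_n -> R) :
  'E_P[fun w => G (s1 w) (s2 w)]%E =
  ((n`!%:R ^+ 2)^-1 * \sum_(a : 'S_n) \sum_(b : 'S_n) G a b)%:E.
Proof.
rewrite unlock.
have GE w : ((G (s1 w) (s2 w))%:E = \sum_(p : 'S_n * 'S_n) (G p.1 p.2)%:E * (\1_(A p) w)%:E)%E.
  rewrite (bigD1 (s1 w, s2 w)) //= big1 ?adde0; last first.
    move=> [p q] /= /eqP pq; rewrite indicE memNset ?mule0 // /A /= => -[] /= e1 e2.
    by apply: pq; rewrite e1 e2.
  by rewrite indicE mem_set ?mule1.
rewrite (eq_integral (fun w => \sum_(p : 'S_n * 'S_n) (G p.1 p.2)%:E * (\1_(A p) w)%:E)%E); last first.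
  by move=> w _; exact: GE.
rewrite integral_sum //; last first.
  by move=> p; apply: integrableZl => //; exact: integrable_indic.
have iA p : (\int[P]_x (\1_(A p) x)%:E = ((n`!%:R ^+ 2)^-1)%:E)%E.
  by rewrite integral_indic // setIT; exact: PA.
rewrite (pair_bigA _ (fun a b => G a b)) mulr_sumr -sumEFin.
apply: eq_bigr => p _; rewrite integralZl //; last exact: integrable_indic.
by rewrite iA -EFinM mulrC.
Qed.

(** [card_vertices] gives the commutator of the inverses; inversion permutes the group, so the
    average over all pairs is the same. *)
Lemma commutator_expectation (F : nat -> R) :
  'E_P[fun w => F #|vertices (s1 w) (s2 w)|]%E = (comm_exp n F)%:E.
Proof.
rewrite (pair_expectation (fun a b => F #|vertices a b|)); congr (_ * _)%:E.
rewrite (reindex_inj invg_inj); apply: eq_bigr => a _.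
rewrite (reindex_inj invg_inj); apply: eq_bigr => b _.
by rewrite card_vertices !invgK.
Qed.

Lemma commutator_probability (Q : pred nat) :
  P [set w | Q #|vertices (s1 w) (s2 w)|] = (comm_exp n (fun k => (Q k)%:R))%:E.
Proof.
rewrite -commutator_expectation [@expectation]unlock.
set B := [set w | _].
have mB : measurable B.
  (* Measurability comes from the two permutations: [B] is a finite union of events that prescribe
     both. *)
  have -> : B = \bigcup_(p in [set p | Q #|vertices p.1 p.2|]) A p.
    apply/seteqP; split=> [w Bw|w [[p q] /= Qpq [/= e1 e2]]]; first by exists (s1 w, s2 w) => //; split.
    by rewrite /B /= e1 e2.
  by apply: fin_bigcup_measurable => //; exact: finite_finset.
transitivity (P (B `&` setT)); first by rewrite setIT.
rewrite -integral_indic //; apply: eq_integral => w _.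
by rewrite indicE /B /= mem_setE.
Qed.

Let X w : R := genus R (s1 w) (s2 w).
Let m := comm_mean R n.

Let XE w : X w = 1 + n%:R / 2 - #|vertices (s1 w) (s2 w)|%:R / 2.
Proof.
rewrite /X /genus /euler_char; move: #|_| => k.
by rewrite mul2n -addnn !rmorphD rmorphN /= -!pmulrn natrD; field.
Qed.

Lemma genus_mean : 'E_P[X]%E = (1 + n%:R / 2 - m / 2)%:E.
Proof.
have -> : X = fun w => 1 + n%:R / 2 + (- 2^-1) * #|vertices (s1 w) (s2 w)|%:R.
  by apply/funext => w; rewrite XE mulNr [_^-1 * _]mulrC.
rewrite (commutator_expectation (fun k => 1 + n%:R / 2 + (- 2^-1) * k%:R)).
by rewrite comm_expD comm_exp_cst comm_expZ mulNr [_^-1 * _]mulrC.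
Qed.

Let XmE w : X w - fine 'E_P[X]%E = (m - #|vertices (s1 w) (s2 w)|%:R) / 2.
Proof. by rewrite genus_mean /= XE; move: #|_|%:R => k; field. Qed.

Lemma genus_stddev : stddev P X = Num.sqrt (comm_var R n) / 2.
Proof.
rewrite /stddev /variance covariance.unlock.
have -> : ((X \- cst (fine 'E_P[X]%E)) * (X \- cst (fine 'E_P[X]%E)))%R =
    fun w => (1 / 4) * (m - #|vertices (s1 w) (s2 w)|%:R) ^+ 2.
  apply/funext => w; transitivity ((X w - fine 'E_P[X]%E) * (X w - fine 'E_P[X]%E)) => //.
  by rewrite XmE; move: #|_|%:R => k; field.
rewrite (commutator_expectation (fun k => (1 / 4) * (m - k%:R) ^+ 2)) comm_expZ comm_exp_sqr /=.
have -> : 1 / 4 = (2^-1) ^+ 2 :> R by field.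
by rewrite sqrtrM ?sqr_ge0 // sqrtr_sqr ger0_norm ?invr_ge0 // mulrC.
Qed.

Lemma genus_cdf (x : R) :
  P ((fun w => (X w - fine 'E_P[X]%E) / stddev P X) @^-1` `]-oo, x]) =
  (comm_exp n (fun k => ((m - k%:R) / Num.sqrt (comm_var R n) <= x)%R%:R))%:E.
Proof.
rewrite -(commutator_probability (fun k => (m - k%:R) / Num.sqrt (comm_var R n) <= x)).
congr (P _); apply/funext => w /=; rewrite in_itv /= XmE genus_stddev.
by rewrite invfM invrK [_^-1 * 2]mulrC mulrA divfK.
Qed.

End RandomPair.

Theorem theorem3p3p1 (R : realType) (d : nat -> measure_display)
    (T : forall n, measurableType (d n)) (P : forall n, probability (T n) R)
    (sa sb : forall n, {RV (P n) >-> 'S_n})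
    (unif_sa : forall n, (0 < n)%N -> uniform_perm (sa n))
    (unif_sb : forall n, (0 < n)%N -> uniform_perm (sb n))
    (indep : forall n, (0 < n)%N -> independent_RV (sa n) (sb n)) :
  let X n (w : T n) : R := genus R (sa n w) (sb n w) in
  let g : R := euler_gamma R in
  [/\ exists2 eps : nat -> R, eps =o_\oo (fun=> 1 : R) &
        forall n, (0 < n)%N ->
          ('E_(P n)[X n] =
            (- (1 / 2) * (ln n%:R + g + eps n) + 1 + n%:R / 2)%:E)%E,
      exists2 eps : nat -> R,
        eps =o_\oo (fun n => (Num.sqrt (ln n%:R))^-1 : R) &
        forall n, (1 < n)%N ->
          stddev (P n) (X n) =
            1 / 2 * (Num.sqrt (ln n%:R)
                     - (pi ^+ 2 / 12 - g / 2) * (Num.sqrt (ln n%:R))^-1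
                     + eps n) &
      cvg_in_distribution P
        (fun n w => (X n w - fine 'E_(P n)[X n]) / stddev (P n) (X n))
        (normal_prob 0 1)].
Proof.
move=> X g; split.
(* [eps] is the exact error, so that the formula is an identity and only its order remains to be
   shown; likewise for the standard deviation. *)
- exists (fun n => comm_mean R n - ln n%:R - g).
    apply/eqoP => e e0.
    have c : (fun n => comm_mean R n - ln n%:R - g) @ \oo --> (0 : R).
      by rewrite -[X in _ --> X](subrr g); apply: cvgB; [exact: cvg_mean|exact: cvg_cst].
    near=> n; rewrite normr1 mulr1; near: n.
    by apply: (cvgr0_norm_le _ c).
  move=> n n0; rewrite (genus_mean (unif_sa _ n0) (unif_sb _ n0) (indep _ n0)); congr (_%:E).
  by move: (comm_mean R n) (ln _) => a b; field.
- exists (fun n => Num.sqrt (comm_var R n) - Num.sqrt (ln n%:R)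
      + (pi ^+ 2 / 12 - g / 2) * (Num.sqrt (ln n%:R))^-1).
    apply/eqoP => e e0.
    have c := sqrt_expansion (@cvg_comm_var R).
    near=> n.
    have l0 : 0 < Num.sqrt (ln n%:R : R).
      by rewrite sqrtr_gt0 ln_gt0 // ltr1n; near: n; exact: nbhs_infty_gt.
    rewrite normfV [`|Num.sqrt (ln _)|]gtr0_norm // ler_pdivlMr //.
    rewrite -[X in _ * X](gtr0_norm l0) -normrM.
    (* The coefficient is minus half of the limit in [cvg_comm_var], as [sqrt_expansion] demands. *)
    have -> : pi ^+ 2 / 12 - g / 2 = - ((euler_gamma R - pi ^+ 2 / 6) / 2) by rewrite /g; field.
    rewrite mulNr; near: n; exact: (cvgr0_norm_le _ c).
  move=> n n1; have n0 := ltnW n1.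
  rewrite (genus_stddev (unif_sa _ n0) (unif_sb _ n0) (indep _ n0)).
  have key (a b c : R) : a / 2 = 1 / 2 * (b - c + (a - b + c)) by field.
  exact: key.
- move=> x cx.
  have phiE y : normal_prob 0 1 `]-oo, y] =
      (\int[@lebesgue_measure R]_(t in `]-oo, y]) normal_pdf 0 1 t)%:E.
    rewrite /Rintegral fineK //.
    apply: integrable_fin_num => //.
    exact: (integrableS _ _ _ (@integrable_normal_pdf R 0 1)).
  have cx' : {for x, continuous (fun y : R =>
      \int[@lebesgue_measure R]_(t in `]-oo, y]) normal_pdf 0 1 t)}.
    by apply: fine_cvg; rewrite -phiE; move: cx; apply: cvg_trans.
  rewrite phiE; apply: cvg_EFin.
    near=> n; have n0 : (0 < n)%N by near: n; exact: nbhs_infty_gt.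
    by rewrite (genus_cdf (unif_sa _ n0) (unif_sb _ n0) (indep _ n0)).
  apply: cvg_trans (comm_clt cx'); apply: near_eq_cvg; near=> n.
  have n0 : (0 < n)%N by near: n; exact: nbhs_infty_gt.
  by rewrite /= (genus_cdf (unif_sa _ n0) (unif_sb _ n0) (indep _ n0)).
Unshelve. all: by end_near.
Qed.
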